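(* Let $\alpha\in[-1,1]$ and let $B$ be a finite Blaschke product of degree at least $1$. Then there exists a norm $\|\cdot\|_{B}$ on $D_\alpha$, induced by an inner product and equivalent to the usual norm $\|\cdot\|_\alpha$, under which $B$ has the wandering subspace property in $D_\alpha$; that is, for every closed subspace $\mathcal{M}\subseteq D_\alpha$ with $B\mathcal{M}\subseteq\mathcal{M}$, $$[\mathcal{M}\ominus B\mathcal{M}]_{B}=\mathcal{M},$$ where the orthogonal complement $\mathcal{M}\ominus B\mathcal{M}$ is taken with respect to the inner product inducing $\|\cdot\|_B$. Moreover, if $B(z)=z^k$ for an integer $k\ge 1$ and $|\alpha|\in\left[0,\frac{\log 2}{\log(k+1)}\right]$, then the norm $\|\cdot\|_B$ can be taken to be the usual norm $\|\cdot\|_\alpha$ (so the wandering subspace property holds for $z^k$ in $D_\alpha$ with its usual norm).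
   Context: Let $\mathbb{D}$ be the open unit disc in $\mathbb{C}$. For $\alpha\in\mathbb{R}$, $D_\alpha$ is the space of analytic functions $f(z)=\sum_{j\ge0}a_jz^j$ on $\mathbb{D}$ with finite usual norm $\|f\|_\alpha=\left(\sum_{j\ge0}|a_j|^2(j+1)^\alpha\right)^{1/2}$; it is a Hilbert space. A finite Blaschke product is a function $B(z)=e^{i\theta}\prod_{i=1}^{N}\frac{z-\alpha_i}{1-\overline{\alpha_i}z}$ with $\theta\in\mathbb{R}$ and $\alpha_i\in\mathbb{D}$ (repetitions allowed); its degree is $N$. Multiplication by $B$, $M_B:f\mapsto Bf$, is a bounded operator on $D_\alpha$. For a subset $\mathcal{K}\subseteq D_\alpha$, $[\mathcal{K}]_{B}$ denotes the smallest closed subspace of $D_\alpha$ that contains $\mathcal{K}$ and is invariant under $M_B$. For $\mathcal{M}$ a closed invariant subspace, $\mathcal{M}\ominus B\mathcal{M}$ is the set of elements of $\mathcal{M}$ orthogonal to $B\mathcal{M}$ in the specified inner product. *)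

(* Defs.v *)
From Stdlib Require Import Reals List ClassicalEpsilon.
From Coquelicot Require Import Coquelicot.

Open Scope R_scope.

(** * Functions on the open unit disc *)

Definition unit_disc : Type := {z : C | Cmod z < 1}.

Definition dfun : Type := unit_disc -> C.

Definition fzero : dfun := fun _ => RtoC 0.
Definition fadd (f g : dfun) : dfun := fun z => Cplus (f z) (g z).
Definition fscal (c : C) (f : dfun) : dfun := fun z => Cmult c (f z).
Definition fsub (f g : dfun) : dfun := fun z => Cminus (f z) (g z).
Definition fmul (f g : dfun) : dfun := fun z => Cmult (f z) (g z).

(** * The spaces [D_alpha] *)

Definition taylor (f : dfun) (a : nat -> C) : Prop :=
  forall z : unit_disc, is_pseries a (proj1_sig z) (f z).

Definition analytic (f : dfun) : Prop := exists a, taylor f a.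

(* The Taylor coefficients of an analytic [f]: they are unique, so the choice
   made by [epsilon] is immaterial.  No meaning when [f] is not analytic. *)
Definition coef (f : dfun) : nat -> C :=
  epsilon (inhabits (fun _ : nat => RtoC 0)) (taylor f).

Definition weighted_sq (alpha : R) (f : dfun) (j : nat) : R :=
  Cmod (coef f j) ^ 2 * Rpower (INR (j + 1)) alpha.

Definition Dspace (alpha : R) (f : dfun) : Prop :=
  analytic f /\ ex_series (weighted_sq alpha f).

Definition usual_norm (alpha : R) (f : dfun) : R :=
  sqrt (Series (weighted_sq alpha f)).

(** * Subspaces of [D_alpha] *)

Definition subset_of (K M : dfun -> Prop) : Prop := forall f, K f -> M f.

Definition same_set (K M : dfun -> Prop) : Prop := forall f, K f <-> M f.

Definition subspace (alpha : R) (M : dfun -> Prop) : Prop :=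
  subset_of M (Dspace alpha) /\
  M fzero /\
  (forall f g, M f -> M g -> M (fadd f g)) /\
  (forall c f, M f -> M (fscal c f)).

(* [M] contains all its adherent points in [D_alpha], for the usual norm. *)
Definition norm_closed (alpha : R) (M : dfun -> Prop) : Prop :=
  forall f, Dspace alpha f ->
    (forall eps, 0 < eps ->
       exists g, M g /\ usual_norm alpha (fsub f g) < eps) ->
    M f.

Definition closed_subspace (alpha : R) (M : dfun -> Prop) : Prop :=
  subspace alpha M /\ norm_closed alpha M.

Definition mul_image (B : dfun) (M : dfun -> Prop) : dfun -> Prop :=
  fun h => exists f, M f /\ h = fmul B f.

Definition invariant (B : dfun) (M : dfun -> Prop) : Prop :=
  subset_of (mul_image B M) M.

(* [[K]_B], the smallest [M_B]-invariant closed subspace containing [K], as the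
   intersection of all of them. *)
Definition generated (alpha : R) (B : dfun) (K : dfun -> Prop) : dfun -> Prop :=
  fun f => forall M, closed_subspace alpha M -> invariant B M ->
                     subset_of K M -> M f.

(** * Inner products on [D_alpha] *)

(* Inner products and norms on [D_alpha] are total functions on [dfun] of which
   only the values on [D_alpha] matter. *)
Definition inner_product (alpha : R) (ip : dfun -> dfun -> C) : Prop :=
  (forall f g h, Dspace alpha f -> Dspace alpha g -> Dspace alpha h ->
     ip (fadd f g) h = Cplus (ip f h) (ip g h)) /\
  (forall c f g, Dspace alpha f -> Dspace alpha g ->
     ip (fscal c f) g = Cmult c (ip f g)) /\
  (forall f g, Dspace alpha f -> Dspace alpha g -> ip g f = Cconj (ip f g)) /\
  (forall f, Dspace alpha f -> 0 <= Re (ip f f)) /\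
  (forall f, Dspace alpha f -> ip f f = RtoC 0 -> f = fzero).

Definition induces (alpha : R) (ip : dfun -> dfun -> C) (nrm : dfun -> R)
  : Prop :=
  forall f, Dspace alpha f -> nrm f = sqrt (Re (ip f f)).

Definition equivalent_norms (alpha : R) (nrm1 nrm2 : dfun -> R) : Prop :=
  exists c1 c2, 0 < c1 /\ 0 < c2 /\
    forall f, Dspace alpha f -> c1 * nrm2 f <= nrm1 f <= c2 * nrm2 f.

Definition ominus (ip : dfun -> dfun -> C) (M N : dfun -> Prop)
  : dfun -> Prop :=
  fun f => M f /\ forall h, N h -> ip f h = RtoC 0.

Definition wandering_subspace_property
  (alpha : R) (ip : dfun -> dfun -> C) (B : dfun) : Prop :=
  forall M, closed_subspace alpha M -> invariant B M ->
    same_set (generated alpha B (ominus ip M (mul_image B M))) M.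

(* The inner product inducing [nrm] is unique on [D_alpha], by polarization. *)
Definition wandering_for_norm (alpha : R) (nrm : dfun -> R) (B : dfun) : Prop :=
  exists ip, inner_product alpha ip /\ induces alpha ip nrm /\
             wandering_subspace_property alpha ip B.

(** * Finite Blaschke products *)

Definition blaschke_factor (a z : C) : C :=
  Cdiv (Cminus z a) (Cminus (RtoC 1) (Cmult (Cconj a) z)).

Definition finite_blaschke (N : nat) (B : dfun) : Prop :=
  exists (theta : R) (zeros : list unit_disc),
    length zeros = N /\
    forall z : unit_disc,
      B z = Cmult (cos theta, sin theta)
              (fold_right Cmult (RtoC 1)
                 (map (fun a => blaschke_factor (proj1_sig a) (proj1_sig z))
                    zeros)).

(* Main.v *)
(* The new norm is diagonal in the Taylor coefficients.  On the circle [|z|^2 = r]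
   the mean of [|f|^2] is [|f|_r^2 = sum_j r^j |a_j|^2], and pointwise
   [|f|^2 - 2 |B f|^2 + |B^2 f|^2 = (1 - |B|^2)^2 |f|^2 >= 0]; since [B] is isometric
   on [H^2], every weight [Q_j = C + sum_i c_i (1 - r_i^j)] with [c_i >= 0] makes [B]
   concave.  Such weights realise all the growths [(j+1)^s] with [0 <= s <= 1].  If
   moreover some [r_i = r0] is close to 1 and [C] is large, then
   [|B* x|_Q^2 + |B x|_Q^2 <= 2 |x|_Q^2], with [B*] the adjoint on [H^2]: writing
   [x = h + B y] with [h] orthogonal to [B H^2], the coefficients of [h] decay
   exponentially, so the cross terms only involve [|h|] and [|y|_{r0}], and these are
   absorbed by [C |h|^2] and by the defect on the circle [r0].
   For [alpha >= 0] use the weight [Q] and Richter's theorem on concave operators.  For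
   [alpha < 0] use the weight [1/Q]: dualising the inequality yields Shimorin's condition
   [|B f + g|^2 <= 2 (|f|^2 + |B g|^2)].  For [B = z^k] the weight
   [Q_j = (j+1)^|alpha|] satisfies the same inequality as soon as
   [(k+1)^|alpha| <= 2]. *)
Require Import Defs.
From Stdlib Require Import Reals Arith List Lra Lia Classical ClassicalEpsilon FunctionalExtensionality.
From Coquelicot Require Import Coquelicot.

Open Scope R_scope.

(** Both abstract theorems need purity: no nonzero vector in the range of every [T^n], and weak
    decay of bounded vectors [T^n v_n]. One quadratic quantity [pp], the mean square on a circle
    inside the disc, supplies both: [B] contracts it by a fixed factor, and it controls the pairing
    with a fixed vector up to an arbitrarily small multiple of the squared norm. Concavity is the
    inequality restricted to [x = B y]. Its dual form, for [alpha < 0], needs every [x], and then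
    the cross terms between [h] and [B y] have no sign; this is the obstacle behind the extra
    summands of the weight. The unweighted pairing serves as the duality between the weights [Q] and
    [1/Q], so identities for [B] are proved with the two arguments in different weighted spaces.
    Real Hilbert spaces suffice: invariant subspaces are complex, and real orthogonality to both [h]
    and [i h] is complex orthogonality. Functions are handled through their coefficients: means over
    circles become weighted sums, and dividing by [1 - b z] becomes a recursion. *)

(** * Real inequalities and concave sequences *)

(** Discriminant argument, tested at [s = p / A]. It yields [cauchy_schwarz] and
    [pairing_cauchy_schwarz], and with [B = 0] the vanishing of a first-order term. *)
Lemma quadratic_form_bound (A B p : R) :
  0 <= A -> (forall s, 2 * s * p <= s ^ 2 * A + B) -> p ^ 2 <= A * B.
Proof.
intros HA H. destruct (Req_dec A 0) as [->|hA].
- destruct (Req_dec p 0) as [->|hp]; [lra|].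
  pose proof (H 0) as h0. specialize (H ((B + 1) / p)).
  replace (2 * ((B + 1) / p) * p) with (2 * (B + 1)) in H by (field; auto).
  lra.
- assert (0 < A) by lra.
  specialize (H (p / A)).
  replace (2 * (p / A) * p) with (2 * (p ^ 2 / A)) in H by (field; lra).
  replace ((p / A) ^ 2 * A) with (p ^ 2 / A) in H by (field; lra).
  assert (p ^ 2 / A <= B) by lra.
  replace (p ^ 2) with (A * (p ^ 2 / A)) by (field; lra).
  nra.
Qed.

Lemma le_of_pow2_le (a b : R) : 0 <= b -> a ^ 2 <= b ^ 2 -> a <= b.
Proof. intros. apply Rnot_lt_le; intros h. nra. Qed.

Lemma le_of_le_add_eps (a b : R) : (forall e, 0 < e -> a <= b + e) -> a <= b.
Proof.
intros H. destruct (Rle_dec a b) as [|h]; [trivial|].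
specialize (H ((a - b) / 2)). lra.
Qed.

Lemma concave_step_bound (a : nat -> R) :
  (forall n, a (S (S n)) + a n <= 2 * a (S n)) ->
  forall n, a n <= a O + INR n * (a 1%nat - a O).
Proof.
intros H.
assert (Hd : forall n, a (S n) - a n <= a 1%nat - a O).
{ induction n; [lra|]. specialize (H n). lra. }
induction n; [simpl; lra|].
rewrite S_INR. specialize (Hd n). lra.
Qed.

(** A negative first increment would, by concavity, drive the sequence below 0. This turns concavity
    of an operator into expansivity. *)
Lemma concave_nonneg_incr (a : nat -> R) :
  (forall n, 0 <= a n) ->
  (forall n, a (S (S n)) + a n <= 2 * a (S n)) -> a O <= a 1%nat.
Proof.
intros Hp H. apply Rnot_lt_le; intros hlt.
pose proof (concave_step_bound a H) as Hb.
destruct (INR_unbounded (a O / (a O - a 1%nat))) as [n hn].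
specialize (Hb n). specialize (Hp n).
assert (a O < INR n * (a O - a 1%nat)); [|lra].
apply Rmult_lt_reg_r with (/ (a O - a 1%nat)).
- apply Rinv_0_lt_compat; lra.
- rewrite Rmult_assoc, Rinv_r by lra. unfold Rdiv in hn. lra.
Qed.

Lemma pow_small_eventually (rho K e : R) :
  0 <= rho < 1 -> 0 <= K -> 0 < e ->
  exists N, forall n, (N <= n)%nat -> K * rho ^ n < e.
Proof.
intros hr hK he.
destruct (pow_lt_1_zero rho) with (y := e / (K + 1)) as [N HN].
- rewrite Rabs_pos_eq; lra.
- apply Rdiv_lt_0_compat; lra.
- exists N. intros n hn. specialize (HN n hn).
  pose proof (pow_le rho n (proj1 hr)).
  rewrite Rabs_pos_eq in HN by auto.
  apply Rle_lt_trans with ((K + 1) * rho ^ n); [nra|].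
  apply Rmult_lt_reg_l with (/ (K + 1)).
  + apply Rinv_0_lt_compat; lra.
  + rewrite <- Rmult_assoc, Rinv_l by lra. unfold Rdiv in HN. lra.
Qed.

Lemma kernel_op_succ_small (e : R) :
  0 < e -> exists N, forall n, (N <= n)%nat -> / (INR n + 1) < e.
Proof.
intros he. destruct (INR_unbounded (/ e)) as [N hN]. exists N. intros n hn.
apply le_INR in hn. rewrite <- (Rinv_inv e).
pose proof (Rinv_0_lt_compat e he).
apply Rinv_lt_contravar; [apply Rmult_lt_0_compat|]; lra.
Qed.

(** * Wandering subspaces in real Hilbert spaces *)

Section RealHilbertSpace.

Variables (E : Type) (D : E -> Prop) (add : E -> E -> E) (scal : R -> E -> E)
  (ip : E -> E -> R).

Let sub (f g : E) : E := add f (scal (-1) g).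
Let nn (f : E) : R := ip f f.

(* The operations are only constrained on the domain [D]; no module axioms are
   needed since vectors are identified through [rh_def]. *)
Record real_hilbert : Prop := {
  rh_add : forall f g, D f -> D g -> D (add f g);
  rh_scal : forall c f, D f -> D (scal c f);
  rh_sym : forall f g, D f -> D g -> ip f g = ip g f;
  rh_addl : forall f g h, D f -> D g -> D h -> ip (add f g) h = ip f h + ip g h;
  rh_scall : forall c f g, D f -> D g -> ip (scal c f) g = c * ip f g;
  rh_pos : forall f, D f -> 0 <= ip f f;
  rh_def : forall f g, D f -> D g -> nn (sub f g) = 0 -> f = g;
  rh_complete : forall u : nat -> E, (forall n, D (u n)) ->
    (forall e, 0 < e -> exists N, forall n m, (N <= n)%nat -> (N <= m)%nat ->
       nn (sub (u n) (u m)) < e) ->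
    exists v, D v /\
      forall e, 0 < e -> exists N, forall n, (N <= n)%nat -> nn (sub (u n) v) < e
}.

Record rh_closed_subspace (M : E -> Prop) : Prop := {
  cs_dom : forall f, M f -> D f;
  cs_ne : exists f, M f;
  cs_add : forall f g, M f -> M g -> M (add f g);
  cs_scal : forall c f, M f -> M (scal c f);
  cs_cl : forall f, D f ->
    (forall e, 0 < e -> exists g, M g /\ nn (sub f g) < e) -> M f
}.

Hypothesis H : real_hilbert.

Let Dsub f g : D f -> D g -> D (sub f g).
Proof. intros; apply (rh_add H); trivial; apply (rh_scal H); trivial. Qed.

Let ip_addr f g h : D f -> D g -> D h -> ip h (add f g) = ip h f + ip h g.
Proof.
intros. rewrite (rh_sym H), (rh_addl H), (rh_sym H f h), (rh_sym H g h); trivial.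
apply (rh_add H); trivial.
Qed.

Let ip_scalr c f g : D f -> D g -> ip g (scal c f) = c * ip g f.
Proof.
intros. rewrite (rh_sym H), (rh_scall H), (rh_sym H f g); trivial.
apply (rh_scal H); trivial.
Qed.

Let ip_subl f g h : D f -> D g -> D h -> ip (sub f g) h = ip f h - ip g h.
Proof.
intros. unfold sub. rewrite (rh_addl H), (rh_scall H); trivial; [ring|].
apply (rh_scal H); trivial.
Qed.

Let ip_subr f g h : D f -> D g -> D h -> ip h (sub f g) = ip h f - ip h g.
Proof.
intros. rewrite (rh_sym H), ip_subl, (rh_sym H f h), (rh_sym H g h); trivial.
apply Dsub; trivial.
Qed.

Let nn_sub f g : D f -> D g -> nn (sub f g) = nn f - 2 * ip f g + nn g.
Proof.
intros. unfold nn. rewrite ip_subl, !ip_subr, (rh_sym H g f); trivial; [ring|].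
apply Dsub; trivial.
Qed.

Let nn_add f g : D f -> D g -> nn (add f g) = nn f + 2 * ip f g + nn g.
Proof.
intros. unfold nn.
rewrite (rh_addl H), !ip_addr, (rh_sym H g f); trivial; [ring|].
apply (rh_add H); trivial.
Qed.

Let nn_scal c f : D f -> nn (scal c f) = c ^ 2 * nn f.
Proof.
intros. unfold nn. rewrite (rh_scall H), ip_scalr; trivial; [ring|].
apply (rh_scal H); trivial.
Qed.

Let cauchy_schwarz f g : D f -> D g -> ip f g ^ 2 <= nn f * nn g.
Proof.
intros hf hg. apply quadratic_form_bound; [apply (rh_pos H); trivial|].
intros s. pose proof (rh_pos H (sub (scal s f) g)) as h0.
fold (nn (sub (scal s f) g)) in h0.
rewrite nn_sub, nn_scal, (rh_scall H) in h0; trivial; try (apply (rh_scal H); trivial).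
assert (D (sub (scal s f) g)) by (apply Dsub; trivial; apply (rh_scal H); trivial).
specialize (h0 H0). lra.
Qed.

Let cs_sub M f g : rh_closed_subspace M -> M f -> M g -> M (sub f g).
Proof. intros hM hf hg; apply (cs_add _ hM); trivial; apply (cs_scal _ hM); trivial. Qed.

(* The vector representing [phi] minimises [nn y - 2 phi y]; by the
   parallelogram law every minimising sequence is Cauchy. *)
Lemma riesz_on_subspace M (phi : E -> R) (C : R) :
  rh_closed_subspace M ->
  (forall f g, M f -> M g -> phi (add f g) = phi f + phi g) ->
  (forall c f, M f -> phi (scal c f) = c * phi f) ->
  0 <= C ->
  (forall f, M f -> phi f ^ 2 <= C * nn f) ->
  exists v, M v /\ forall y, M y -> ip v y = phi y.
Proof.
intros hM hadd hscal hC hb.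
pose (J := fun y => nn y - 2 * phi y).
assert (HD := cs_dom _ hM).
assert (Jlow : forall y, M y -> - C <= J y).
{ intros y hy. unfold J. specialize (hb y hy).
  assert (h0 : 0 <= nn y) by (apply (rh_pos H); auto).
  assert (0 <= C + nn y) by lra.
  assert ((2 * phi y) ^ 2 <= (C + nn y) ^ 2) by (pose proof (pow2_ge_0 (C - nn y)); nra).
  assert (2 * phi y <= C + nn y) by (apply le_of_pow2_le; trivial).
  lra. }
destruct (completeness (fun r => exists y, M y /\ r = - J y)) as [s [hs1 hs2]].
{ exists C. intros r [y [hy ->]]. specialize (Jlow y hy); lra. }
{ destruct (cs_ne _ hM) as [y hy]. exists (- J y); eauto. }
set (m := - s) in *.
assert (hm : forall y, M y -> m <= J y).
{ intros y hy. specialize (hs1 (- J y)). unfold m.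
  assert (- J y <= s) by (apply hs1; eauto). lra. }
assert (hseq : forall n : nat, exists y, M y /\ J y < m + / (INR n + 1)).
{ intros n. apply NNPP. intros hno.
  assert (hpos : 0 < / (INR n + 1)).
  { apply Rinv_0_lt_compat. pose proof (pos_INR n). lra. }
  assert (s <= s - / (INR n + 1)); [|lra].
  apply hs2. intros r [y [hy ->]].
  destruct (Rlt_dec (J y) (m + / (INR n + 1))) as [hl|hl].
  - exfalso; apply hno; eauto.
  - unfold m in hl. lra. }
pose (u := fun n => proj1_sig (constructive_indefinite_description _ (hseq n))).
assert (hu : forall n, M (u n) /\ J (u n) < m + / (INR n + 1)).
{ intros n. exact (proj2_sig (constructive_indefinite_description _ (hseq n))). }
assert (hphisub : forall a b, M a -> M b -> phi (sub a b) = phi a - phi b).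
{ intros a b ha hb'. unfold sub. rewrite hadd, hscal; trivial; [ring|].
  apply (cs_scal _ hM); trivial. }
assert (hpar : forall a b, M a -> M b ->
  nn (sub a b) = 2 * J a + 2 * J b - 4 * J (scal (1/2) (add a b))).
{ intros a b ha hb'. unfold J.
  rewrite nn_sub, nn_scal, nn_add, hscal, hadd; auto.
  - field.
  - apply (cs_add _ hM); trivial.
  - apply (rh_add H); auto. }
assert (hcau : forall n k, nn (sub (u n) (u k)) <=
   2 * / (INR n + 1) + 2 * / (INR k + 1)).
{ intros n k. destruct (hu n), (hu k). rewrite hpar; trivial.
  assert (m <= J (scal (1/2) (add (u n) (u k)))).
  { apply hm. apply (cs_scal _ hM), (cs_add _ hM); trivial. }
  lra. }
destruct (rh_complete H u) as [v [hv hlim]].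
{ intros n. apply HD, hu. }
{ intros e he. destruct (kernel_op_succ_small (e / 4)) as [N hN]; [lra|].
  exists N. intros n k hn hk. specialize (hcau n k).
  pose proof (hN n hn). pose proof (hN k hk). lra. }
assert (hMv : M v).
{ apply (cs_cl _ hM); trivial. intros e he. destruct (hlim e he) as [N hN].
  exists (u N). split; [apply hu|]. specialize (hN N (le_n _)).
  rewrite nn_sub in *; auto; try (apply HD, hu).
  rewrite (rh_sym H); auto; [lra|apply HD, hu]. }
assert (hJsub : forall a b, M a -> M b ->
  J a = J b + 2 * (ip b (sub a b) - phi (sub a b)) + nn (sub a b)).
{ intros a b ha hb'. unfold J. rewrite hphisub, nn_sub, ip_subr, (rh_sym H b a); auto.
  unfold nn. ring. }
exists v. split; trivial.
(* Passage to the limit in [J (u n)]: [hJsub] expands [J] at [v], and the square of the linear term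
   is at most [2 * K] times the squared distance from [u n] to [v]. *)
assert (hJv : J v <= m).
{ apply le_of_le_add_eps. intros e he.
  set (K := Rabs (nn v) + C + 1).
  pose (e1 := Rmin 1 ((e / 2) ^ 2 / (8 * K))).
  assert (hK : 0 < K) by (unfold K; pose proof (Rabs_pos (nn v)); lra).
  assert (he1 : 0 < e1).
  { apply Rmin_pos; [lra|]. apply Rdiv_lt_0_compat; [apply pow_lt|]; lra. }
  destruct (hlim e1 he1) as [N1 hN1].
  destruct (kernel_op_succ_small (e / 2)) as [N2 hN2]; [lra|].
  set (n := (N1 + N2)%nat).
  assert (h1 := hN1 n ltac:(unfold n; lia)). assert (h2 := hN2 n ltac:(unfold n; lia)).
  destruct (hu n) as [h3 h4].
  rewrite (hJsub _ _ h3 hMv) in h4.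
  assert (hq : (ip v (sub (u n) v) - phi (sub (u n) v)) ^ 2 <= 2 * K * e1).
  { set (w := sub (u n) v) in *.
    assert (hw : M w) by (apply cs_sub; trivial).
    pose proof (cauchy_schwarz v w hv (HD _ hw)). pose proof (hb w hw).
    assert (0 <= nn w) by (apply (rh_pos H); auto).
    pose proof (Rle_abs (nn v)). pose proof (Rabs_pos (nn v)).
    assert (0 <= nn v) by (apply (rh_pos H); auto).
    assert ((nn v + C) * nn w <= K * e1).
    { apply Rmult_le_compat; trivial; [lra|unfold K; lra|lra]. }
    pose proof (pow2_ge_0 (ip v w + phi w)). lra. }
  assert (hq2 : 2 * K * e1 <= (e / 4) ^ 2).
  { apply Rle_trans with (2 * K * ((e / 2) ^ 2 / (8 * K))).
    - apply Rmult_le_compat_l; [lra|]. apply Rmin_r.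
    - right. field. lra. }
  assert (- (e / 4) <= ip v (sub (u n) v) - phi (sub (u n) v)).
  { apply Ropp_le_cancel. rewrite Ropp_involutive. apply le_of_pow2_le; lra. }
  assert (0 <= nn (sub (u n) v)) by (apply (rh_pos H); apply Dsub; auto).
  lra. }
(* first-order optimality at [v], tested along the line [v + t y] *)
intros y hy.
set (c := ip v y - phi y).
assert (hk : forall t, 0 <= 2 * t * c + t ^ 2 * nn y).
{ intros t. assert (hz : M (add v (scal t y))).
  { apply (cs_add _ hM); trivial. apply (cs_scal _ hM); trivial. }
  pose proof (hm _ hz) as h. unfold J in h, hJv. unfold c.
  rewrite nn_add, nn_scal, hadd, hscal, ip_scalr in h; auto.
  - lra.
  - apply (cs_scal _ hM); trivial.
  - apply (rh_scal H); auto. }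
assert (hc2 : c ^ 2 <= nn y * 0).
{ apply quadratic_form_bound; [apply (rh_pos H); auto|].
  intros t. specialize (hk (- t)). lra. }
assert (hc0 : c = 0) by nra. unfold c in *. lra.
Qed.

Lemma orthogonal_projection M x :
  rh_closed_subspace M -> D x ->
  exists v, M v /\ forall y, M y -> ip (sub x v) y = 0.
Proof.
intros hM hx. assert (HD := cs_dom _ hM).
destruct (riesz_on_subspace M (fun y => ip x y) (nn x)) as [v [hv1 hv2]]; trivial.
- intros; apply ip_addr; auto.
- intros; apply ip_scalr; auto.
- apply (rh_pos H); trivial.
- intros; apply cauchy_schwarz; auto.
- exists v; split; trivial. intros y hy.
  rewrite ip_subl, hv2; auto. ring.
Qed.

Lemma rh_closed_subspace_inter M M' :
  rh_closed_subspace M -> rh_closed_subspace M' -> (exists f, M f /\ M' f) ->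
  rh_closed_subspace (fun f => M f /\ M' f).
Proof.
intros hM hM' hne. split; trivial.
- intros f hf. apply (cs_dom _ hM), hf.
- intros f g [] []; split; [apply (cs_add _ hM) | apply (cs_add _ hM')]; trivial.
- intros c f []; split; [apply (cs_scal _ hM) | apply (cs_scal _ hM')]; trivial.
- intros f hf hcl; split; [apply (cs_cl _ hM) | apply (cs_cl _ hM')]; trivial;
  intros e he; destruct (hcl e he) as [g [[] ?]]; eauto.
Qed.

(** * Operators that are bounded and bounded below *)

Variables (T : E -> E) (CT cT : R).
Hypothesis TD : forall f, D f -> D (T f).
Hypothesis Tadd : forall f g, D f -> D g -> T (add f g) = add (T f) (T g).
Hypothesis Tscal : forall c f, D f -> T (scal c f) = scal c (T f).
Hypothesis Tbound : forall f, D f -> nn (T f) <= CT * nn f.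
Hypothesis Tbelow : forall f, D f -> nn f <= cT * nn (T f).

Let Tsub f g : D f -> D g -> T (sub f g) = sub (T f) (T g).
Proof. intros; unfold sub; rewrite Tadd, Tscal; trivial; apply (rh_scal H); trivial. Qed.

(** Boundedness below makes preimages of a Cauchy sequence Cauchy; boundedness above identifies the
    image of their limit. *)
Lemma closed_range M :
  rh_closed_subspace M -> rh_closed_subspace (fun f => exists g, M g /\ f = T g).
Proof.
intros hM. assert (HD := cs_dom _ hM). split.
- intros f [g [hg ->]]; auto.
- destruct (cs_ne _ hM) as [g hg]; eauto.
- intros f f' [g [hg ->]] [g' [hg' ->]]. exists (add g g').
  rewrite Tadd; auto. split; trivial. apply (cs_add _ hM); trivial.
- intros c f [g [hg ->]]. exists (scal c g). rewrite Tscal; auto. split; trivial.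
  apply (cs_scal _ hM); trivial.
- intros f hf hcl.
  assert (hseq : forall n : nat, exists g, M g /\ nn (sub f (T g)) < / (INR n + 1)).
  { intros n. destruct (hcl (/ (INR n + 1))) as [g [[g' [hg' ->]] hg]]; eauto.
    apply Rinv_0_lt_compat. pose proof (pos_INR n). lra. }
  pose (u := fun n => proj1_sig (constructive_indefinite_description _ (hseq n))).
  assert (hu : forall n, M (u n) /\ nn (sub f (T (u n))) < / (INR n + 1)).
  { intros n. exact (proj2_sig (constructive_indefinite_description _ (hseq n))). }
  (* The parallelogram law for [a - b] and [c - a], with the diagonal [2 a - b - c] dropped. *)
  assert (htri : forall a b c, D a -> D b -> D c ->
    nn (sub b c) <= 2 * nn (sub a b) + 2 * nn (sub a c)).
  { intros a b c ha hb hc.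
    assert (h0 : 0 <= nn (sub (sub a b) (sub c a))).
    { apply (rh_pos H). apply Dsub; apply Dsub; trivial. }
    rewrite nn_sub, ip_subl, !ip_subr, !nn_sub in *; try apply Dsub; trivial.
    rewrite (rh_sym H b a), (rh_sym H c a) in *; trivial.
    unfold nn in *. lra. }
  assert (hpc : 0 <= Rabs cT) by apply Rabs_pos.
  assert (Tbelow' : forall f, D f -> nn f <= (Rabs cT + 1) * nn (T f)).
  { intros g hg. specialize (Tbelow g hg). pose proof (Rle_abs cT).
    assert (0 <= nn (T g)) by (apply (rh_pos H); auto). nra. }
  destruct (rh_complete H u) as [v [hv hlim]].
  + intros n; apply HD, hu.
  + intros e he.
    destruct (kernel_op_succ_small (e / (4 * (Rabs cT + 1)))) as [N hN].
    { apply Rdiv_lt_0_compat; lra. }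
    exists N. intros n k hn hk. destruct (hu n) as [h1 h2], (hu k) as [h3 h4].
    specialize (Tbelow' (sub (u n) (u k)) ltac:(apply Dsub; auto)).
    rewrite Tsub in Tbelow'; auto.
    pose proof (htri f (T (u n)) (T (u k)) hf ltac:(auto) ltac:(auto)).
    pose proof (hN n hn). pose proof (hN k hk).
    apply Rle_lt_trans with ((Rabs cT + 1) * (2 * nn (sub f (T (u n))) + 2 * nn (sub f (T (u k))))).
    * eapply Rle_trans; [exact Tbelow'|]. apply Rmult_le_compat_l; lra.
    * apply Rlt_le_trans with ((Rabs cT + 1) * (4 * (e / (4 * (Rabs cT + 1))))).
      -- apply Rmult_lt_compat_l; lra.
      -- right; field; lra.
  + assert (hMv : M v).
    { apply (cs_cl _ hM); trivial. intros e he. destruct (hlim e he) as [N hN].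
      exists (u N). split; [apply hu|]. specialize (hN N (le_n _)).
      assert (D (u N)) by (apply HD, hu).
      rewrite nn_sub in *; auto. rewrite (rh_sym H); auto. lra. }
    exists v; split; trivial. apply (rh_def H); auto.
    assert (hp : 0 <= nn (sub f (T v))) by (apply (rh_pos H); apply Dsub; auto).
    apply Rle_antisym; trivial. apply le_of_le_add_eps. intros e he.
    assert (hpC : 0 <= Rabs CT) by apply Rabs_pos.
    destruct (hlim (e / (4 * (Rabs CT + 1)))) as [N1 hN1].
    { apply Rdiv_lt_0_compat; lra. }
    destruct (kernel_op_succ_small (e / 4)) as [N2 hN2]; [lra|].
    set (n := (N1 + N2)%nat).
    assert (h1 := hN1 n ltac:(unfold n; lia)). assert (h2 := hN2 n ltac:(unfold n; lia)).
    destruct (hu n) as [h3 h4].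
    pose proof (Tbound (sub (u n) v) ltac:(apply Dsub; auto)) as h5.
    rewrite Tsub in h5; auto.
    assert (h6 : nn (T (u n)) - 2 * ip (T (u n)) (T v) + nn (T v) <= e / 4).
    { rewrite <- nn_sub; auto. eapply Rle_trans; [exact h5|].
      assert (0 <= nn (sub (u n) v)) by (apply (rh_pos H); apply Dsub; auto).
      pose proof (Rle_abs CT).
      apply Rle_trans with ((Rabs CT + 1) * (e / (4 * (Rabs CT + 1)))); [|right; field; lra].
      apply Rle_trans with ((Rabs CT + 1) * nn (sub (u n) v)); [nra|].
      apply Rmult_le_compat_l; lra. }
    pose proof (htri (T (u n)) f (T v) ltac:(auto) hf ltac:(auto)) as h7.
    rewrite (nn_sub (T (u n)) f), (nn_sub (T (u n)) (T v)), (rh_sym H (T (u n)) f) in h7; auto.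
    rewrite nn_sub in h4; auto. lra.
Qed.

(** * Two criteria for the wandering subspace property *)

Section Wandering.

(** [M0] stands for an arbitrary closed invariant subspace containing the wandering subspace of [M];
    the inclusion of [M] in every such [M0] is the wandering subspace property. *)
Variables (M M0 : E -> Prop).
Hypothesis hM : rh_closed_subspace M.
Hypothesis hM0 : rh_closed_subspace M0.
Hypothesis MT : forall f, M f -> M (T f).
Hypothesis M0T : forall f, M0 f -> M0 (T f).
Hypothesis M0W : forall f, M f -> (forall g, M g -> ip f (T g) = 0) -> M0 f.

(** One step of a Wold decomposition: the remainder of the projection onto the closed range [T M] is
    in the wandering subspace, hence in [M0]. *)
Let wandering_split x : M x ->
  exists b, M b /\ M0 (sub x (T b)) /\ M (sub x (T b)) /\
    forall y, M y -> ip (sub x (T b)) (T y) = 0.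
Proof.
intros hx.
destruct (orthogonal_projection _ x (closed_range M hM)) as [v [[b [hb ->]] hv2]].
{ apply (cs_dom _ hM); trivial. }
assert (hs : M (sub x (T b))) by (apply cs_sub; auto).
exists b. repeat split; trivial.
- apply M0W; trivial. intros; apply hv2; eauto.
- intros; apply hv2; eauto.
Qed.

(** The hypothesis is applied to the remainder of [f] after projection onto the intersection of [M]
    and [M0]. *)
Let sub_of_orthogonal_trivial :
  (forall x, M x -> (forall y, M y -> M0 y -> ip x y = 0) -> nn x = 0) ->
  forall f, M f -> M0 f.
Proof.
intros hz f hf.
assert (hI : rh_closed_subspace (fun f => M f /\ M0 f)).
{ apply rh_closed_subspace_inter; trivial.
  destruct (wandering_split f hf) as [b [_ [h1 [h2 _]]]]. eauto. }
assert (hfD : D f) by (apply (cs_dom _ hM); trivial).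
destruct (orthogonal_projection _ f hI hfD) as [v [[hv1 hv2] hv]].
rewrite (rh_def H f v); trivial; [apply (cs_dom _ hM); trivial|].
apply hz; [apply cs_sub; trivial|auto].
Qed.

Let Tn (n : nat) (f : E) : E := Nat.iter n T f.

Let Tn_D n f : D f -> D (Tn n f).
Proof. intros; induction n; simpl; auto. Qed.

Let Tn_succ n f : Tn (S n) f = Tn n (T f).
Proof. induction n; simpl in *; congruence. Qed.

(** [pp] will be the squared norm on a smaller circle. Geometric decay of [pp] under [T] together
    with [pp_weak] is a quantitative form of weak convergence to 0 of bounded vectors [T^n v_n]. *)
Variables (pp : E -> R) (rho Cp : R).
Hypothesis pp_pos : forall f, D f -> 0 <= pp f.
Hypothesis rho_bd : 0 <= rho < 1.
Hypothesis pp_T : forall f, D f -> pp (T f) <= rho * pp f.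
Hypothesis Cp_pos : 0 <= Cp.
Hypothesis pp_nn : forall f, D f -> pp f <= Cp * nn f.
Hypothesis pp_weak : forall x, D x -> forall e, 0 < e -> exists K, 0 <= K /\
  forall u, D u -> ip x u ^ 2 <= e * nn u + K * pp u.

Let pp_Tn n f : D f -> pp (Tn n f) <= rho ^ n * (Cp * nn f).
Proof.
intros hf. induction n; simpl.
- rewrite Rmult_1_l; auto.
- eapply Rle_trans; [apply pp_T; auto|]. rewrite Rmult_assoc.
  apply Rmult_le_compat_l; tauto.
Qed.

(* Richter's argument: with [x = T^n v_n + (element of M0)], the increments
   [|T v_n|^2 - |v_n|^2] are summable, so [T^n v_n] is bounded along a
   subsequence, along which it tends weakly to 0. *)
Theorem wandering_of_concave :
  (forall f, D f -> nn (T (T f)) + nn f <= 2 * nn (T f)) ->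
  forall f, M f -> M0 f.
Proof.
intros hconc. apply sub_of_orthogonal_trivial. intros x hx horth.
assert (HD := cs_dom _ hM).
assert (hexp : forall f, D f -> nn f <= nn (T f)).
{ intros f hf. apply (concave_nonneg_incr (fun n => nn (Tn n f))).
  - intros n; apply (rh_pos H); auto.
  - intros n; apply hconc; auto. }
(* The splitting is iterated on pairs of a vector and its membership in [M], giving [w n] as the sum
   of an element of [M0] and [T (w (S n))]. *)
pose (L := fun v : {v | M v} =>
  let s := constructive_indefinite_description _ (wandering_split _ (proj2_sig v)) in
  exist M (proj1_sig s) (proj1 (proj2_sig s))).
pose (v := fun n => Nat.iter n L (exist M x hx)).
pose (w := fun n => proj1_sig (v n)).
assert (hw : forall n, M (w n)) by (intros n; exact (proj2_sig (v n))).
assert (hL : forall n, M0 (sub (w n) (T (w (S n)))) /\ M (sub (w n) (T (w (S n)))) /\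
    forall y, M y -> ip (sub (w n) (T (w (S n)))) (T y) = 0).
{ intros n.
  exact (proj2 (proj2_sig (constructive_indefinite_description _
    (wandering_split _ (proj2_sig (v n)))))). }
assert (hwD : forall n, D (w n)) by auto.
assert (hTnM : forall n f, M f -> M (Tn n f)) by (intros n f hf; induction n; simpl; auto).
assert (hTnM0 : forall n f, M0 f -> M0 (Tn n f)) by (intros n f hf; induction n; simpl; auto).
assert (hTnsub : forall n f g, D f -> D g -> Tn n (sub f g) = sub (Tn n f) (Tn n g)).
{ intros n f g hf hg; induction n; simpl; trivial. rewrite IHn, Tsub; auto. }
(* The pieces discarded up to step [n] are images under powers of [T] of elements of both [M] and
   [M0], to which [x] is orthogonal. *)
assert (hip : forall n, ip x (Tn n (w n)) = nn x).
{ induction n; [reflexivity|]. rewrite <- IHn.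
  destruct (hL n) as [h1 [h2 _]].
  assert (h0 : ip x (Tn n (sub (w n) (T (w (S n))))) = 0) by auto.
  rewrite hTnsub, ip_subr, <- Tn_succ in h0; auto. lra. }
pose (d := fun n => nn (T (w n)) - nn (w n)).
assert (hd0 : forall n, 0 <= d n) by (intros n; unfold d; specialize (hexp (w n) (hwD n)); lra).
(* Pythagoras: the left side is [nn (T (w (S n)))], and [T (w (S n))] is an orthogonal projection of
   [w n]. Hence the sum of the [d i] with [i >= 1] is at most [nn x]. *)
assert (hstep : forall n, nn (w (S n)) + d (S n) <= nn (w n)).
{ intros n. unfold d. destruct (hL n) as [_ [h2 h3]].
  specialize (h3 (w (S n)) (hw _)).
  rewrite ip_subl in h3; auto.
  assert (h4 : 0 <= nn (sub (w n) (T (w (S n))))) by (apply (rh_pos H); auto).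
  rewrite nn_sub in h4; auto. fold (nn (T (w (S n)))) in h3. lra. }
assert (hsum : forall k n, (forall i, (n < i <= n + k)%nat -> nn x < INR n * d i) ->
   nn (w (n + k)%nat) * INR n + INR k * nn x <= nn (w n) * INR n).
{ induction k; intros n hk.
  - rewrite Nat.add_0_r. simpl. lra.
  - specialize (IHk n ltac:(intros; apply hk; lia)).
    pose proof (hk (n + S k)%nat ltac:(lia)) as h1.
    pose proof (hstep (n + k)%nat) as h2. rewrite <- plus_n_Sm in *.
    rewrite S_INR. pose proof (pos_INR n). nra. }
assert (hwn : forall n, nn (w n) <= nn x).
{ induction n; [apply Rle_refl|]. specialize (hstep n). specialize (hd0 (S n)). lra. }
assert (hx0 : 0 <= nn x) by (apply (rh_pos H); auto).
destruct (Req_dec (nn x) 0) as [|hx1]; trivial. exfalso.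
(* If every [d i] with [n < i <= 2n] exceeded [nn x / n], the block would exhaust [nn (w n)] and
   force [w (2n)] to be null, contradicting [d (2n) > 0]. The factor 2 comes from [i <= 2n]. *)
assert (hsub : forall n, (1 <= n)%nat -> exists i, (n <= i)%nat /\ INR i * d i <= 2 * nn x).
{ intros n hn. apply NNPP; intros hno.
  assert (hall : forall i, (n < i <= n + n)%nat -> nn x < INR n * d i).
  { intros i hi. apply Rnot_le_lt; intros hle. apply hno. exists i. split; [lia|].
    assert (INR i <= 2 * INR n).
    { replace 2 with (INR 2) by reflexivity. rewrite <- mult_INR. apply le_INR. lia. }
    specialize (hd0 i). nra. }
  specialize (hsum n n hall).
  assert (0 < INR n) by (apply lt_0_INR; lia).
  pose proof (hwn n).
  assert (hfin : nn (w (n + n)%nat) * INR n <= 0) by nra.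
  assert (h0 : 0 <= nn (w (n + n)%nat)) by (apply (rh_pos H); auto).
  assert (h1 : nn (w (n + n)%nat) = 0) by nra.
  pose proof (hall (n + n)%nat ltac:(lia)) as h2.
  pose proof (Tbound _ (hwD (n + n)%nat)) as h3. unfold d in h2. rewrite h1 in *.
  nra. }
(* Along the subsequence [nn (Tn n (w n)) <= 3 * nn x], so [1/6] uses half of [nn x ^ 2]; [N] makes
   the [pp] term smaller than the other half. *)
destruct (pp_weak x (HD _ hx) (nn x / 6)) as [K [hK hKx]]; [lra|].
destruct (pow_small_eventually rho (K * (Cp * nn x)) (nn x ^ 2 / 2)) as [N hN]; trivial.
{ apply Rmult_le_pos; trivial. apply Rmult_le_pos; trivial. }
{ nra. }
destruct (hsub (S N)) as [n [hn1 hn2]]; [lia|].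
specialize (hN n ltac:(lia)).
specialize (hKx (Tn n (w n)) ltac:(auto)). rewrite hip in hKx.
pose proof (pp_Tn n (w n) ltac:(auto)) as h1.
assert (h2 : nn (Tn n (w n)) <= 3 * nn x).
{ pose proof (concave_step_bound (fun k => nn (Tn k (w n)))) as hc. cbn beta in hc.
  specialize (hc ltac:(intros; apply hconc; auto) n).
  change (nn (Tn n (w n)) <= nn (w n) + INR n * d n) in hc.
  specialize (hwn n). lra. }
assert (h3 : K * pp (Tn n (w n)) <= K * (Cp * nn x) * rho ^ n).
{ rewrite Rmult_assoc. apply Rmult_le_compat_l; trivial.
  eapply Rle_trans; [exact h1|]. rewrite Rmult_comm.
  apply Rmult_le_compat_r; [apply pow_le; tauto|].
  apply Rmult_le_compat_l; auto. }
assert (h4 : nn x / 6 * nn (Tn n (w n)) <= nn x ^ 2 / 2) by nra.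
lra.
Qed.

(* Shimorin's argument: if [x] is orthogonal to [M0], the iterates of the adjoint
   of [T|M] on [x] have concave, hence constant, norms; so [T] inverts the adjoint
   on them and [x] lies in the range of every [T^n]. *)
Theorem wandering_of_shimorin :
  (forall f g, D f -> D g -> nn (add (T f) g) <= 2 * (nn f + nn (T g))) ->
  (forall f, D f -> nn (T f) <= nn f) ->
  forall f, M f -> M0 f.
Proof.
intros hshi hctr. apply sub_of_orthogonal_trivial. intros x hx horth.
assert (HD := cs_dom _ hM).
assert (hadj : forall v, M v -> exists v', M v' /\ forall y, M y -> ip v' y = ip v (T y)).
{ intros v hv. apply (riesz_on_subspace M (fun y => ip v (T y)) (nn v)); trivial.
  - intros. rewrite Tadd, ip_addr; auto.
  - intros. rewrite Tscal, ip_scalr; auto.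
  - apply (rh_pos H); auto.
  - intros f hf. eapply Rle_trans; [apply cauchy_schwarz; auto|].
    apply Rmult_le_compat_l; [apply (rh_pos H)|]; auto. }
pose (A := fun v : {v | M v} =>
  let s := constructive_indefinite_description _ (hadj _ (proj2_sig v)) in
  exist M (proj1_sig s) (proj1 (proj2_sig s))).
pose (v := fun n => Nat.iter n A (exist M x hx)).
pose (w := fun n => proj1_sig (v n)).
assert (hw : forall n, M (w n)) by (intros n; exact (proj2_sig (v n))).
assert (hA : forall n y, M y -> ip (w (S n)) y = ip (w n) (T y)).
{ intros n.
  exact (proj2 (proj2_sig (constructive_indefinite_description _
    (hadj _ (proj2_sig (v n)))))). }
assert (hwD : forall n, D (w n)) by auto.
(* Inherited by the adjoint iterates because [M0] is invariant under [T]. *)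
assert (hwo : forall n y, M y -> M0 y -> ip (w n) y = 0).
{ induction n; [exact horth|]. intros y h1 h2. rewrite hA; auto. }
(* The part of [w n] orthogonal to [T M] lies in [M0], so it is orthogonal to [w n] and to [T b],
   hence to itself. *)
assert (hrange : forall n, exists b, M b /\ w n = T b).
{ intros n. destruct (wandering_split (w n) (hw n)) as [b [h1 [h2 [h3 h4]]]].
  exists b; split; trivial. apply (rh_def H); auto.
  unfold nn. rewrite ip_subl; auto.
  rewrite hwo; trivial. rewrite (rh_sym H), h4; auto. ring. }
(* Shimorin's inequality is taken at [f = w (n+2)] and [g = b], where [w n = T b]. The pairing of
   [T f + g] with [w (n+1)] equals the left side [s], so Cauchy-Schwarz gives
   [s ^ 2 <= 2 * s * nn (w (n+1))]. *)
assert (hconc : forall n, nn (w (S (S n))) + nn (w n) <= 2 * nn (w (S n))).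
{ intros n. destruct (hrange n) as [b [hb hbn]].
  set (s := nn (w (S (S n))) + nn (w n)).
  assert (h1 : ip (add (T (w (S (S n)))) b) (w (S n)) = s).
  { rewrite (rh_addl H), (rh_sym H (T _)), (rh_sym H b), <- !hA; auto.
    rewrite (hA n b); trivial. rewrite <- hbn. reflexivity. }
  pose proof (hshi (w (S (S n))) b ltac:(auto) ltac:(auto)) as h2.
  rewrite <- hbn in h2. fold s in h2.
  assert (h3 : D (add (T (w (S (S n)))) b)) by (apply (rh_add H); auto).
  pose proof (cauchy_schwarz _ _ h3 (hwD (S n))) as h4. rewrite h1 in h4.
  assert (h5 : 0 <= nn (w (S n))) by (apply (rh_pos H); auto).
  assert (h6 : 0 <= s).
  { unfold s. pose proof (rh_pos H _ (hwD n)). pose proof (rh_pos H _ (hwD (S (S n)))).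
    unfold nn. lra. }
  destruct (Req_dec s 0) as [->|hs]; [lra|].
  assert (h7 : s ^ 2 <= 2 * s * nn (w (S n))) by nra.
  apply Rmult_le_reg_l with s; nra. }
assert (hinc : forall n, nn (w n) <= nn (w (S n))).
{ intros n. pose proof (concave_nonneg_incr (fun k => nn (w (k + n)%nat))) as h.
  apply h; intros k; [apply (rh_pos H); auto|apply hconc]. }
assert (hdec : forall n, nn (w (S n)) <= nn (w n)).
{ intros n.
  pose proof (cauchy_schwarz (w n) (T (w (S n))) ltac:(auto) ltac:(auto)) as h1.
  rewrite <- hA in h1; auto. fold (nn (w (S n))) in h1.
  pose proof (hctr _ (hwD (S n))) as h2.
  assert (h5 : 0 <= nn (w (S n))) by (apply (rh_pos H); auto).
  assert (h6 : 0 <= nn (w n)) by (apply (rh_pos H); auto).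
  destruct (Req_dec (nn (w (S n))) 0) as [->|hs]; [lra|].
  apply Rmult_le_reg_l with (nn (w (S n))); nra. }
(* Expanding the square of the difference gives [nn (w n) - 2 * nn (w (S n)) + nn (T (w (S n)))],
   which is nonpositive by constancy of the norms and contractivity. *)
assert (hback : forall n, w n = T (w (S n))).
{ intros n. apply (rh_def H); auto. apply Rle_antisym; [|apply (rh_pos H); auto].
  rewrite nn_sub, <- hA; auto. fold (nn (w (S n))).
  pose proof (hctr _ (hwD (S n))). pose proof (hinc n). pose proof (hdec n). lra. }
assert (hconst : forall n, nn (w n) = nn x).
{ induction n; [reflexivity|]. pose proof (hinc n). pose proof (hdec n). lra. }
assert (hTn : forall n, x = Tn n (w n)).
{ induction n; [reflexivity|]. rewrite Tn_succ, <- hback; trivial. }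
assert (hx0 : 0 <= nn x) by (apply (rh_pos H); auto).
assert (hpx : pp x = 0).
{ apply Rle_antisym; auto. apply le_of_le_add_eps. intros e he.
  destruct (pow_small_eventually rho (Cp * nn x) e) as [N hN]; trivial.
  { apply Rmult_le_pos; trivial. }
  specialize (hN N (le_n _)).
  pose proof (pp_Tn N (w N) ltac:(auto)) as h. rewrite <- hTn, hconst in h. lra. }
destruct (Req_dec (nn x) 0) as [|hx1]; trivial. exfalso.
destruct (pp_weak x (HD _ hx) (nn x / 2)) as [K [hK hKx]]; [lra|].
specialize (hKx x (HD _ hx)). rewrite hpx in hKx. fold (nn x) in hKx. nra.
Qed.

End Wandering.
End RealHilbertSpace.

(** * Real series and their partial sums *)

Lemma sum_n_S (u : nat -> R) n : sum_n u (S n) = sum_n u n + u (S n).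
Proof. exact (sum_Sn u n). Qed.

Lemma sum_n_0 (u : nat -> R) : sum_n u O = u O.
Proof. exact (sum_O u). Qed.

Lemma sum_n_le (u v : nat -> R) n : (forall j, u j <= v j) -> sum_n u n <= sum_n v n.
Proof. intros h. apply sum_n_m_le, h. Qed.

Lemma series_of_bounded_sums (u : nat -> R) (M : R) :
  (forall j, 0 <= u j) -> (forall n, sum_n u n <= M) ->
  ex_series u /\ Series u <= M.
Proof.
intros h0 hM.
assert (hf : ex_finite_lim_seq (sum_n u)).
{ apply ex_finite_lim_seq_incr with M; trivial.
  intros n. rewrite sum_n_S. specialize (h0 (S n)). lra. }
assert (hex : ex_series u) by (destruct hf as [l hl]; exists l; exact hl).
split; trivial.
assert (hl : is_lim_seq (sum_n u) (Series u)) by exact (Series_correct u hex).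
pose proof (is_lim_seq_le _ _ _ _ hM hl (is_lim_seq_const M)) as h. exact h.
Qed.

Lemma sum_n_le_series (u : nat -> R) n :
  (forall j, 0 <= u j) -> ex_series u -> sum_n u n <= Series u.
Proof.
intros h0 hex.
assert (hl : is_lim_seq (sum_n u) (Series u)) by exact (Series_correct u hex).
apply (is_lim_seq_incr_compare _ _ hl).
intros k. rewrite sum_n_S. specialize (h0 (S k)). lra.
Qed.

Lemma ex_series_R_le (u v : nat -> R) :
  (forall j, Rabs (u j) <= v j) -> ex_series v -> ex_series u.
Proof. exact (ex_series_le u v). Qed.

Lemma ex_series_R_plus (u v : nat -> R) :
  ex_series u -> ex_series v -> ex_series (fun j => u j + v j).
Proof. exact (ex_series_plus u v). Qed.

Lemma ex_series_R_scal (c : R) (u : nat -> R) :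
  ex_series u -> ex_series (fun j => c * u j).
Proof. exact (ex_series_scal_l c u). Qed.

Lemma ex_series_R_ext (u v : nat -> R) :
  (forall j, u j = v j) -> ex_series u -> ex_series v.
Proof. exact (ex_series_ext u v). Qed.

Lemma series_le_of_ex (u v : nat -> R) :
  (forall j, u j <= v j) -> ex_series u -> ex_series v -> Series u <= Series v.
Proof.
intros h hu hv.
pose proof (is_lim_seq_le _ _ (Series u) (Series v) (fun n => sum_n_le u v n h)
  (Series_correct u hu) (Series_correct v hv)) as h'. exact h'.
Qed.

Lemma series_nonneg (u : nat -> R) : (forall j, 0 <= u j) -> ex_series u -> 0 <= Series u.
Proof.
intros h hu. apply Rle_trans with (sum_n u 0); [rewrite sum_n_0; apply h|].
apply sum_n_le_series; trivial.
Qed.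

Lemma series_ge_term (u : nat -> R) j : (forall j, 0 <= u j) -> ex_series u -> u j <= Series u.
Proof.
intros h hu. apply Rle_trans with (sum_n u j); [|apply sum_n_le_series; trivial].
destruct j; [rewrite sum_n_0; lra|]. rewrite sum_n_S.
assert (0 <= sum_n u j); [|lra].
induction j; [rewrite sum_n_0; auto|]. rewrite sum_n_S. specialize (h (S j)); lra.
Qed.

Lemma series_zero : Series (fun _ => 0) = 0.
Proof.
rewrite (Series_ext _ (fun _ => 0 * 0)) by (intros; ring). rewrite Series_scal_l. ring.
Qed.

Lemma ex_series_zero : ex_series (fun _ : nat => 0).
Proof.
apply (series_of_bounded_sums _ 0); [intros; lra|].
induction n; [rewrite sum_n_0; lra|]. rewrite sum_n_S. lra.
Qed.

(* [Re (z * conj w)]; the imaginary part is [dot z (i w)] *)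
Definition dot (z w : C) : R := fst z * fst w + snd z * snd w.

Lemma Cmod_sq (z : C) : Cmod z ^ 2 = dot z z.
Proof.
unfold Cmod, dot. rewrite pow2_sqrt; [ring|]. nra.
Qed.

(** The weight of the pairing is split between two others. This covers the duality of [Q] and [1/Q]
    through the unweighted pairing, and the cross terms of [circle_inequality]. *)
Lemma dot_young (z w : C) (A B W : R) :
  0 <= A -> 0 <= B -> W ^ 2 <= A * B ->
  Rabs (2 * (dot z w * W)) <= Cmod z ^ 2 * A + Cmod w ^ 2 * B.
Proof.
intros hA hB hW. rewrite !Cmod_sq.
assert (hd : dot z w ^ 2 <= dot z z * dot w w).
{ unfold dot. pose proof (pow2_ge_0 (fst z * snd w - snd z * fst w)). nra. }
assert (hz : 0 <= dot z z) by (unfold dot; nra).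
assert (hw : 0 <= dot w w) by (unfold dot; nra).
assert (h : (2 * (dot z w * W)) ^ 2 <= (dot z z * A + dot w w * B) ^ 2).
{ apply Rle_trans with (4 * ((dot z z * dot w w) * (A * B))).
  - replace ((2 * (dot z w * W)) ^ 2) with (4 * (dot z w ^ 2 * W ^ 2)) by ring.
    apply Rmult_le_compat_l; [lra|].
    apply Rmult_le_compat; trivial; apply pow2_ge_0.
  - pose proof (pow2_ge_0 (dot z z * A - dot w w * B)). nra. }
assert (0 <= dot z z * A + dot w w * B) by nra.
apply Rabs_le. split; [apply Ropp_le_cancel; rewrite Ropp_involutive|];
apply le_of_pow2_le; trivial. nra.
Qed.

(** * Weighted square-summable sequences *)

Definition in_l2 (W : nat -> R) (a : nat -> C) : Prop :=
  ex_series (fun j => Cmod (a j) ^ 2 * W j).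
Definition normsq (W : nat -> R) (a : nat -> C) : R :=
  Series (fun j => Cmod (a j) ^ 2 * W j).
Definition pairing (W : nat -> R) (a b : nat -> C) : R :=
  Series (fun j => dot (a j) (b j) * W j).
Definition ones : nat -> R := fun _ => 1.
Definition geom (r : R) : nat -> R := fun j => r ^ j.

Definition seq_add (a b : nat -> C) : nat -> C := fun j => Cplus (a j) (b j).
Definition seq_scal (c : C) (a : nat -> C) : nat -> C := fun j => Cmult c (a j).
Definition seq_zero : nat -> C := fun _ => RtoC 0.
Definition seq_sub (a b : nat -> C) : nat -> C := fun j => Cminus (a j) (b j).

Lemma normsq_pairing W a : normsq W a = pairing W a a.
Proof. apply Series_ext. intros; rewrite Cmod_sq; reflexivity. Qed.

Lemma Cmod2_pos (z : C) W : 0 <= W -> 0 <= Cmod z ^ 2 * W.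
Proof. intros; apply Rmult_le_pos; trivial; apply pow2_ge_0. Qed.

Lemma normsq_nonneg W a : (forall j, 0 <= W j) -> in_l2 W a -> 0 <= normsq W a.
Proof. intros h ha. apply series_nonneg; trivial. intros; apply Cmod2_pos; trivial. Qed.

Lemma pairing_ex W W1 W2 a b :
  (forall j, 0 <= W1 j) -> (forall j, 0 <= W2 j) ->
  (forall j, W j ^ 2 <= W1 j * W2 j) -> in_l2 W1 a -> in_l2 W2 b ->
  ex_series (fun j => dot (a j) (b j) * W j).
Proof.
intros h1 h2 h ha hb.
apply ex_series_R_le with (fun j => 1 / 2 * (Cmod (a j) ^ 2 * W1 j + Cmod (b j) ^ 2 * W2 j)).
- intros j. pose proof (dot_young (a j) (b j) _ _ _ (h1 j) (h2 j) (h j)) as hy.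
  rewrite Rabs_mult, Rabs_pos_eq in hy; lra.
- apply ex_series_R_scal, ex_series_R_plus; trivial.
Qed.

Lemma pairing_young W W1 W2 a b :
  (forall j, 0 <= W1 j) -> (forall j, 0 <= W2 j) ->
  (forall j, W j ^ 2 <= W1 j * W2 j) -> in_l2 W1 a -> in_l2 W2 b ->
  Rabs (2 * pairing W a b) <= normsq W1 a + normsq W2 b.
Proof.
intros h1 h2 h ha hb.
assert (hex := pairing_ex W W1 W2 a b h1 h2 h ha hb).
assert (hy : forall j, - (Cmod (a j) ^ 2 * W1 j + Cmod (b j) ^ 2 * W2 j) <=
   2 * (dot (a j) (b j) * W j) <= Cmod (a j) ^ 2 * W1 j + Cmod (b j) ^ 2 * W2 j).
{ intros j. apply Rabs_le_between, dot_young; auto. }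
unfold pairing. rewrite <- Series_scal_l. unfold normsq. rewrite <- Series_plus by trivial.
assert (hs := ex_series_R_plus _ _ ha hb).
apply Rabs_le. split.
- rewrite <- Series_opp. apply series_le_of_ex; [apply hy| |apply ex_series_R_scal; trivial].
  exact (ex_series_opp _ hs).
- apply series_le_of_ex; [apply hy| |trivial]. apply ex_series_R_scal; trivial.
Qed.

Lemma Cmod_scal_sq (c z : C) : Cmod (Cmult c z) ^ 2 = Cmod c ^ 2 * Cmod z ^ 2.
Proof. rewrite Cmod_mult. ring. Qed.

Lemma in_l2_seq_scal W c a : in_l2 W a -> in_l2 W (seq_scal c a).
Proof.
intros h. apply ex_series_R_ext with (fun j => Cmod c ^ 2 * (Cmod (a j) ^ 2 * W j)).
- intros j. unfold seq_scal. rewrite Cmod_scal_sq. ring.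
- apply ex_series_R_scal; trivial.
Qed.

Lemma normsq_seq_scal W c a : normsq W (seq_scal c a) = Cmod c ^ 2 * normsq W a.
Proof.
unfold normsq. rewrite <- Series_scal_l. apply Series_ext. intros j. unfold seq_scal.
rewrite Cmod_scal_sq. ring.
Qed.

Lemma Cmod_add_sq (z w : C) : Cmod (Cplus z w) ^ 2 = Cmod z ^ 2 + 2 * dot z w + Cmod w ^ 2.
Proof. rewrite !Cmod_sq. unfold dot. simpl. ring. Qed.

Lemma Cmod_add_sq_le (z w : C) : Cmod (Cplus z w) ^ 2 <= 2 * Cmod z ^ 2 + 2 * Cmod w ^ 2.
Proof.
rewrite Cmod_add_sq, !Cmod_sq. unfold dot.
pose proof (pow2_ge_0 (fst z - fst w)). pose proof (pow2_ge_0 (snd z - snd w)). nra.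
Qed.

Lemma in_l2_seq_add W a b : (forall j, 0 <= W j) -> in_l2 W a -> in_l2 W b -> in_l2 W (seq_add a b).
Proof.
intros hW ha hb.
apply ex_series_R_le with (fun j => 2 * (Cmod (a j) ^ 2 * W j) + 2 * (Cmod (b j) ^ 2 * W j)).
- intros j. rewrite Rabs_pos_eq by (apply Cmod2_pos; trivial).
  pose proof (Cmod_add_sq_le (a j) (b j)). unfold seq_add. specialize (hW j). nra.
- apply ex_series_R_plus; apply ex_series_R_scal; trivial.
Qed.

Lemma seq_sub_eq a b : seq_sub a b = seq_add a (seq_scal (RtoC (-1)) b).
Proof.
apply functional_extensionality; intros j. unfold seq_sub, seq_add, seq_scal.
apply injective_projections; simpl; ring.
Qed.

Lemma in_l2_seq_sub W a b : (forall j, 0 <= W j) -> in_l2 W a -> in_l2 W b -> in_l2 W (seq_sub a b).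
Proof. intros. rewrite seq_sub_eq. apply in_l2_seq_add; trivial. apply in_l2_seq_scal; trivial. Qed.

Lemma in_l2_seq_zero W : in_l2 W seq_zero.
Proof.
apply ex_series_R_ext with (fun _ => 0); [|apply ex_series_zero].
intros j. unfold seq_zero. rewrite Cmod_0. ring.
Qed.

Lemma normsq_seq_add_le W a b : (forall j, 0 <= W j) -> in_l2 W a -> in_l2 W b ->
  normsq W (seq_add a b) <= 2 * normsq W a + 2 * normsq W b.
Proof.
intros hW ha hb. unfold normsq.
rewrite <- !Series_scal_l, <- Series_plus by (apply ex_series_R_scal; trivial).
apply series_le_of_ex.
- intros j. pose proof (Cmod_add_sq_le (a j) (b j)). unfold seq_add. specialize (hW j). nra.
- apply in_l2_seq_add; trivial.
- apply ex_series_R_plus; apply ex_series_R_scal; trivial.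
Qed.

Lemma in_l2_le W W' c a : (forall j, 0 <= W j) -> (forall j, W j <= c * W' j) -> in_l2 W' a -> in_l2 W a.
Proof.
intros h0 h ha. apply ex_series_R_le with (fun j => c * (Cmod (a j) ^ 2 * W' j)).
- intros j. rewrite Rabs_pos_eq by (apply Cmod2_pos; trivial).
  pose proof (pow2_ge_0 (Cmod (a j))). specialize (h j). nra.
- apply ex_series_R_scal; trivial.
Qed.

Lemma normsq_le W W' c a : (forall j, W j <= c * W' j) ->
  in_l2 W a -> in_l2 W' a -> normsq W a <= c * normsq W' a.
Proof.
intros h hb ha. unfold normsq. rewrite <- Series_scal_l. apply series_le_of_ex; trivial.
- intros j. pose proof (pow2_ge_0 (Cmod (a j))). specialize (h j). nra.
- apply ex_series_R_scal; trivial.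
Qed.

Lemma normsq_eq0 W a : (forall j, 0 < W j) -> in_l2 W a -> normsq W a = 0 -> a = seq_zero.
Proof.
intros hW ha h. apply functional_extensionality; intros j.
assert (h1 : Cmod (a j) ^ 2 * W j <= normsq W a).
{ apply (series_ge_term (fun j => Cmod (a j) ^ 2 * W j)); trivial.
  intros i; apply Cmod2_pos. left; auto. }
apply Cmod_eq_0. specialize (hW j). pose proof (pow2_ge_0 (Cmod (a j))).
assert (Cmod (a j) ^ 2 = 0) by nra. nra.
Qed.

Lemma dot_sym z w : dot z w = dot w z.
Proof. unfold dot; ring. Qed.

Lemma pairing_sym W a b : pairing W a b = pairing W b a.
Proof. apply Series_ext; intros; rewrite dot_sym; ring. Qed.

Lemma pairing_seq_add_l W a b c :
  ex_series (fun j => dot (a j) (c j) * W j) -> ex_series (fun j => dot (b j) (c j) * W j) ->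
  pairing W (seq_add a b) c = pairing W a c + pairing W b c.
Proof.
intros ha hb. unfold pairing. rewrite <- Series_plus by trivial. apply Series_ext; intros j.
unfold seq_add, dot; simpl; ring.
Qed.

Lemma pairing_seq_scal_l W z a b : pairing W (seq_scal z a) b = pairing W a (seq_scal (Cconj z) b).
Proof. apply Series_ext; intros j. unfold seq_scal, dot; simpl; ring. Qed.

Lemma pairing_seq_scal_real W t a b : pairing W (seq_scal (RtoC t) a) b = t * pairing W a b.
Proof. unfold pairing. rewrite <- Series_scal_l. apply Series_ext; intros j. unfold seq_scal, dot; simpl; ring. Qed.

Lemma pairing_cauchy_schwarz W W1 W2 a b :
  (forall j, 0 <= W1 j) -> (forall j, 0 <= W2 j) ->
  (forall j, W j ^ 2 <= W1 j * W2 j) -> in_l2 W1 a -> in_l2 W2 b ->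
  pairing W a b ^ 2 <= normsq W1 a * normsq W2 b.
Proof.
intros h1 h2 h ha hb. apply quadratic_form_bound; [apply normsq_nonneg; trivial|].
intros s. rewrite Rmult_assoc, <- pairing_seq_scal_real.
eapply Rle_trans; [apply Rle_abs|].
eapply Rle_trans; [apply pairing_young with (W1 := W1) (W2 := W2); trivial; apply in_l2_seq_scal; trivial|].
rewrite normsq_seq_scal, Cmod_R. rewrite pow2_abs. lra.
Qed.

Lemma normsq_seq_add W W1 a b : (forall j, 0 <= W1 j) ->
  (forall j, W j ^ 2 <= W1 j * W1 j) ->
  in_l2 W1 a -> in_l2 W1 b -> in_l2 W a -> in_l2 W b ->
  normsq W (seq_add a b) = normsq W a + 2 * pairing W a b + normsq W b.
Proof.
intros hW h ha hb ha' hb'. unfold normsq, pairing.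
assert (hex := pairing_ex W W1 W1 a b hW hW h ha hb).
rewrite <- Series_scal_l, <- Series_plus by (trivial; apply ex_series_R_scal; trivial).
rewrite <- Series_plus; trivial.
- apply Series_ext. intros j. unfold seq_add. rewrite Cmod_add_sq. ring.
- apply ex_series_R_plus; trivial. apply ex_series_R_scal; trivial.
Qed.

Lemma fst_le_Cmod (z : C) : Rabs (fst z) <= Cmod z.
Proof. pose proof (Rmax_Cmod z). pose proof (Rmax_l (Rabs (fst z)) (Rabs (snd z))). lra. Qed.

Lemma snd_le_Cmod (z : C) : Rabs (snd z) <= Cmod z.
Proof. pose proof (Rmax_Cmod z). pose proof (Rmax_r (Rabs (fst z)) (Rabs (snd z))). lra. Qed.

Lemma weighted_l2_complete (W : nat -> R) (u : nat -> nat -> C) :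
  (forall j, 0 < W j) -> (forall n, in_l2 W (u n)) ->
  (forall e, 0 < e -> exists N, forall n m, (N <= n)%nat -> (N <= m)%nat ->
      normsq W (seq_sub (u n) (u m)) < e) ->
  exists v, in_l2 W v /\
    forall e, 0 < e -> exists N, forall n, (N <= n)%nat -> normsq W (seq_sub (u n) v) < e.
Proof.
intros hW hu hc.
assert (hW' : forall j, 0 <= W j) by (intros; left; auto).
assert (hterm : forall n m j, Cmod (seq_sub (u n) (u m) j) ^ 2 * W j <= normsq W (seq_sub (u n) (u m))).
{ intros n m j. apply (series_ge_term (fun j => Cmod (seq_sub (u n) (u m) j) ^ 2 * W j)).
  - intros; apply Cmod2_pos; auto.
  - apply in_l2_seq_sub; auto. }
assert (hcoord : forall j e, 0 < e -> exists N, forall n m, (N <= n)%nat -> (N <= m)%nat ->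
   Cmod (seq_sub (u n) (u m) j) < e).
{ intros j e he. destruct (hc (e ^ 2 * W j)) as [N hN].
  { apply Rmult_lt_0_compat; auto. apply pow_lt; trivial. }
  exists N. intros n m hn hm. specialize (hN n m hn hm). specialize (hterm n m j).
  pose proof (hW j). apply Rnot_le_lt. intros hle.
  assert (e ^ 2 <= Cmod (seq_sub (u n) (u m) j) ^ 2) by nra. nra. }
assert (hlim : forall j, exists l : C, is_lim_seq (fun n => fst (u n j)) (fst l) /\
    is_lim_seq (fun n => snd (u n j)) (snd l)).
{ intros j.
  assert (h1 : ex_finite_lim_seq (fun n => fst (u n j))).
  { apply ex_lim_seq_cauchy_corr. intros e. destruct (hcoord j e (cond_pos e)) as [N hN].
    exists N. intros n m hn hm. eapply Rle_lt_trans; [|apply (hN n m hn hm)].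
    eapply Rle_trans; [|apply fst_le_Cmod]. unfold seq_sub. simpl. right. f_equal; ring. }
  assert (h2 : ex_finite_lim_seq (fun n => snd (u n j))).
  { apply ex_lim_seq_cauchy_corr. intros e. destruct (hcoord j e (cond_pos e)) as [N hN].
    exists N. intros n m hn hm. eapply Rle_lt_trans; [|apply (hN n m hn hm)].
    eapply Rle_trans; [|apply snd_le_Cmod]. unfold seq_sub. simpl. right. f_equal; ring. }
  destruct h1 as [l1 hl1], h2 as [l2 hl2]. exists (l1, l2). split; trivial. }
pose (v := fun j => proj1_sig (constructive_indefinite_description _ (hlim j))).
assert (hv : forall j, is_lim_seq (fun n => fst (u n j)) (fst (v j)) /\
    is_lim_seq (fun n => snd (u n j)) (snd (v j))).
{ intros j. exact (proj2_sig (constructive_indefinite_description _ (hlim j))). }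
assert (hsum : forall n k, is_lim_seq
   (fun m => sum_n (fun j => Cmod (seq_sub (u n) (u m) j) ^ 2 * W j) k)
   (sum_n (fun j => Cmod (seq_sub (u n) v j) ^ 2 * W j) k)).
{ intros n k.
  assert (hj : forall j, is_lim_seq (fun m => Cmod (seq_sub (u n) (u m) j) ^ 2 * W j)
       (Cmod (seq_sub (u n) v j) ^ 2 * W j)).
  { intros j. destruct (hv j) as [h1 h2].
    apply is_lim_seq_ext with (fun m => ((fst (u n j) - fst (u m j)) * (fst (u n j) - fst (u m j)) +
       (snd (u n j) - snd (u m j)) * (snd (u n j) - snd (u m j))) * W j).
    { intros m. rewrite Cmod_sq. unfold dot, seq_sub; simpl. ring. }
    replace (Cmod (seq_sub (u n) v j) ^ 2 * W j) with
      (((fst (u n j) - fst (v j)) * (fst (u n j) - fst (v j)) +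
       (snd (u n j) - snd (v j)) * (snd (u n j) - snd (v j))) * W j)
      by (rewrite Cmod_sq; unfold dot, seq_sub; simpl; ring).
    apply is_lim_seq_mult'; [|apply is_lim_seq_const].
    apply is_lim_seq_plus'; apply is_lim_seq_mult'; apply is_lim_seq_minus'; trivial;
    apply is_lim_seq_const. }
  induction k.
  - rewrite sum_n_0. eapply is_lim_seq_ext; [|apply (hj O)]. intros m; rewrite sum_n_0; trivial.
  - rewrite sum_n_S. eapply is_lim_seq_ext;
      [intros m; symmetry;
       exact (sum_n_S (fun j => Cmod (seq_sub (u n) (u m) j) ^ 2 * W j) k)|].
    apply is_lim_seq_plus'; trivial. }
(* Fatou's argument: each partial sum passes to the coordinatewise limit. Summability of [u n - v]
   comes first, and that of [v] follows from it. *)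
assert (hdiff : forall e, 0 < e -> exists N, forall n, (N <= n)%nat ->
    in_l2 W (seq_sub (u n) v) /\ normsq W (seq_sub (u n) v) <= e).
{ intros e he. destruct (hc e he) as [N hN]. exists N. intros n hn.
  apply series_of_bounded_sums; [intros; apply Cmod2_pos; auto|].
  intros k.
  assert (hle : Rbar_le (sum_n (fun j => Cmod (seq_sub (u n) v j) ^ 2 * W j) k) e).
  { refine (is_lim_seq_le_loc _ _ _ _ _ (hsum n k) (is_lim_seq_const e)).
    exists N. intros m hm.
    eapply Rle_trans; [apply sum_n_le_series; [intros; apply Cmod2_pos; auto|]|].
    - apply in_l2_seq_sub; auto.
    - left. apply hN; trivial. }
  exact hle. }
exists v. split.
- destruct (hdiff 1) as [N hN]; [lra|]. destruct (hN N (le_n _)) as [h _].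
  replace v with (seq_sub (u N) (seq_sub (u N) v)); [apply in_l2_seq_sub; auto|].
  apply functional_extensionality; intros j. unfold seq_sub.
  apply injective_projections; simpl; ring.
- intros e he. destruct (hdiff (e / 2)) as [N hN]; [lra|]. exists N. intros n hn.
  destruct (hN n hn). lra.
Qed.

Lemma pairing_self_ex W a b : (forall j, 0 <= W j) -> in_l2 W a -> in_l2 W b ->
  ex_series (fun j => dot (a j) (b j) * W j).
Proof. intros. apply pairing_ex with W W; trivial. intros; right; ring. Qed.

Lemma seq_real_hilbert W : (forall j, 0 < W j) ->
  real_hilbert (nat -> C) (in_l2 W) seq_add (fun t => seq_scal (RtoC t)) (pairing W).
Proof.
intros hW. assert (hW' : forall j, 0 <= W j) by (intros; left; auto).
split.
- intros; apply in_l2_seq_add; trivial.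
- intros; apply in_l2_seq_scal; trivial.
- intros; apply pairing_sym.
- intros; apply pairing_seq_add_l; apply pairing_self_ex; trivial.
- intros; apply pairing_seq_scal_real.
- intros f hf. rewrite <- normsq_pairing. apply normsq_nonneg; trivial.
- intros f g hf hg h. rewrite <- normsq_pairing, <- seq_sub_eq in h.
  apply normsq_eq0 in h; trivial; [|apply in_l2_seq_sub; trivial].
  apply functional_extensionality; intros j.
  assert (hj : seq_sub f g j = RtoC 0) by (rewrite h; reflexivity).
  unfold seq_sub in hj. replace (f j) with (Cplus (g j) (Cminus (f j) (g j))) by ring.
  rewrite hj. ring.
- intros u hu hc. destruct (weighted_l2_complete W u hW hu) as [v [hv1 hv2]].
  + intros e he. destruct (hc e he) as [N hN]. exists N. intros n m hn hm.
    specialize (hN n m hn hm). rewrite <- normsq_pairing, <- seq_sub_eq in hN. trivial.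
  + exists v. split; trivial. intros e he. destruct (hv2 e he) as [N hN].
    exists N. intros n hn. rewrite <- normsq_pairing, <- seq_sub_eq. auto.
Qed.

(** * Blaschke factors acting on coefficient sequences *)

Definition fshift (a : nat -> C) : nat -> C :=
  fun j => match j with O => RtoC 0 | S i => a i end.
Definition bshift (a : nat -> C) : nat -> C := fun j => a (S j).

(* coefficients of [f(z) / (1 - b z)] *)
Fixpoint kernel_op (b : C) (f : nat -> C) (j : nat) : C :=
  match j with
  | O => f O
  | S i => Cplus (Cmult b (kernel_op b f i)) (f (S i))
  end.

(* coefficients of [(z - a) / (1 - conj a z) * f(z)] *)
Definition factor_op (a : C) (f : nat -> C) : nat -> C :=
  seq_sub (fshift (kernel_op (Cconj a) f)) (seq_scal a (kernel_op (Cconj a) f)).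

Definition blaschke_op (l : list C) (f : nat -> C) : nat -> C := List.fold_right factor_op f l.

Definition in_disc (l : list C) : Prop := List.Forall (fun a : C => Cmod a < 1) l.

(** Linear operators commuting with multiplication by [z]. They then commute with division by
    [1 - b z], since [kernel_op] is the unique solution of an equation in the shift. *)
Record shift_linear (U : (nat -> C) -> nat -> C) : Prop := {
  sl_add : forall f g, U (seq_add f g) = seq_add (U f) (U g);
  sl_scz : forall c f, U (seq_scal c f) = seq_scal c (U f);
  sl_sh : forall f, U (fshift f) = fshift (U f)
}.

Ltac seq_ext j := apply functional_extensionality; intros j.
Ltac Cring_seq := unfold seq_add, seq_sub, seq_scal, Cminus; ring.

Lemma shift_linear_seq_sub U f g : shift_linear U -> U (seq_sub f g) = seq_sub (U f) (U g).
Proof. intros h. rewrite !seq_sub_eq, (sl_add U h), (sl_scz U h); trivial. Qed.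

Lemma kernel_op_spec b f : seq_sub (kernel_op b f) (seq_scal b (fshift (kernel_op b f))) = f.
Proof. seq_ext j. destruct j; unfold seq_sub, seq_scal; simpl; ring. Qed.

Lemma kernel_op_uniq b f g : seq_sub g (seq_scal b (fshift g)) = f -> kernel_op b f = g.
Proof.
intros <-. seq_ext j. induction j; simpl.
- unfold seq_sub, seq_scal; simpl; ring.
- rewrite IHj. unfold seq_sub, seq_scal; simpl; ring.
Qed.

Lemma shift_linear_kernel_op U b f : shift_linear U -> U (kernel_op b f) = kernel_op b (U f).
Proof.
intros h. symmetry. apply kernel_op_uniq.
rewrite <- (sl_sh U h), <- (sl_scz U h), <- (shift_linear_seq_sub U _ _ h), kernel_op_spec. trivial.
Qed.

Lemma shift_linear_factor_op_comm U a f : shift_linear U -> U (factor_op a f) = factor_op a (U f).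
Proof.
intros h. unfold factor_op.
rewrite (shift_linear_seq_sub U _ _ h), (sl_scz U h), (sl_sh U h), !(shift_linear_kernel_op U); trivial.
Qed.

Lemma shift_linear_blaschke_op_comm U l f : shift_linear U -> U (blaschke_op l f) = blaschke_op l (U f).
Proof.
intros h. induction l as [|a l IH]; simpl; trivial.
rewrite (shift_linear_factor_op_comm U), IH; trivial.
Qed.

Lemma fshift_shift_linear : shift_linear fshift.
Proof. split; intros; trivial; seq_ext j; destruct j; unfold seq_add, seq_scal; simpl; ring. Qed.

Lemma kernel_op_shift_linear b : shift_linear (kernel_op b).
Proof.
split; intros.
- seq_ext j. induction j; simpl; [trivial|]. rewrite IHj. unfold seq_add; simpl. ring.
- seq_ext j. induction j; simpl; [trivial|]. rewrite IHj. unfold seq_scal; simpl. ring.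
- rewrite (shift_linear_kernel_op fshift); trivial. apply fshift_shift_linear.
Qed.

Lemma factor_op_shift_linear a : shift_linear (factor_op a).
Proof.
pose proof (kernel_op_shift_linear (Cconj a)) as h.
split; intros; unfold factor_op.
- rewrite !(sl_add _ h), (sl_add _ fshift_shift_linear). seq_ext j; Cring_seq.
- rewrite !(sl_scz _ h), (sl_scz _ fshift_shift_linear). seq_ext j; Cring_seq.
- rewrite !(sl_sh _ h), (shift_linear_seq_sub _ _ _ fshift_shift_linear), (sl_scz _ fshift_shift_linear). trivial.
Qed.

Lemma blaschke_op_shift_linear l : shift_linear (blaschke_op l).
Proof.
induction l as [|a l IH]; simpl; [split; trivial|].
pose proof (factor_op_shift_linear a) as h.
split; intros; simpl.
- rewrite (sl_add _ IH), (sl_add _ h); trivial.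
- rewrite (sl_scz _ IH), (sl_scz _ h); trivial.
- rewrite (sl_sh _ IH), (sl_sh _ h); trivial.
Qed.

(** Clearing the denominator puts every [(z - a) w] in the range of the factor; this is what turns
    orthogonality to the range into a recurrence. *)
Lemma factor_op_inverse a w : factor_op a (seq_sub w (seq_scal (Cconj a) (fshift w))) = seq_sub (fshift w) (seq_scal a w).
Proof. unfold factor_op. rewrite (kernel_op_uniq _ _ w); trivial. Qed.

(** * Division by [1 - b z] on weighted spaces *)

(** Convexity of the square at [x] and [y / (1 - b)]. The coefficient [b < 1] on [x ^ 2] is what
    makes the recursions summable. *)
Lemma convex_square (b x y : R) : 0 <= b < 1 -> (b * x + y) ^ 2 <= b * x ^ 2 + y ^ 2 / (1 - b).
Proof.
intros hb.
apply Rminus_le.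
replace ((b * x + y) ^ 2 - (b * x ^ 2 + y ^ 2 / (1 - b)))
  with (- (b * ((1 - b) * x - y) ^ 2 / (1 - b))) by (field; lra).
apply Ropp_le_cancel. rewrite Ropp_involutive, Ropp_0.
apply Rdiv_le_0_compat; [|lra]. apply Rmult_le_pos; [lra|apply pow2_ge_0].
Qed.

Lemma Cmod_affine_sq (b z w : C) : Cmod b < 1 ->
  Cmod (Cplus (Cmult b z) w) ^ 2 <= Cmod b * Cmod z ^ 2 + Cmod w ^ 2 / (1 - Cmod b).
Proof.
intros hb. pose proof (Cmod_ge_0 b).
eapply Rle_trans; [|apply convex_square; lra].
apply pow_incr. split; [apply Cmod_ge_0|].
rewrite <- Cmod_mult. apply Cmod_triangle.
Qed.

(** The partial sums satisfy [G (n+1) <= be * (G n + G' n) + F (n+1) / (1 - be)], and monotonicity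
    of [G] solves this. [W'] bounds the increments of [W]: 0 treats nonincreasing weights, and a
    constant, once treated itself, gives weights of bounded growth. *)
Lemma in_l2_kernel_op_growth W W' b f :
  (forall j, 0 <= W j) -> (forall j, 0 <= W' j) -> (forall j, W (S j) <= W j + W' j) ->
  Cmod b < 1 -> in_l2 W f -> in_l2 W' (kernel_op b f) ->
  in_l2 W (kernel_op b f) /\
  (1 - Cmod b) * normsq W (kernel_op b f) <= Cmod b * normsq W' (kernel_op b f) + normsq W f / (1 - Cmod b).
Proof.
intros hW hW' hg hb hf hf'. pose proof (Cmod_ge_0 b) as hb0.
set (g := kernel_op b f) in *. set (be := Cmod b) in *.
set (G := fun n => sum_n (fun j => Cmod (g j) ^ 2 * W j) n).
set (G' := fun n => sum_n (fun j => Cmod (g j) ^ 2 * W' j) n).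
set (F := fun n => sum_n (fun j => Cmod (f j) ^ 2 * W j) n).
assert (hib : 1 <= / (1 - be)).
{ rewrite <- Rinv_1 at 1. apply Rinv_le_contravar; lra. }
assert (hF0 : forall n, 0 <= F n).
{ unfold F. induction n; [rewrite sum_n_0|rewrite sum_n_S];
  [|pose proof (Cmod2_pos (f (S n)) _ (hW (S n))); cbn beta in *; lra].
  apply Cmod2_pos; trivial. }
assert (hterm : forall n, Cmod (g (S n)) ^ 2 * W (S n) <=
   be * (Cmod (g n) ^ 2 * W n + Cmod (g n) ^ 2 * W' n) + Cmod (f (S n)) ^ 2 * W (S n) / (1 - be)).
{ intros n. pose proof (Cmod_affine_sq b (g n) (f (S n)) hb) as h. fold be in h.
  change (Cplus (Cmult b (g n)) (f (S n))) with (g (S n)) in h.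
  apply Rle_trans with ((be * Cmod (g n) ^ 2 + Cmod (f (S n)) ^ 2 / (1 - be)) * W (S n)).
  - apply Rmult_le_compat_r; trivial.
  - pose proof (pow2_ge_0 (Cmod (g n))).
    assert (be * Cmod (g n) ^ 2 * W (S n) <= be * Cmod (g n) ^ 2 * (W n + W' n)).
    { apply Rmult_le_compat_l; trivial. apply Rmult_le_pos; trivial. }
    unfold Rdiv in *. nra. }
assert (hG : forall n, G (S n) <= be * (G n + G' n) + F (S n) / (1 - be)).
{ induction n.
  - unfold G, G', F. rewrite !sum_n_S, !sum_n_0. specialize (hterm O).
    change (g O) with (f O) in *.
    pose proof (Cmod2_pos (f O) _ (hW O)). unfold Rdiv in *. nra.
  - unfold G, G', F in *. rewrite (sum_n_S _ (S n)).
    rewrite (sum_n_S _ n) at 2. rewrite (sum_n_S (fun j => Cmod (g j) ^ 2 * W' j) n).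
    rewrite (sum_n_S (fun j => Cmod (f j) ^ 2 * W j) (S n)).
    specialize (hterm (S n)). unfold Rdiv in *. nra. }
assert (hG2 : forall n, G n <= G (S n)).
{ intros n. unfold G. rewrite sum_n_S. pose proof (Cmod2_pos (g (S n)) _ (hW (S n))). cbn beta in *; lra. }
assert (hb1 : forall n, G n <= (be * normsq W' g + normsq W f / (1 - be)) / (1 - be)).
{ intros n. eapply Rle_trans; [apply hG2|].
  assert (h1 : G' n <= normsq W' g).
  { apply (sum_n_le_series (fun j => Cmod (g j) ^ 2 * W' j)); trivial. intros; apply Cmod2_pos; trivial. }
  assert (h2 : F (S n) <= normsq W f).
  { apply (sum_n_le_series (fun j => Cmod (f j) ^ 2 * W j)); trivial. intros; apply Cmod2_pos; trivial. }
  specialize (hG n). specialize (hG2 n).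
  assert (F (S n) / (1 - be) <= normsq W f / (1 - be)).
  { apply Rmult_le_compat_r; trivial. lra. }
  apply Rmult_le_reg_r with (1 - be); [lra|].
  unfold Rdiv at 1. rewrite Rmult_assoc, Rinv_l by lra. nra. }
destruct (series_of_bounded_sums _ _ (fun j => Cmod2_pos (g j) _ (hW j)) hb1) as [h1 h2].
split; trivial.
change (Series (fun j => Cmod (g j) ^ 2 * W j)) with (normsq W g) in h2.
apply Rmult_le_compat_l with (r := 1 - be) in h2; [|lra].
eapply Rle_trans; [exact h2|]. right; field; lra.
Qed.

Definition nonincreasing (W : nat -> R) : Prop :=
  (forall j, 0 < W j) /\ forall j, W (S j) <= W j.

(** Covers [Q], with bounded increments and a positive lower bound, as well as [1/Q] and [r^j], with
    [A = 0]. The last clause lets the constant [A] serve as [W'] in [in_l2_kernel_op_growth]. *)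
Definition admissible (W : nat -> R) : Prop :=
  (forall j, 0 < W j) /\ exists A c, 0 <= A /\ 0 <= c /\
    (forall j, W (S j) <= W j + A) /\ forall j, A <= c * W j.

Lemma nonincreasing_admissible W : nonincreasing W -> admissible W.
Proof.
intros [h1 h2]. split; trivial. exists 0, 0. repeat split; try lra; intros j.
- specialize (h2 j); lra.
- lra.
Qed.

Lemma in_l2_W0 f : in_l2 (fun _ => 0) f.
Proof. apply ex_series_R_ext with (fun _ => 0); [intros; symmetry; apply Rmult_0_r|apply ex_series_zero]. Qed.

Lemma kernel_op_weakly_nonincreasing W b f :
  (forall j, 0 <= W j) -> (forall j, W (S j) <= W j) -> Cmod b < 1 -> in_l2 W f ->
  in_l2 W (kernel_op b f) /\ normsq W (kernel_op b f) <= normsq W f / (1 - Cmod b) ^ 2.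
Proof.
intros h0 h1 hb hf.
destruct (in_l2_kernel_op_growth W (fun _ => 0) b f) as [h2 h3]; trivial.
- intros; lra.
- intros j; specialize (h1 j); lra.
- apply in_l2_W0.
- split; trivial.
  replace (normsq (fun _ => 0) (kernel_op b f)) with 0 in h3.
  + pose proof (Cmod_ge_0 b). apply Rmult_le_reg_l with (1 - Cmod b); [lra|].
    replace ((1 - Cmod b) * (normsq W f / (1 - Cmod b) ^ 2)) with (normsq W f / (1 - Cmod b)) by (field; lra).
    lra.
  + transitivity (Series (fun _ => 0)); [symmetry; apply series_zero|].
    apply Series_ext; intros; symmetry; apply Rmult_0_r.
Qed.

Lemma in_l2_kernel_op W b f : admissible W -> Cmod b < 1 -> in_l2 W f -> in_l2 W (kernel_op b f).
Proof.
intros [h0 [A [c [hA [hc [h1 h2]]]]]] hb hf.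
apply (in_l2_kernel_op_growth W (fun _ => A)); trivial.
- intros; left; auto.
- apply kernel_op_weakly_nonincreasing; trivial; [intros; lra|].
  apply in_l2_le with W c; trivial.
Qed.

Lemma admissible_pos W : admissible W -> forall j, 0 <= W j.
Proof. intros [h _] j. left; auto. Qed.

Lemma in_l2_fshift_iff W a : in_l2 W (fshift a) <-> in_l2 (fun j => W (S j)) a.
Proof.
unfold in_l2. split; intros h.
- apply ex_series_incr_1 in h. exact h.
- apply ex_series_incr_1. exact h.
Qed.

Lemma in_l2_fshift W a : admissible W -> in_l2 W a -> in_l2 W (fshift a).
Proof.
intros [h0 [A [c [hA [hc [h1 h2]]]]]] ha. apply in_l2_fshift_iff.
apply in_l2_le with W (1 + c); trivial.
- intros; left; auto.
- intros j. specialize (h1 j). specialize (h2 j). lra.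
Qed.

Lemma normsq_fshift W a : admissible W -> in_l2 W a -> normsq W (fshift a) = normsq (fun j => W (S j)) a.
Proof.
intros hW ha. unfold normsq. rewrite Series_incr_1.
- simpl. rewrite Cmod_0. ring.
- apply (in_l2_fshift W a); trivial.
Qed.

Lemma Cmod_conj_lt a : Cmod a < 1 -> Cmod (Cconj a) < 1.
Proof. rewrite Cmod_conj; trivial. Qed.

Lemma in_l2_factor_op W a f : admissible W -> Cmod a < 1 -> in_l2 W f -> in_l2 W (factor_op a f).
Proof.
intros hW ha hf. pose proof (admissible_pos W hW).
assert (in_l2 W (kernel_op (Cconj a) f)) by (apply in_l2_kernel_op; trivial; apply Cmod_conj_lt; trivial).
apply in_l2_seq_sub; trivial.
- apply in_l2_fshift; trivial.
- apply in_l2_seq_scal; trivial.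
Qed.

Lemma in_l2_blaschke_op W l f : admissible W -> in_disc l -> in_l2 W f -> in_l2 W (blaschke_op l f).
Proof.
intros hW hl hf. induction hl; simpl; trivial. apply in_l2_factor_op; trivial.
Qed.

Lemma blaschke_op_bounded W l : nonincreasing W -> in_disc l ->
  exists C, 0 <= C /\ forall f, in_l2 W f -> normsq W (blaschke_op l f) <= C * normsq W f.
Proof.
intros hW hl. pose proof (nonincreasing_admissible W hW) as hA. pose proof (admissible_pos W hA) as h0.
induction hl as [|a l ha hl [C [hC h]]]; simpl.
- exists 1. split; [lra|]. intros; lra.
- exists (4 / (1 - Cmod a) ^ 2 * C).
  assert (hk : 0 <= 4 / (1 - Cmod a) ^ 2).
  { apply Rdiv_le_0_compat; [lra|]. apply pow_lt; lra. }
  split; [apply Rmult_le_pos; trivial|].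
  intros f hf. assert (hT : in_l2 W (blaschke_op l f)) by (apply in_l2_blaschke_op; trivial).
  destruct (kernel_op_weakly_nonincreasing W (Cconj a) (blaschke_op l f)) as [h1 h2]; trivial.
  { apply hW. } { apply Cmod_conj_lt; trivial. }
  rewrite Cmod_conj in h2.
  assert (h3 : normsq W (fshift (kernel_op (Cconj a) (blaschke_op l f))) <= normsq W (kernel_op (Cconj a) (blaschke_op l f))).
  { rewrite normsq_fshift; trivial. rewrite <- (Rmult_1_l (normsq W _)). apply normsq_le; trivial.
    - intros j. rewrite Rmult_1_l. apply hW.
    - apply in_l2_fshift_iff, in_l2_fshift; trivial. }
  assert (h4 : normsq W (factor_op a (blaschke_op l f)) <= 4 * normsq W (kernel_op (Cconj a) (blaschke_op l f))).
  { unfold factor_op. rewrite seq_sub_eq. eapply Rle_trans; [apply normsq_seq_add_le; trivial|].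
    - apply in_l2_fshift; trivial.
    - apply in_l2_seq_scal, in_l2_seq_scal; trivial.
    - rewrite !normsq_seq_scal, Cmod_R, pow2_abs.
      assert (Cmod a ^ 2 <= 1).
      { rewrite <- (pow1 2). apply pow_incr. split; [apply Cmod_ge_0|lra]. }
      assert (0 <= normsq W (kernel_op (Cconj a) (blaschke_op l f))) by (apply normsq_nonneg; trivial).
      nra. }
  specialize (h f hf).
  assert (0 <= / (1 - Cmod a) ^ 2) by (unfold Rdiv in hk; lra).
  unfold Rdiv in *. nra.
Qed.

(** * Isometry on [H^2] and defects on smaller circles *)

(** The polarised form of [|1 - conj a z|^2 - |z - a|^2 = (1 - |a|^2) (1 - |z|^2)], applied to [u]
    and [v] with the shift in place of [z]; it already holds at each index. *)
Lemma factor_op_defect_term a f g j :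
  let u := kernel_op (Cconj a) f in let v := kernel_op (Cconj a) g in
  dot (f j) (g j) - dot (factor_op a f j) (factor_op a g j) =
  (1 - Cmod a ^ 2) * (dot (u j) (v j) - dot (fshift u j) (fshift v j)).
Proof.
intros u v.
assert (hf : f j = Cminus (u j) (Cmult (Cconj a) (fshift u j))).
{ exact (eq_sym (equal_f (kernel_op_spec (Cconj a) f) j)). }
assert (hg : g j = Cminus (v j) (Cmult (Cconj a) (fshift v j))).
{ exact (eq_sym (equal_f (kernel_op_spec (Cconj a) g) j)). }
rewrite hf, hg. unfold factor_op, seq_sub, seq_scal. fold u v.
destruct (u j) as [u1 u2], (v j) as [v1 v2], (fshift u j) as [s1 s2], (fshift v j) as [t1 t2], a as [a1 a2].
rewrite Cmod_sq. unfold dot. simpl. ring.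
Qed.

Lemma factor_op_defect r W1 W2 a f g :
  admissible W1 -> admissible W2 -> (forall j, (r ^ j) ^ 2 <= W1 j * W2 j) -> Cmod a < 1 ->
  in_l2 W1 f -> in_l2 W2 g ->
  pairing (geom r) f g - pairing (geom r) (factor_op a f) (factor_op a g) =
  (1 - Cmod a ^ 2) * (1 - r) * pairing (geom r) (kernel_op (Cconj a) f) (kernel_op (Cconj a) g).
Proof.
intros h1 h2 hr ha hf hg.
assert (ha' := Cmod_conj_lt a ha).
assert (p1 := admissible_pos _ h1). assert (p2 := admissible_pos _ h2).
assert (hu : in_l2 W1 (kernel_op (Cconj a) f)) by (apply in_l2_kernel_op; trivial).
assert (hv : in_l2 W2 (kernel_op (Cconj a) g)) by (apply in_l2_kernel_op; trivial).
assert (hex : forall x y, in_l2 W1 x -> in_l2 W2 y -> ex_series (fun j => dot (x j) (y j) * geom r j)).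
{ intros x y hx hy. apply pairing_ex with W1 W2; trivial. }
assert (hs : pairing (geom r) (fshift (kernel_op (Cconj a) f)) (fshift (kernel_op (Cconj a) g)) =
   r * pairing (geom r) (kernel_op (Cconj a) f) (kernel_op (Cconj a) g)).
{ unfold pairing. rewrite Series_incr_1; [|apply hex; apply in_l2_fshift; trivial].
  simpl. rewrite <- Series_scal_l. unfold dot at 1. simpl.
  rewrite (Series_ext _ (fun n => r * (dot (kernel_op (Cconj a) f n) (kernel_op (Cconj a) g n) * geom r n))).
  - ring.
  - intros n. unfold geom. simpl. ring. }
transitivity ((1 - Cmod a ^ 2) * (pairing (geom r) (kernel_op (Cconj a) f) (kernel_op (Cconj a) g) -
   pairing (geom r) (fshift (kernel_op (Cconj a) f)) (fshift (kernel_op (Cconj a) g)))).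
- unfold pairing. rewrite <- !Series_minus; try apply hex; trivial;
  try (apply in_l2_fshift; trivial); try (apply in_l2_factor_op; trivial).
  rewrite <- Series_scal_l. apply Series_ext. intros j.
  pose proof (factor_op_defect_term a f g j) as h. cbn zeta in h.
  rewrite <- !Rmult_minus_distr_r. rewrite h. ring.
- rewrite hs. ring.
Qed.

Lemma geom1 : geom 1 = ones.
Proof. seq_ext j. apply pow1. Qed.

(** At [r = 1] the factor [1 - r] of the defect vanishes. With two weights, one argument may lie
    outside [H^2] if the other lies in the dual space. *)
Lemma blaschke_op_isometry W1 W2 l f g :
  admissible W1 -> admissible W2 -> (forall j, 1 <= W1 j * W2 j) -> in_disc l ->
  in_l2 W1 f -> in_l2 W2 g -> pairing ones (blaschke_op l f) (blaschke_op l g) = pairing ones f g.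
Proof.
intros h1 h2 hr hl hf hg. induction hl as [|a l ha hl IH]; simpl; trivial.
rewrite <- IH. symmetry. apply Rminus_diag_uniq. rewrite <- geom1.
rewrite (factor_op_defect 1 W1 W2); trivial; try (apply in_l2_blaschke_op; trivial).
- ring.
- intros j. rewrite !pow1. trivial.
Qed.

Lemma geom_nonincreasing r : 0 < r <= 1 -> nonincreasing (geom r).
Proof.
intros hr. split; intros j; unfold geom; [apply pow_lt; lra|].
simpl. pose proof (pow_lt r j). nra.
Qed.

Lemma ones_nonincreasing : nonincreasing ones.
Proof. split; intros; unfold ones; lra. Qed.

(* For [U] multiplication by [B], the mean of [(1 - |B|^2) |f|^2] over [|z|^2 = r]. *)
Definition defect (r : R) (U : (nat -> C) -> nat -> C) (f : nat -> C) : R :=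
  normsq (geom r) f - normsq (geom r) (U f).

Section Defect.

Variable r : R.
Hypothesis hr : 0 < r <= 1.

Let hA : admissible (geom r) := nonincreasing_admissible _ (geom_nonincreasing r hr).
Let hP : forall j, 0 <= geom r j := admissible_pos _ hA.

Lemma defect_factor_op a f : Cmod a < 1 -> in_l2 (geom r) f ->
  defect r (factor_op a) f = (1 - Cmod a ^ 2) * (1 - r) * normsq (geom r) (kernel_op (Cconj a) f).
Proof.
intros ha hf. unfold defect. rewrite !normsq_pairing. apply factor_op_defect with (geom r) (geom r); trivial.
intros j. right. unfold geom; ring.
Qed.

Lemma defect_coef_pos a : Cmod a < 1 -> 0 <= (1 - Cmod a ^ 2) * (1 - r).
Proof.
intros ha. apply Rmult_le_pos; [|lra]. pose proof (Cmod_ge_0 a). nra.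
Qed.

Lemma blaschke_op_contractive l f : in_disc l -> in_l2 (geom r) f -> normsq (geom r) (blaschke_op l f) <= normsq (geom r) f.
Proof.
intros hl hf. induction hl as [|a l ha hl IH]; simpl; [lra|].
eapply Rle_trans; [|exact IH].
assert (hT : in_l2 (geom r) (blaschke_op l f)) by (apply in_l2_blaschke_op; trivial).
pose proof (defect_factor_op a (blaschke_op l f) ha hT) as h. unfold defect in h.
assert (0 <= normsq (geom r) (kernel_op (Cconj a) (blaschke_op l f))).
{ apply normsq_nonneg; trivial. apply in_l2_kernel_op; trivial. apply Cmod_conj_lt; trivial. }
pose proof (defect_coef_pos a ha). nra.
Qed.

(** Peeling off factors writes the defect as a sum of terms [(1 - |a|^2) (1 - r)] times the squared
    norm of a [kernel_op]; [U] commutes with all the operators involved and contracts each term. *)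
Lemma defect_monotone l U f :
  in_disc l -> shift_linear U ->
  (forall g, in_l2 (geom r) g -> in_l2 (geom r) (U g) /\ normsq (geom r) (U g) <= normsq (geom r) g) ->
  in_l2 (geom r) f -> defect r (blaschke_op l) (U f) <= defect r (blaschke_op l) f.
Proof.
intros hl hU hc hf. induction hl as [|a l ha hl IH]; unfold defect in *; simpl; [lra|].
assert (hT : in_l2 (geom r) (blaschke_op l f)) by (apply in_l2_blaschke_op; trivial).
assert (hTU : in_l2 (geom r) (blaschke_op l (U f))) by (apply in_l2_blaschke_op; trivial; apply hc; trivial).
pose proof (defect_factor_op a (blaschke_op l f) ha hT) as h1.
pose proof (defect_factor_op a (blaschke_op l (U f)) ha hTU) as h2.
unfold defect in *.
rewrite <- (shift_linear_blaschke_op_comm U) in * by trivial. rewrite <- (shift_linear_kernel_op U) in h2 by trivial.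
destruct (hc (kernel_op (Cconj a) (blaschke_op l f))) as [_ h3].
{ apply in_l2_kernel_op; trivial. apply Cmod_conj_lt; trivial. }
pose proof (defect_coef_pos a ha). nra.
Qed.

(** [f = (1 - conj a z) u] with [|1 - conj a z| <= 2]. *)
Lemma normsq_le_kernel_op a f : Cmod a < 1 -> in_l2 (geom r) f ->
  normsq (geom r) f <= 4 * normsq (geom r) (kernel_op (Cconj a) f).
Proof.
intros ha hf. set (u := kernel_op (Cconj a) f).
assert (hu : in_l2 (geom r) u) by (apply in_l2_kernel_op; trivial; apply Cmod_conj_lt; trivial).
rewrite <- (kernel_op_spec (Cconj a) f). fold u. rewrite seq_sub_eq.
eapply Rle_trans; [apply normsq_seq_add_le; trivial|].
- apply in_l2_seq_scal, in_l2_seq_scal, in_l2_fshift; trivial.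
- rewrite !normsq_seq_scal, Cmod_R, pow2_abs, Cmod_conj.
  assert (h3 : normsq (geom r) (fshift u) <= normsq (geom r) u).
  { rewrite normsq_fshift; trivial. rewrite <- (Rmult_1_l (normsq (geom r) u)). apply normsq_le; trivial.
    - intros j. rewrite Rmult_1_l. apply geom_nonincreasing; trivial.
    - apply in_l2_fshift_iff, in_l2_fshift; trivial. }
  assert (0 <= normsq (geom r) (fshift u)) by (apply normsq_nonneg; trivial; apply in_l2_fshift; trivial).
  assert (Cmod a ^ 2 <= 1).
  { rewrite <- (pow1 2). apply pow_incr. split; [apply Cmod_ge_0|lra]. }
  nra.
Qed.

Lemma blaschke_op_cons_comm a l f : blaschke_op (a :: l) f = blaschke_op l (factor_op a f).
Proof. simpl. symmetry. apply shift_linear_factor_op_comm, blaschke_op_shift_linear. Qed.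

Lemma defect_cons_ge a l f : Cmod a < 1 -> in_disc l -> in_l2 (geom r) f ->
  (1 - Cmod a ^ 2) * (1 - r) * normsq (geom r) (kernel_op (Cconj a) f) <= defect r (blaschke_op (a :: l)) f.
Proof.
intros ha hl hf. rewrite <- defect_factor_op; trivial. unfold defect.
rewrite blaschke_op_cons_comm.
pose proof (blaschke_op_contractive l (factor_op a f) hl ltac:(apply in_l2_factor_op; trivial)). lra.
Qed.

Lemma blaschke_op_strictly_contractive a l f :
  Cmod a < 1 -> in_disc l -> in_l2 (geom r) f ->
  normsq (geom r) (blaschke_op (a :: l) f) <= (1 - (1 - Cmod a ^ 2) * (1 - r) / 4) * normsq (geom r) f.
Proof.
intros ha hl hf. pose proof (defect_cons_ge a l f ha hl hf) as h.
pose proof (normsq_le_kernel_op a f ha hf). pose proof (defect_coef_pos a ha).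
unfold defect in h. nra.
Qed.

(* the mean of [(1 - |B|^2)^2 |f|^2] over [|z|^2 = r] *)
Definition second_defect (l : list C) (f : nat -> C) : R :=
  normsq (geom r) f - 2 * normsq (geom r) (blaschke_op l f) + normsq (geom r) (blaschke_op l (blaschke_op l f)).

Lemma second_defect_eq l f :
  second_defect l f = defect r (blaschke_op l) f - defect r (blaschke_op l) (blaschke_op l f).
Proof. unfold second_defect, defect. ring. Qed.

Lemma blaschke_op_self_contraction l : in_disc l ->
  forall g, in_l2 (geom r) g -> in_l2 (geom r) (blaschke_op l g) /\ normsq (geom r) (blaschke_op l g) <= normsq (geom r) g.
Proof. intros; split; [apply in_l2_blaschke_op|apply blaschke_op_contractive]; trivial. Qed.

Lemma second_defect_nonneg l f : in_disc l -> in_l2 (geom r) f -> 0 <= second_defect l f.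
Proof.
intros hl hf. rewrite second_defect_eq.
pose proof (defect_monotone l (blaschke_op l) f hl (blaschke_op_shift_linear l) (blaschke_op_self_contraction l hl) hf). lra.
Qed.

(** Pointwise, [1 - |B|^2] is at least its value for the factor [a] alone, hence at least [k / 4].
    On coefficients this is two applications of [kernel_op], each costing a factor 4. *)
Lemma second_defect_ge a l f :
  Cmod a < 1 -> in_disc l -> in_l2 (geom r) f ->
  ((1 - Cmod a ^ 2) * (1 - r)) ^ 2 / 16 * normsq (geom r) f <= second_defect (a :: l) f.
Proof.
intros ha hl hf. rewrite second_defect_eq.
assert (hal : in_disc (a :: l)) by (constructor; trivial).
set (k := (1 - Cmod a ^ 2) * (1 - r)). assert (hk : 0 <= k) by (apply defect_coef_pos; trivial).
set (T := blaschke_op (a :: l)).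
assert (hTf : in_l2 (geom r) (T f)) by (apply in_l2_blaschke_op; trivial).
set (u := kernel_op (Cconj a) f).
assert (ha' := Cmod_conj_lt a ha).
assert (hu : in_l2 (geom r) u) by (apply in_l2_kernel_op; trivial).
assert (h1 : k * defect r T u <= defect r T f - defect r T (T f)).
{ assert (h0 : forall g, in_l2 (geom r) g -> defect r T g = defect r (factor_op a) g + defect r (blaschke_op l) (factor_op a g)).
  { intros g hg. unfold defect, T. rewrite blaschke_op_cons_comm. ring. }
  rewrite (h0 f hf), (h0 (T f) hTf), !defect_factor_op; trivial. fold k.
  pose proof (blaschke_op_shift_linear (a :: l)) as hsT. fold T in hsT.
  rewrite <- (shift_linear_kernel_op T), <- (shift_linear_factor_op_comm T) by trivial. fold u.
  pose proof (defect_monotone l T (factor_op a f) hl hsT (blaschke_op_self_contraction _ hal)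
    ltac:(apply in_l2_factor_op; trivial)).
  unfold defect at 1. nra. }
pose proof (defect_cons_ge a l u ha hl hu) as h2. fold k in h2. fold T in h2.
pose proof (normsq_le_kernel_op a f ha hf) as h3. fold u in h3.
pose proof (normsq_le_kernel_op a u ha hu) as h4.
eapply Rle_trans; [|exact h1].
apply Rle_trans with (k * (k * normsq (geom r) (kernel_op (Cconj a) u))).
- assert (0 <= k ^ 2) by apply pow2_ge_0.
  assert (normsq (geom r) f <= 16 * normsq (geom r) (kernel_op (Cconj a) u)) by lra. nra.
- apply Rmult_le_compat_l; trivial.
Qed.

End Defect.

(** * Exponential decay of the functions orthogonal to the range *)

Lemma normsq_scal_weight k W a : normsq (fun j => k * W j) a = k * normsq W a.
Proof. unfold normsq. rewrite <- Series_scal_l. apply Series_ext; intros; ring. Qed.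

Lemma in_l2_scal_weight k W a : in_l2 W a -> in_l2 (fun j => k * W j) a.
Proof.
intros h. apply ex_series_R_ext with (fun j => k * (Cmod (a j) ^ 2 * W j)).
- intros; ring.
- apply ex_series_R_scal; trivial.
Qed.

(** Scaling the recurrence by [R0] turns the growing weight into a multiplier [R0 * |b| < 1], and
    the convexity argument for [kernel_op] applies. *)
Lemma geometric_recursion_decay (R0 : R) b h h' :
  0 < R0 -> R0 * Cmod b < 1 ->
  (forall j, h (S j) = Cplus (Cmult b (h j)) (h' j)) ->
  in_l2 (geom (R0 ^ 2)) h' ->
  in_l2 (geom (R0 ^ 2)) h /\
  normsq (geom (R0 ^ 2)) h <=
    (Cmod (h O) ^ 2 + R0 ^ 2 / (1 - R0 * Cmod b) * normsq (geom (R0 ^ 2)) h') / (1 - R0 * Cmod b).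
Proof.
intros hR hb hrec hh'. set (be := R0 * Cmod b) in *. set (V := geom (R0 ^ 2)).
assert (hbe : 0 <= be) by (apply Rmult_le_pos; [lra|apply Cmod_ge_0]).
assert (hR2 : 0 < R0 ^ 2) by (apply pow_lt; trivial).
assert (hV : forall j, 0 <= V j) by (intros j; apply pow_le; lra).
set (k := R0 ^ 2 / (1 - be)).
assert (hk : 0 <= k) by (apply Rdiv_le_0_compat; lra).
assert (hterm : forall j, Cmod (h (S j)) ^ 2 * V (S j) <=
   be * (Cmod (h j) ^ 2 * V j) + k * (Cmod (h' j) ^ 2 * V j)).
{ intros j. pose proof (Cmod_affine_sq (Cmult (RtoC R0) b) (h j) (Cmult (RtoC R0) (h' j))) as h1.
  rewrite Cmod_mult, Cmod_R, (Rabs_pos_eq R0) in h1 by lra. fold be in h1. specialize (h1 hb).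
  replace (Cplus (Cmult (Cmult (RtoC R0) b) (h j)) (Cmult (RtoC R0) (h' j)))
    with (Cmult (RtoC R0) (h (S j))) in h1 by (rewrite hrec; ring).
  rewrite !Cmod_scal_sq, Cmod_R, (Rabs_pos_eq R0) in h1 by lra.
  apply Rle_trans with ((be * Cmod (h j) ^ 2 + R0 ^ 2 * Cmod (h' j) ^ 2 / (1 - be)) * V j).
  - replace (Cmod (h (S j)) ^ 2 * V (S j)) with (R0 ^ 2 * Cmod (h (S j)) ^ 2 * V j)
      by (unfold V, geom; simpl; ring).
    apply Rmult_le_compat_r; trivial.
  - right. unfold k. field. lra. }
set (G := fun n => sum_n (fun j => Cmod (h j) ^ 2 * V j) n).
set (F := fun n => sum_n (fun j => Cmod (h' j) ^ 2 * V j) n).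
assert (hV0 : V O = 1) by reflexivity.
assert (hG : forall n, G (S n) <= Cmod (h O) ^ 2 + be * G n + k * F n).
{ induction n; unfold G, F in *.
  - rewrite sum_n_S, !sum_n_0. specialize (hterm O). rewrite hV0 in *. lra.
  - rewrite sum_n_S. rewrite (sum_n_S _ n) at 2. rewrite (sum_n_S (fun j => Cmod (h' j) ^ 2 * V j) n).
    specialize (hterm (S n)). lra. }
assert (hG2 : forall n, G n <= G (S n)).
{ intros n. unfold G. rewrite sum_n_S. pose proof (Cmod2_pos (h (S n)) _ (hV (S n))). cbn beta in *; lra. }
apply (series_of_bounded_sums (fun j => Cmod (h j) ^ 2 * V j)).
- intros j; apply Cmod2_pos; trivial.
- intros n. specialize (hG n). specialize (hG2 n).
  assert (h1 : F n <= normsq V h').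
  { apply (sum_n_le_series (fun j => Cmod (h' j) ^ 2 * V j)); trivial. intros; apply Cmod2_pos; trivial. }
  assert (k * F n <= k * normsq V h') by (apply Rmult_le_compat_l; trivial).
  fold k. change (G n <= (Cmod (h O) ^ 2 + k * normsq V h') / (1 - be)).
  apply Rmult_le_reg_r with (1 - be); [lra|].
  unfold Rdiv. rewrite Rmult_assoc, Rinv_l by lra. lra.
Qed.

Lemma in_l2_bshift a : in_l2 ones a -> in_l2 ones (bshift a).
Proof. intros h. apply ex_series_incr_1 in h. exact h. Qed.

Lemma normsq_bshift a : in_l2 ones a -> normsq ones (bshift a) <= normsq ones a.
Proof.
intros h. unfold normsq. rewrite (Series_incr_1 (fun j => Cmod (a j) ^ 2 * ones j)); [|exact h].
change (Series (fun k => Cmod (a (S k)) ^ 2 * ones (S k)))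
  with (Series (fun j => Cmod (bshift a j) ^ 2 * ones j)).
pose proof (Cmod2_pos (a O) (ones O) Rle_0_1). lra.
Qed.

Lemma ones_admissible : admissible ones.
Proof. exact (nonincreasing_admissible _ ones_nonincreasing). Qed.

Lemma ones_pos j : 0 <= ones j.
Proof. exact (admissible_pos _ ones_admissible j). Qed.

Lemma pairing_ones_ex a b : in_l2 ones a -> in_l2 ones b -> ex_series (fun j => dot (a j) (b j) * ones j).
Proof. apply pairing_self_ex. exact ones_pos. Qed.

Lemma pairing_fshift_bshift g h : in_l2 ones g -> in_l2 ones h -> pairing ones (fshift g) h = pairing ones g (bshift h).
Proof.
intros hg hh. unfold pairing. rewrite Series_incr_1.
- simpl. unfold dot at 1. simpl. unfold bshift, ones. ring.
- apply pairing_ones_ex; trivial. apply in_l2_fshift; trivial; exact ones_admissible.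
Qed.

Lemma pairing_ones_sub_r f g h : in_l2 ones f -> in_l2 ones g -> in_l2 ones h ->
  pairing ones h (seq_sub f g) = pairing ones h f - pairing ones h g.
Proof.
intros hf hg hh. rewrite pairing_sym, seq_sub_eq, pairing_seq_add_l.
- rewrite pairing_seq_scal_real, (pairing_sym ones f), (pairing_sym ones g). ring.
- apply pairing_ones_ex; trivial.
- apply pairing_ones_ex; trivial. apply in_l2_seq_scal; trivial.
Qed.

(* [h] orthogonal to [B H^2] satisfies the linear recurrence with characteristic
   roots [conj a], [a] in [l] *)
Lemma range_orthogonal_decay (R0 : R) l : 0 < R0 ->
  in_disc l -> List.Forall (fun a : C => R0 * Cmod a < 1) l ->
  exists C, 0 <= C /\ forall h, in_l2 ones h ->
    (forall f, in_l2 ones f -> pairing ones (blaschke_op l f) h = 0) ->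
    in_l2 (geom (R0 ^ 2)) h /\ normsq (geom (R0 ^ 2)) h <= C * normsq ones h.
Proof.
intros hR hl hlR. induction l as [|a l IH].
- exists 0. split; [lra|]. intros h hh h0. specialize (h0 h hh). simpl in h0.
  rewrite <- normsq_pairing in h0. apply normsq_eq0 in h0; trivial; [|apply ones_nonincreasing].
  subst h. split; [apply in_l2_seq_zero|].
  rewrite Rmult_0_l. right. transitivity (Series (fun _ => 0)); [|apply series_zero].
  apply Series_ext. intros j. unfold seq_zero. rewrite Cmod_0. ring.
- inversion_clear hl as [|? ? ha hl']. inversion_clear hlR as [|? ? haR hlR'].
  destruct (IH hl' hlR') as [C1 [hC1 hdec]]. clear IH.
  set (be := R0 * Cmod a) in *.
  exists ((1 + R0 ^ 2 / (1 - be) * (C1 * 4)) / (1 - be)).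
  assert (hR2 : 0 < R0 ^ 2) by (apply pow_lt; trivial).
  assert (hk : 0 <= R0 ^ 2 / (1 - be)) by (apply Rdiv_le_0_compat; lra).
  split.
  { apply Rdiv_le_0_compat; [|lra]. assert (0 <= C1 * 4) by lra. nra. }
  intros h hh horth.
  set (h' := seq_sub (bshift h) (seq_scal (Cconj a) h)).
  assert (hbh := in_l2_bshift h hh).
  assert (hh' : in_l2 ones h').
  { apply in_l2_seq_sub; trivial; [exact ones_pos|]. apply in_l2_seq_scal; trivial. }
  destruct (hdec h' hh') as [h1 h2].
  (* Moving the backward shift across the pairing, [h'] tested on [w] is [h] tested on [(z - a) w],
     which is in the range of the full product by [factor_op_inverse]. *)
  { intros g hg. set (w := blaschke_op l g).
    assert (hw : in_l2 ones w) by (apply in_l2_blaschke_op; trivial; exact ones_admissible).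
    assert (hsw : in_l2 ones (fshift w)) by (apply in_l2_fshift; trivial; exact ones_admissible).
    unfold h'. rewrite pairing_ones_sub_r; trivial; [|apply in_l2_seq_scal; trivial].
    rewrite <- pairing_fshift_bshift, <- pairing_seq_scal_l; trivial.
    rewrite (pairing_sym _ (fshift w)), (pairing_sym _ (seq_scal a w)), <- pairing_ones_sub_r; trivial; [|apply in_l2_seq_scal; trivial].
    rewrite <- factor_op_inverse, pairing_sym.
    pose proof (blaschke_op_shift_linear l) as hs.
    unfold w. rewrite <- (sl_sh _ hs), <- (sl_scz _ hs), <- (shift_linear_seq_sub _ _ _ hs).
    apply (horth (seq_sub g (seq_scal (Cconj a) (fshift g)))).
    apply in_l2_seq_sub; trivial; [exact ones_pos|]. apply in_l2_seq_scal; apply in_l2_fshift; trivial; exact ones_admissible. }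
  assert (h3 : normsq ones h' <= 4 * normsq ones h).
  { unfold h'. rewrite seq_sub_eq. eapply Rle_trans; [apply normsq_seq_add_le; trivial|].
    - exact ones_pos.
    - apply in_l2_seq_scal; apply in_l2_seq_scal; trivial.
    - rewrite !normsq_seq_scal, Cmod_R, pow2_abs, Cmod_conj.
      assert (Cmod a ^ 2 <= 1).
      { rewrite <- (pow1 2). apply pow_incr. split; [apply Cmod_ge_0|lra]. }
      assert (0 <= normsq ones h) by (apply normsq_nonneg; trivial; exact ones_pos).
      pose proof (normsq_bshift h hh). nra. }
  destruct (geometric_recursion_decay R0 (Cconj a) h h') as [h4 h5]; trivial.
  { rewrite Cmod_conj; trivial. }
  { intros j. unfold h', seq_sub, bshift, seq_scal. ring. }
  split; trivial. rewrite Cmod_conj in h5. fold be in h5.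
  eapply Rle_trans; [exact h5|]. unfold Rdiv at 1 3.
  rewrite Rmult_assoc, (Rmult_comm (/ (1 - be))), <- Rmult_assoc.
  apply Rmult_le_compat_r; [left; apply Rinv_0_lt_compat; lra|].
  rewrite Rmult_plus_distr_r, Rmult_1_l.
  apply Rplus_le_compat.
  + pose proof (series_ge_term (fun j => Cmod (h j) ^ 2 * ones j) O) as h6.
    cbn beta in h6. unfold ones at 2 in h6. rewrite Rmult_1_r in h6. apply h6; trivial.
    intros; apply Cmod2_pos; apply ones_pos.
  + rewrite Rmult_assoc. apply Rmult_le_compat_l; trivial.
    eapply Rle_trans; [exact h2|]. rewrite Rmult_assoc.
    apply Rmult_le_compat_l; trivial.
Qed.

Lemma common_radius l : in_disc l ->
  exists R0, 1 < R0 /\ List.Forall (fun a : C => R0 * Cmod a < 1) l.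
Proof.
intros hl. induction hl as [|a l ha hl [R1 [h1 h2]]].
- exists 2. split; [lra|constructor].
- pose (R2 := 2 / (1 + Cmod a)). pose proof (Cmod_ge_0 a).
  assert (hR2 : 1 < R2).
  { unfold R2. apply Rmult_lt_reg_r with (1 + Cmod a); [lra|].
    unfold Rdiv. rewrite Rmult_assoc, Rinv_l by lra. lra. }
  assert (hR2a : R2 * Cmod a < 1).
  { unfold R2. apply Rmult_lt_reg_r with (1 + Cmod a); [lra|].
    replace (2 / (1 + Cmod a) * Cmod a * (1 + Cmod a)) with (2 * Cmod a) by (field; lra). lra. }
  exists (Rmin R1 R2). split; [apply Rmin_glb_lt; trivial|].
  constructor.
  + eapply Rle_lt_trans; [|exact hR2a]. apply Rmult_le_compat_r; trivial. apply Rmin_r.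
  + eapply List.Forall_impl; [|exact h2]. intros b hb. cbn beta in *.
    eapply Rle_lt_trans; [|exact hb]. apply Rmult_le_compat_r; [apply Cmod_ge_0|apply Rmin_l].
Qed.

(** Bernoulli for [sqrt R0], squared. The exponent 2 is the one required by [((1 - r) * j) ^ 2] in
    the cross terms. *)
Lemma square_le_geometric R0 : 1 < R0 -> exists c, 0 < c /\ forall j, INR j ^ 2 <= c * R0 ^ j.
Proof.
intros hR. set (s := sqrt R0).
assert (hs : 1 < s) by (rewrite <- sqrt_1; apply sqrt_lt_1; lra).
assert (hss : s * s = R0) by (apply sqrt_sqrt; lra).
exists (/ (s - 1) ^ 2). split; [apply Rinv_0_lt_compat, pow_lt; lra|].
intros j. rewrite <- hss, Rpow_mult_distr.
pose proof (poly j (s - 1) ltac:(lra)) as hp.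
replace (1 + (s - 1)) with s in hp by ring.
pose proof (pos_INR j).
assert (hj : 0 <= INR j * (s - 1)) by (apply Rmult_le_pos; lra).
assert (hle : (INR j * (s - 1)) * (INR j * (s - 1)) <= s ^ j * s ^ j)
  by (apply Rmult_le_compat; lra).
apply Rmult_le_reg_l with ((s - 1) ^ 2); [apply pow_lt; lra|].
rewrite <- Rmult_assoc, Rinv_r by (apply pow_nonzero; lra). lra.
Qed.

Lemma pow_unit_interval x j : 0 <= x <= 1 -> 0 <= x ^ j <= 1.
Proof.
intros hx. split; [apply pow_le; lra|].
rewrite <- (pow1 j). apply pow_incr; trivial.
Qed.

Lemma one_sub_pow_le r j : 0 <= r <= 1 -> 0 <= 1 - r ^ j <= (1 - r) * INR j.
Proof.
intros hr. assert (hp := pow_unit_interval r j hr).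
split; [lra|]. clear hp. induction j; [simpl; lra|].
assert (hp := pow_unit_interval r j hr).
rewrite S_INR. simpl. nra.
Qed.

Definition one_sub_geom (r : R) : nat -> R := fun j => 1 - r ^ j.

Lemma normsq_one_sub_geom r a : 0 < r <= 1 -> in_l2 ones a -> normsq (one_sub_geom r) a = normsq ones a - normsq (geom r) a.
Proof.
intros hr ha. unfold normsq. rewrite <- Series_minus; trivial.
- apply Series_ext; intros j. unfold one_sub_geom, ones, geom. ring.
- apply (in_l2_le (geom r) ones 1); trivial.
  + intros j; left; apply geom_nonincreasing; trivial.
  + intros j. unfold ones, geom. rewrite Rmult_1_l, <- (pow1 j). apply pow_incr. lra.
Qed.

Lemma in_l2_geom_of_ones r a : 0 < r <= 1 -> in_l2 ones a -> in_l2 (geom r) a.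
Proof.
intros hr ha. apply in_l2_le with ones 1; trivial.
- intros j; left; apply geom_nonincreasing; trivial.
- intros j. unfold ones, geom. rewrite Rmult_1_l, <- (pow1 j). apply pow_incr. lra.
Qed.

Lemma in_l2_one_sub_geom r a : 0 < r <= 1 -> in_l2 ones a -> in_l2 (one_sub_geom r) a.
Proof.
intros hr ha. apply in_l2_le with ones 1; trivial; intros j;
destruct (one_sub_pow_le r j) as [h1 h2]; try lra; unfold one_sub_geom; trivial.
pose proof (pow_le r j). unfold ones. lra.
Qed.

Lemma in_disc_app l l' : in_disc l -> in_disc l' -> in_disc (l ++ l').
Proof. intros; apply List.Forall_app; split; trivial. Qed.

Lemma blaschke_op_app l l' f : blaschke_op (l ++ l') f = blaschke_op l (blaschke_op l' f).
Proof. unfold blaschke_op. apply List.fold_right_app. Qed.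

(** * The main inequality *)

(* [y] plays the role of the adjoint of [B] applied to [x], so [x = h + B y] is the
   orthogonal decomposition in [H^2].  The cross terms [<h, B y>] are taken in the
   weight [1 - r^j], which produces the factor [1 - r], and the decay of [h] makes
   them cost only the norm of [y] on a fixed circle of radius [< 1]. *)
Lemma circle_inequality l : in_disc l -> exists r0, 0 < r0 < 1 /\
  forall eps, 0 < eps -> exists K, 0 <= K /\ forall r x y, 0 < r < 1 ->
    in_l2 ones x -> in_l2 ones y ->
    (forall f, in_l2 ones f -> pairing ones (blaschke_op l f) x = pairing ones f y) ->
    normsq (one_sub_geom r) (blaschke_op l x) + normsq (one_sub_geom r) y - 2 * normsq (one_sub_geom r) x <=
    (1 - r) * (K * normsq ones (seq_sub x (blaschke_op l y)) + eps * normsq (geom r0) y)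
    - second_defect r l y.
Proof.
intros hl. destruct (common_radius l hl) as [R0 [hR1 hR]].
assert (hRR : List.Forall (fun a : C => R0 * Cmod a < 1) (l ++ l)) by (apply List.Forall_app; auto).
assert (hll := in_disc_app l l hl hl).
destruct (range_orthogonal_decay R0 l ltac:(lra) hl hR) as [C1 [hC1 hd1]].
(* [T h] is orthogonal to the range of [T] squared, the product over [l ++ l], so its coefficients
   decay as well. *)
destruct (range_orthogonal_decay R0 (l ++ l) ltac:(lra) hll hRR) as [C2 [hC2 hd2]].
destruct (square_le_geometric R0 hR1) as [c [hc hcj]].
(* With this radius the product of the weights [R0^(2j)] and [r0^j] is [R0^j], which dominates
   [j^2]. *)
set (r0 := / R0).
assert (hr0 : 0 < r0 < 1).
{ unfold r0. split; [apply Rinv_0_lt_compat; lra|]. rewrite <- Rinv_1. apply Rinv_lt_contravar; lra. }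
exists r0. split; trivial. intros eps heps.
set (e := eps / 3). assert (he : 0 < e) by (unfold e; lra).
assert (hce : 0 < c / e) by (apply Rdiv_lt_0_compat; trivial).
(* The terms pay for [T h] itself, the cross term of [T h] with [T (T y)], and twice the cross term
   of [h] with [T y]. These three cross terms also explain [e = eps / 3]. *)
exists (c * C2 + c / e * C2 + 2 * (c / e * C1)).
assert (0 <= c * C2) by (apply Rmult_le_pos; lra).
assert (0 <= c / e * C2) by (apply Rmult_le_pos; lra).
assert (0 <= c / e * C1) by (apply Rmult_le_pos; lra).
split; [lra|].
intros r x y hr hx hy hxy.
set (T := blaschke_op l). set (h := seq_sub x (T y)).
assert (hT : forall f, in_l2 ones f -> in_l2 ones (T f)) by (intros; apply in_l2_blaschke_op; trivial; exact ones_admissible).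
assert (hiso : forall f g, in_l2 ones f -> in_l2 ones g -> pairing ones (T f) (T g) = pairing ones f g).
{ intros; apply blaschke_op_isometry with ones ones; trivial; try exact ones_admissible.
  intros; unfold ones; lra. }
assert (hison : forall f, in_l2 ones f -> normsq ones (T f) = normsq ones f).
{ intros; rewrite !normsq_pairing; auto. }
assert (hh : in_l2 ones h) by (apply in_l2_seq_sub; auto; exact ones_pos).
assert (horth : forall f, in_l2 ones f -> pairing ones (T f) h = 0).
{ intros f hf. unfold h. rewrite pairing_ones_sub_r; auto. unfold T at 1. rewrite hxy, hiso; auto. ring. }
destruct (hd1 h hh horth) as [hV1 hV1'].
destruct (hd2 (T h) (hT h hh)) as [hV2 hV2'].
{ intros f hf. rewrite blaschke_op_app. fold T. rewrite hiso; auto. }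
rewrite hison in hV2' by trivial.
set (V := geom (R0 ^ 2)) in *. set (Hn := normsq ones h) in *.
assert (hVpos : forall j, 0 <= V j) by (intros j; apply pow_le, pow2_ge_0).
assert (hom : forall j, one_sub_geom r j ^ 2 <= 1 * 1).
{ intros j. destruct (one_sub_pow_le r j) as [h1 _]; [lra|].
  pose proof (pow_le r j ltac:(lra)). unfold one_sub_geom. nra. }
assert (hr1 : 0 < r <= 1) by lra.
assert (hr01 : 0 < r0 <= 1) by lra.
assert (hx' : x = seq_add h (T y)).
{ seq_ext j. unfold h, seq_add, seq_sub. ring. }
assert (hTx : T x = seq_add (T h) (T (T y))).
{ rewrite hx'. apply (sl_add _ (blaschke_op_shift_linear l)). }
assert (hsplit : forall a b, in_l2 ones a -> in_l2 ones b ->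
  normsq (one_sub_geom r) (seq_add a b) = normsq (one_sub_geom r) a + 2 * pairing (one_sub_geom r) a b + normsq (one_sub_geom r) b).
{ intros a b ha hb. apply normsq_seq_add with ones; trivial; try (apply in_l2_one_sub_geom; trivial).
  exact ones_pos. }
assert (hVj : forall j, INR j ^ 2 <= c * (V j * geom r0 j)).
{ intros j. unfold V, geom, r0. rewrite <- Rpow_mult_distr.
  replace (R0 ^ 2 * / R0) with R0 by (field; lra). apply hcj. }
assert (hcross : forall a b, in_l2 ones a -> in_l2 ones b -> in_l2 V a ->
  Rabs (2 * pairing (one_sub_geom r) a b) <= (1 - r) * (c / e * normsq V a + e * normsq (geom r0) b)).
{ intros a b ha hb hVa.
  replace ((1 - r) * (c / e * normsq V a + e * normsq (geom r0) b)) with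
    (normsq (fun j => (1 - r) * (c / e) * V j) a + normsq (fun j => (1 - r) * e * geom r0 j) b)
    by (rewrite !normsq_scal_weight; ring).
  apply pairing_young.
  - intros j. apply Rmult_le_pos; trivial. apply Rmult_le_pos; lra.
  - intros j. apply Rmult_le_pos; [apply Rmult_le_pos; lra|]. left; apply geom_nonincreasing; trivial.
  - intros j. destruct (one_sub_pow_le r j) as [h1 h2]; [lra|].
    replace ((1 - r) * (c / e) * V j * ((1 - r) * e * geom r0 j))
      with ((1 - r) ^ 2 * (c * (V j * geom r0 j))) by (field; lra).
    apply Rle_trans with (((1 - r) * INR j) ^ 2).
    + apply pow_incr. split; trivial.
    + rewrite Rpow_mult_distr. apply Rmult_le_compat_l; [apply pow2_ge_0|trivial].
  - apply in_l2_scal_weight; trivial.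
  - apply in_l2_scal_weight, in_l2_geom_of_ones; trivial. }
assert (hTh : normsq (one_sub_geom r) (T h) <= (1 - r) * (c * C2) * Hn).
{ apply Rle_trans with ((1 - r) * c * normsq V (T h)).
  - apply normsq_le; auto; [|apply in_l2_one_sub_geom; auto].
    intros j. destruct (one_sub_pow_le r j) as [h1 h2]; [lra|].
    unfold one_sub_geom. eapply Rle_trans; [exact h2|]. rewrite Rmult_assoc.
    apply Rmult_le_compat_l; [lra|].
    apply Rle_trans with (INR j ^ 2).
    + destruct j; [simpl; lra|]. rewrite S_INR. pose proof (pos_INR j). nra.
    + eapply Rle_trans; [apply hVj|]. apply Rmult_le_compat_l; [lra|].
      rewrite <- (Rmult_1_r (V j)) at 2. apply Rmult_le_compat_l; trivial.
      unfold geom. rewrite <- (pow1 j). apply pow_incr. lra.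
  - rewrite !Rmult_assoc. apply Rmult_le_compat_l; [lra|]. apply Rmult_le_compat_l; lra. }
assert (hY1 : normsq (geom r0) (T y) <= normsq (geom r0) y).
{ apply blaschke_op_contractive; trivial. apply in_l2_geom_of_ones; trivial. }
assert (hY2 : normsq (geom r0) (T (T y)) <= normsq (geom r0) y).
{ eapply Rle_trans; [|exact hY1]. apply blaschke_op_contractive; trivial. apply in_l2_geom_of_ones; auto. }
pose proof (hcross h (T y) hh (hT y hy) hV1) as hc1.
pose proof (hcross (T h) (T (T y)) (hT h hh) ltac:(auto) hV2) as hc2.
apply Rabs_le_between in hc1, hc2.
assert (hh0 : 0 <= normsq (one_sub_geom r) h).
{ apply normsq_nonneg; [|apply in_l2_one_sub_geom; trivial]. intros j. apply one_sub_pow_le. lra. }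
rewrite hTx. rewrite hx'. rewrite !hsplit; auto.
assert (hG : normsq (one_sub_geom r) (T (T y)) + normsq (one_sub_geom r) y - 2 * normsq (one_sub_geom r) (T y) = - second_defect r l y).
{ unfold second_defect. change (blaschke_op l) with T. rewrite !normsq_one_sub_geom, !hison; auto. ring. }
fold T in hG |- *.
assert (hb1 : (1 - r) * (c / e * normsq V h + e * normsq (geom r0) (T y)) <=
   (1 - r) * (c / e * C1 * Hn + e * normsq (geom r0) y)).
{ apply Rmult_le_compat_l; [lra|]. apply Rplus_le_compat; [|apply Rmult_le_compat_l; lra].
  rewrite Rmult_assoc. apply Rmult_le_compat_l; lra. }
assert (hb2 : (1 - r) * (c / e * normsq V (T h) + e * normsq (geom r0) (T (T y))) <=
   (1 - r) * (c / e * C2 * Hn + e * normsq (geom r0) y)).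
{ apply Rmult_le_compat_l; [lra|]. apply Rplus_le_compat; [|apply Rmult_le_compat_l; lra].
  rewrite Rmult_assoc. apply Rmult_le_compat_l; lra. }
replace (seq_sub (seq_add h (T y)) (T y)) with h by (rewrite <- hx'; reflexivity).
fold Hn. replace eps with (3 * e) by (unfold e; field).
lra.
Qed.

(** * Weights comparable to [(j+1)^al] *)

Lemma sum_n_affine (u v : nat -> R) c J :
  sum_n (fun j => v j + c * u j) J = sum_n v J + c * sum_n u J.
Proof.
induction J; [rewrite !sum_n_0; trivial|].
rewrite !(sum_n_S _ J). unfold AbelianMonoid.sort in IHJ. cbn in IHJ |- *. rewrite IHJ. lra.
Qed.

Lemma series_tail_bound (u v : nat -> R) J :
  (forall j, Rabs (u j) <= v j) -> ex_series v ->
  Rabs (Series u - sum_n u J) <= Series v - sum_n v J.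
Proof.
intros h hv. assert (hu := ex_series_R_le u v h hv).
assert (hb : forall j, - v j <= u j <= v j) by (intros; apply Rabs_le_between; auto).
assert (hc : forall c, c = 1 \/ c = -1 ->
   sum_n v J + c * sum_n u J <= Series v + c * Series u).
{ intros c hc. rewrite <- sum_n_affine, <- Series_scal_l.
  rewrite <- Series_plus by (trivial; apply ex_series_R_scal; trivial).
  apply sum_n_le_series.
  - intros j; specialize (hb j); destruct hc as [-> | ->]; lra.
  - apply ex_series_R_plus; [|apply ex_series_R_scal]; trivial. }
pose proof (hc 1 ltac:(auto)). pose proof (hc (-1) ltac:(auto)).
apply Rabs_le. lra.
Qed.

(** Dominated convergence as an inequality: tails beyond [J] are uniformly small, and finitely many
    terms converge. *)
Lemma series_bound_of_dominated_limit (Pn : nat -> nat -> R) (P X M : nat -> R) c :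
  (forall n j, 0 <= Pn n j <= M j) -> (forall j, is_lim_seq (fun n => Pn n j) (P j)) ->
  ex_series (fun j => Rabs (X j) * M j) ->
  (forall n, Series (fun j => X j * Pn n j) <= c) ->
  Series (fun j => X j * P j) <= c.
Proof.
intros hPn hlim hex hc.
assert (hP : forall j, 0 <= P j <= M j).
{ intros j. split.
  - refine (is_lim_seq_le (fun _ => 0) (fun n => Pn n j) 0 (P j) _ (is_lim_seq_const 0) (hlim j)).
    intros; apply hPn.
  - refine (is_lim_seq_le (fun n => Pn n j) (fun _ => M j) (P j) (M j) _ (hlim j) (is_lim_seq_const (M j))).
    intros; apply hPn. }
assert (hdom : forall p : nat -> R, (forall j, 0 <= p j <= M j) -> forall j, Rabs (X j * p j) <= Rabs (X j) * M j).
{ intros p hp j. rewrite Rabs_mult, (Rabs_pos_eq (p j)) by apply hp.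
  apply Rmult_le_compat_l; [apply Rabs_pos|apply hp]. }
apply le_of_le_add_eps. intros e he.
set (v := fun j => Rabs (X j) * M j) in *.
assert (hv : is_lim_seq (sum_n v) (Series v)) by exact (Series_correct v hex).
apply is_lim_seq_spec in hv.
destruct (hv (mkposreal (e / 4) ltac:(lra))) as [J hJ]. specialize (hJ J (le_n _)). simpl in hJ.
apply Rabs_lt_between in hJ.
assert (hs : is_lim_seq (fun n => sum_n (fun j => X j * Pn n j) J) (sum_n (fun j => X j * P j) J)).
{ clear hJ. induction J.
  - rewrite sum_n_0. eapply is_lim_seq_ext; [intros n; symmetry; exact (sum_n_0 (fun j => X j * Pn n j))|].
    apply is_lim_seq_mult'; trivial. apply is_lim_seq_const.
  - rewrite sum_n_S.
    eapply is_lim_seq_ext; [intros n; symmetry; exact (sum_n_S (fun j => X j * Pn n j) J)|].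
    apply is_lim_seq_plus'; trivial. apply is_lim_seq_mult'; trivial. apply is_lim_seq_const. }
apply is_lim_seq_spec in hs.
destruct (hs (mkposreal (e / 4) ltac:(lra))) as [n hn]. specialize (hn n (le_n _)). simpl in hn.
apply Rabs_lt_between in hn.
pose proof (series_tail_bound _ _ J (hdom P hP) hex) as h1.
pose proof (series_tail_bound _ _ J (hdom (Pn n) (hPn n)) hex) as h2.
apply Rabs_le_between in h1. apply Rabs_le_between in h2. specialize (hc n).
fold v in h1, h2. lra.
Qed.

(* The weights in the closed cone generated by the sequences [1 - r^j], with an
   [A] controlling the total mass [sum c_i (1 - r_i)]. *)
Definition circle_weight (P : nat -> R) (A : R) : Prop :=
  0 <= A /\ (forall j, 0 <= P j) /\ (forall j, P j <= P (S j) <= P j + A) /\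
  forall X K, ex_series (fun j => Rabs (X j) * (1 + P j)) -> 0 <= K ->
    (forall r, 0 < r < 1 -> Series (fun j => X j * one_sub_geom r j) <= (1 - r) * K) ->
    Series (fun j => X j * P j) <= A * K.

Definition comparable (W : nat -> R) (al : R) : Prop :=
  exists c1 c2, 0 < c1 /\ 0 < c2 /\
    forall j, c1 * Rpower (INR (j + 1)) al <= W j <= c2 * Rpower (INR (j + 1)) al.

Lemma circle_weight_zero : circle_weight (fun _ => 0) 0.
Proof.
split; [lra|]. split; [intros; lra|]. split; [intros; lra|].
intros X K _ hK _. right. rewrite Rmult_0_l.
transitivity (Series (fun _ => 0)); [|apply series_zero].
apply Series_ext. intros; ring.
Qed.

(** [j] is the limit of [(1 - r^j) / (1 - r)] as [r] tends to 1, and each quotient has mass 1. *)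
Lemma circle_weight_id : circle_weight INR 1.
Proof.
split; [lra|]. split; [apply pos_INR|].
split; [intros j; rewrite S_INR; lra|].
intros X K hX hK h. rewrite Rmult_1_l.
pose (rn := fun n => 1 - / (INR n + 2)).
assert (hrn : forall n, 0 < rn n < 1).
{ intros n. unfold rn. pose proof (pos_INR n).
  assert (0 < / (INR n + 2) < 1); [|lra].
  split; [apply Rinv_0_lt_compat; lra|]. rewrite <- Rinv_1. apply Rinv_lt_contravar; lra. }
assert (hlim1 : is_lim_seq rn 1).
{ unfold rn. replace (Finite 1) with (Finite (1 - 0)) by (f_equal; ring).
  apply is_lim_seq_minus'; [apply is_lim_seq_const|].
  replace (Finite 0) with (Rbar_inv p_infty) by reflexivity.
  apply is_lim_seq_inv; [|discriminate].
  apply is_lim_seq_plus with p_infty 2; [apply is_lim_seq_INR|apply is_lim_seq_const|reflexivity]. }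
apply (series_bound_of_dominated_limit (fun n j => one_sub_geom (rn n) j / (1 - rn n)) INR X (fun j => 1 + INR j)); trivial.
- intros n j. specialize (hrn n). destruct (one_sub_pow_le (rn n) j) as [h1 h2]; [lra|].
  fold (one_sub_geom (rn n) j) in *.
  split; [apply Rdiv_le_0_compat; trivial; lra|].
  apply Rmult_le_reg_r with (1 - rn n); [lra|].
  unfold Rdiv. rewrite Rmult_assoc, Rinv_l by lra. lra.
- induction j.
  + eapply is_lim_seq_ext; [|apply is_lim_seq_const]. intros n. unfold one_sub_geom. simpl.
    specialize (hrn n). field. lra.
  + rewrite S_INR.
    apply is_lim_seq_ext with (fun n => one_sub_geom (rn n) j / (1 - rn n) + rn n ^ j).
    { intros n. specialize (hrn n). unfold one_sub_geom. simpl. field. lra. }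
    apply is_lim_seq_plus'; trivial. clear IHj.
    induction j; [apply is_lim_seq_const|]. simpl.
    replace (Finite 1) with (Finite (1 * 1)) by (f_equal; ring).
    apply is_lim_seq_mult'; trivial.
- intros n. specialize (hrn n).
  rewrite (Series_ext _ (fun j => / (1 - rn n) * (X j * one_sub_geom (rn n) j))) by (intros; unfold Rdiv; ring).
  rewrite Series_scal_l. apply Rmult_le_reg_l with (1 - rn n); [lra|].
  rewrite <- Rmult_assoc, Rinv_r, Rmult_1_l by lra. apply h; trivial.
Qed.

(** * Dyadic weights of growth [(j+1)^al], [0 < al < 1] *)

Section Dyadic.

Variable al : R.
Hypothesis hal : 0 < al < 1.

Let q : R := Rpower 2 al.
Let s : R := q / 2.

Lemma dyadic_q_bounds : 1 < q < 2.
Proof.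
unfold q. split.
- rewrite <- (Rpower_O 2) by lra. apply Rpower_lt; lra.
- rewrite <- (Rpower_1 2) at 2 by lra. apply Rpower_lt; lra.
Qed.

(** [1 - (1 - 2^-m)^j] behaves like the minimum of 1 and [j 2^-m]. Weighted by [q^m = 2^(al m)], the
    terms grow with ratio [q > 1] until [2^m] reaches [j], then decay with ratio [s = q / 2 < 1],
    and sum to order [j^al]. Exponents start at 1 to keep the radii positive. *)
Definition dyadic_term (j m : nat) : R := q ^ S m * one_sub_geom (1 - (1 / 2) ^ S m) j.
Definition dyadic_weight (j : nat) : R := Series (dyadic_term j).

Lemma half_pow_bounds m : 0 < (1 / 2) ^ S m < 1.
Proof.
split; [apply pow_lt; lra|]. induction m; simpl in *; [lra|].
assert (0 < 1 / 2 * (1 / 2) ^ m) by (apply Rmult_lt_0_compat; [lra|apply pow_lt; lra]). lra.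
Qed.

Lemma s_pow m : q ^ m * (1 / 2) ^ m = s ^ m.
Proof. rewrite <- Rpow_mult_distr. unfold s, Rdiv. rewrite Rmult_1_l. trivial. Qed.

Lemma s_bounds : 0 < s < 1.
Proof. pose proof dyadic_q_bounds. unfold s. lra. Qed.

Lemma dyadic_term_bounds j m :
  0 <= dyadic_term j m /\ dyadic_term j m <= q ^ S m /\ dyadic_term j m <= s ^ S m * INR j.
Proof.
pose proof (half_pow_bounds m) as hh. pose proof dyadic_q_bounds as hq.
assert (hqm : 0 < q ^ S m) by (apply pow_lt; lra).
destruct (one_sub_pow_le (1 - (1 / 2) ^ S m) j) as [h1 h2]; [lra|].
fold (one_sub_geom (1 - (1 / 2) ^ S m) j) in *. unfold dyadic_term.
split; [apply Rmult_le_pos; lra|]. split.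
- rewrite <- (Rmult_1_r (q ^ S m)) at 2. apply Rmult_le_compat_l; [lra|].
  unfold one_sub_geom. pose proof (pow_le (1 - (1 / 2) ^ S m) j). lra.
- rewrite <- s_pow, Rmult_assoc. apply Rmult_le_compat_l; [lra|]. lra.
Qed.

Lemma ex_series_s : ex_series (fun m => s ^ S m).
Proof.
apply (ex_series_R_scal s (fun m => s ^ m)). apply ex_series_geom.
pose proof s_bounds. rewrite Rabs_pos_eq; lra.
Qed.

Lemma ex_dyadic j : ex_series (dyadic_term j).
Proof.
apply ex_series_R_le with (fun m => INR j * s ^ S m).
- intros m. destruct (dyadic_term_bounds j m) as [h1 [h2 h3]].
  rewrite Rabs_pos_eq; lra.
- apply ex_series_R_scal, ex_series_s.
Qed.

(** The coefficient [q^m] at radius [1 - 2^-m] contributes [q^m 2^-m = s^m] to the mass. *)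
Lemma dyadic_circle_weight : circle_weight dyadic_weight (Series (fun m => s ^ S m)).
Proof.
set (A := Series (fun m => s ^ S m)).
assert (hsp : forall m, 0 <= s ^ S m) by (intros; apply pow_le; pose proof s_bounds; lra).
assert (hA : 0 <= A) by (apply series_nonneg; trivial; apply ex_series_s).
assert (ht0 : forall j m, 0 <= dyadic_term j m) by (intros; apply dyadic_term_bounds).
split; trivial. split; [intros j; apply series_nonneg; trivial; apply ex_dyadic|].
split.
- intros j.
  assert (hd : forall m, dyadic_term j m <= dyadic_term (S j) m <= dyadic_term j m + s ^ S m).
  { intros m. unfold dyadic_term. pose proof (half_pow_bounds m) as hh. pose proof dyadic_q_bounds as hq.
    set (x := (1 / 2) ^ S m) in *.
    assert (he : one_sub_geom (1 - x) (S j) = one_sub_geom (1 - x) j + (1 - x) ^ j * x) by (unfold one_sub_geom; simpl; ring).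
    assert (hp := pow_unit_interval (1 - x) j ltac:(lra)).
    assert (hqm : 0 < q ^ S m) by (apply pow_lt; lra).
    rewrite <- s_pow. fold x. rewrite he.
    assert (0 <= (1 - x) ^ j * x <= x) by (split; [apply Rmult_le_pos|rewrite <- (Rmult_1_l x) at 3; apply Rmult_le_compat_r]; lra).
    rewrite <- Rmult_plus_distr_l. split; apply Rmult_le_compat_l; lra. }
  unfold dyadic_weight. split.
  + apply series_le_of_ex; try apply ex_dyadic. intros; apply hd.
  + unfold A. rewrite <- Series_plus; [|apply ex_dyadic|apply ex_series_s].
    apply series_le_of_ex; [intros; apply hd|apply ex_dyadic|].
    apply ex_series_R_plus; [apply ex_dyadic|apply ex_series_s].
- intros X K hX hK h.
  assert (hpart : forall n j, 0 <= sum_n (dyadic_term j) n <= dyadic_weight j).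
  { intros n j. split; [|apply sum_n_le_series; trivial; apply ex_dyadic].
    induction n; [rewrite sum_n_0; auto|]. rewrite sum_n_S. specialize (ht0 j (S n)). lra. }
  apply (series_bound_of_dominated_limit (fun n j => sum_n (dyadic_term j) n) _ X (fun j => 1 + dyadic_weight j)); trivial.
  + intros n j. specialize (hpart n j). lra.
  + intros j. exact (Series_correct _ (ex_dyadic j)).
  + intros n.
    assert (hle : forall p, (forall j, 0 <= p j <= dyadic_weight j) -> ex_series (fun j => X j * p j)).
    { intros p hp. eapply ex_series_R_le; [|exact hX]. intros j. cbn beta.
      specialize (hp j). rewrite Rabs_mult, (Rabs_pos_eq (p j)) by lra.
      apply Rmult_le_compat_l; [apply Rabs_pos|lra]. }
    assert (hterm : forall m, Series (fun j => X j * dyadic_term j m) <= s ^ S m * K).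
    { intros m. unfold dyadic_term.
      rewrite (Series_ext _ (fun j => q ^ S m * (X j * one_sub_geom (1 - (1 / 2) ^ S m) j))) by (intros; ring).
      rewrite Series_scal_l, <- s_pow, Rmult_assoc. apply Rmult_le_compat_l.
      - apply pow_le. pose proof dyadic_q_bounds; lra.
      - pose proof (half_pow_bounds m). eapply Rle_trans; [apply h; lra|]. right; ring. }
    apply Rle_trans with (sum_n (fun m => s ^ S m) n * K).
    * induction n.
      -- rewrite sum_n_0. eapply Rle_trans; [|apply hterm]. right. apply Series_ext.
         intros j. rewrite sum_n_0. trivial.
      -- rewrite sum_n_S.
         rewrite (Series_ext _ (fun j => X j * sum_n (dyadic_term j) n + X j * dyadic_term j (S n)))
           by (intros j; rewrite sum_n_S; ring).
         rewrite Series_plus.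
         ++ specialize (hterm (S n)). lra.
         ++ apply hle; auto.
         ++ apply hle. intros j. split; [apply ht0|]. apply series_ge_term; trivial. apply ex_dyadic.
    * apply Rmult_le_compat_r; trivial. apply sum_n_le_series; trivial. apply ex_series_s.
Qed.

Lemma q_pow_Rpower p : q ^ p = Rpower (2 ^ p) al.
Proof.
rewrite <- Rpower_pow by (unfold q, Rpower; apply exp_pos).
rewrite <- (Rpower_pow p 2) by lra.
unfold q. rewrite !Rpower_mult. f_equal. ring.
Qed.

Lemma dyadic_scale j : exists p,
  2 ^ p <= INR (j + 1) < 2 ^ S p /\ q ^ p <= Rpower (INR (j + 1)) al <= q ^ S p.
Proof.
set (p := Nat.log2 (j + 1)). exists p.
destruct (Nat.log2_spec (j + 1)) as [h1 h2]; [lia|]. fold p in h1, h2.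
apply le_INR in h1. apply lt_INR in h2. rewrite pow_INR in h1, h2.
change (INR 2) with 2 in *.
assert (0 < 2 ^ p) by (apply pow_lt; lra).
split; [split; trivial|]. rewrite !q_pow_Rpower.
split; apply Rle_Rpower_l; lra.
Qed.

Lemma one_sub_pow_ge x j : 0 <= x <= 1 -> (1 - x) ^ j * (1 + INR j * x) <= 1.
Proof.
intros hx. destruct (Req_dec x 0) as [->|hx0].
- rewrite Rminus_0_r, pow1, Rmult_0_r. lra.
- pose proof (poly j x ltac:(lra)) as hp.
  apply Rle_trans with ((1 - x) ^ j * (1 + x) ^ j).
  + apply Rmult_le_compat_l; trivial. apply pow_le; lra.
  + rewrite <- Rpow_mult_distr. apply pow_unit_interval.
    split; [apply Rmult_le_pos; lra|nra].
Qed.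

Lemma dyadic_comparable : comparable (fun j => 1 + dyadic_weight j) al.
Proof.
pose proof dyadic_q_bounds as hq. pose proof s_bounds as hs.
(* With [2^p <= j + 1 < 2^(p+1)] and [x = 2^-(p+1)], [j x >= 1/4] for [j >= 1], so
   [1 - (1 - x)^j >= 1 - 1 / (1 + 1/4) = 1/5]. The upper constant adds the geometric sums before and
   after [p]. *)
exists (1 / 5), (1 + (q * q / (q - 1) + 2 * q / (1 - s))).
assert (hk1 : 0 < q * q / (q - 1)) by (apply Rdiv_lt_0_compat; nra).
assert (hk2 : 0 < 2 * q / (1 - s)) by (apply Rdiv_lt_0_compat; lra).
split; [lra|]. split; [lra|].
intros j. destruct (dyadic_scale j) as [p [[hp1 hp2] [hp3 hp4]]].
assert (h2p : 0 < 2 ^ p) by (apply pow_lt; lra).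
assert (hqp : 1 <= q ^ p) by (apply pow_R1_Rle; lra).
assert (hj1 : INR (j + 1) = INR j + 1) by (rewrite plus_INR; trivial).
assert (ht0 : forall m, 0 <= dyadic_term j m) by (intros; apply dyadic_term_bounds).
split.
- destruct j.
  + simpl INR in *. simpl. rewrite Rpower_1_l || (replace (Rpower 1 al) with 1 by (unfold Rpower; rewrite ln_1, Rmult_0_r, exp_0; trivial)).
    assert (0 <= dyadic_weight 0) by (apply series_nonneg; trivial; apply ex_dyadic). lra.
  + assert (ht : dyadic_term (S j) p <= dyadic_weight (S j)).
    { apply series_ge_term; trivial. apply ex_dyadic. }
    assert (hge : q ^ S p * (1 / 5) <= dyadic_term (S j) p).
    { unfold dyadic_term. apply Rmult_le_compat_l; [apply pow_le; lra|].
      pose proof (half_pow_bounds p) as hh. set (x := (1 / 2) ^ S p) in *.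
      pose proof (one_sub_pow_ge x (S j) ltac:(lra)) as h. unfold one_sub_geom.
      assert (hx : 1 / 4 <= INR (S j) * x).
      { assert (hx2 : 2 ^ p * x = 1 / 2).
        { unfold x. simpl. rewrite <- Rmult_assoc, (Rmult_comm (2 ^ p)), Rmult_assoc, <- Rpow_mult_distr.
          replace (2 * (1 / 2)) with 1 by field. rewrite pow1. ring. }
        rewrite S_INR in *. pose proof (pos_INR j). nra. }
      pose proof (pow_le (1 - x) (S j) ltac:(lra)). nra. }
    lra.
- assert (hmon : forall n k, sum_n (dyadic_term j) n <= sum_n (dyadic_term j) (k + n)).
  { intros n k. induction k; [simpl; lra|]. change (S k + n)%nat with (S (k + n)). rewrite sum_n_S.
    specialize (ht0 (S (k + n))). lra. }
  assert (hF1 : forall n, sum_n (dyadic_term j) n <= q ^ n * (q * q / (q - 1))).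
  { assert (hqq : q * (q * q / (q - 1)) = q * q / (q - 1) + q * q) by (field; lra).
    induction n.
    - rewrite sum_n_0. destruct (dyadic_term_bounds j 0) as [_ [h _]]. simpl in *.
      assert (q <= q * q / (q - 1)); [|lra].
      apply Rmult_le_reg_r with (q - 1); [lra|]. unfold Rdiv. rewrite Rmult_assoc, Rinv_l by lra. nra.
    - rewrite sum_n_S. destruct (dyadic_term_bounds j (S n)) as [_ [h _]].
      simpl in h |- *. replace (q * q ^ n * (q * q / (q - 1))) with (q ^ n * (q * (q * q / (q - 1)))) by ring.
      rewrite hqq. lra. }
  assert (hF2 : forall k, sum_n (dyadic_term j) (k + p) <=
     q ^ p * (q * q / (q - 1)) + INR j * ((s ^ S (S p) - s ^ S (S (k + p))) / (1 - s))).
  { induction k.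
    - change (0 + p)%nat with p. replace ((s ^ S (S p) - s ^ S (S p)) / (1 - s)) with 0 by (field; lra). rewrite Rmult_0_r.
      specialize (hF1 p). lra.
    - change (S k + p)%nat with (S (k + p)). rewrite sum_n_S. destruct (dyadic_term_bounds j (S (k + p))) as [_ [_ h]].
      replace ((s ^ S (S p) - s ^ S (S (S (k + p)))) / (1 - s)) with
        ((s ^ S (S p) - s ^ S (S (k + p))) / (1 - s) + s ^ S (S (k + p))) by (simpl; field; lra).
      lra. }
  assert (hb : forall n, sum_n (dyadic_term j) n <= q ^ p * (q * q / (q - 1) + 2 * q / (1 - s))).
  { intros n. eapply Rle_trans; [apply (hmon n p)|]. rewrite Nat.add_comm.
    eapply Rle_trans; [apply hF2|]. rewrite Rmult_plus_distr_l. apply Rplus_le_compat_l.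
    assert (hsk : 0 <= s ^ S (S (n + p))) by (apply pow_le; lra).
    assert (hsj : INR j * s ^ S (S p) <= q ^ p * (2 * q)).
    { apply Rle_trans with (2 ^ S p * s ^ S (S p)).
      - apply Rmult_le_compat_r; [apply pow_le; lra|]. lra.
      - assert (h2 : 2 ^ p * (1 / 2) ^ p = 1).
        { rewrite <- Rpow_mult_distr. replace (2 * (1 / 2)) with 1 by field. apply pow1. }
        replace (2 ^ S p * s ^ S (S p)) with (q ^ p * (2 * (s * s)) * (2 ^ p * (1 / 2) ^ p))
          by (rewrite <- !tech_pow_Rmult, <- s_pow; ring).
        rewrite h2, Rmult_1_r. apply Rmult_le_compat_l; [lra|]. nra. }
    unfold Rdiv. rewrite <- !Rmult_assoc.
    apply Rmult_le_compat_r; [left; apply Rinv_0_lt_compat; lra|].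
    pose proof (pos_INR j). nra. }
  destruct (series_of_bounded_sums (dyadic_term j) _ ht0 hb) as [_ hfin].
  fold (dyadic_weight j) in hfin.
  assert (q ^ p * (q * q / (q - 1) + 2 * q / (1 - s)) <=
    Rpower (INR (j + 1)) al * (q * q / (q - 1) + 2 * q / (1 - s))).
  { apply Rmult_le_compat_r; lra. }
  lra.
Qed.

End Dyadic.

(** The dyadic sum requires [1 < q < 2], so the endpoints are treated apart. *)
Lemma circle_weight_exists al : 0 <= al <= 1 ->
  exists P A, circle_weight P A /\ comparable (fun j => 1 + P j) al.
Proof.
intros hal.
assert (hj : forall j, 0 < INR (j + 1)) by (intros j; apply lt_0_INR; lia).
destruct (Req_dec al 0) as [->|h0].
{ exists (fun _ => 0), 0. split; [apply circle_weight_zero|].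
  exists 1, 1. repeat split; try lra; rewrite Rpower_O; trivial; lra. }
destruct (Req_dec al 1) as [->|h1].
{ exists INR, 1. split; [apply circle_weight_id|].
  exists 1, 1. repeat split; try lra; rewrite Rpower_1, plus_INR; trivial; simpl; lra. }
assert (h : 0 < al < 1) by lra.
exists (dyadic_weight al), (Series (fun m => (Rpower 2 al / 2) ^ S m)).
split; [apply dyadic_circle_weight|apply dyadic_comparable]; trivial.
Qed.

(** * The adjoint inequality and its dual *)

Definition adjoint_pair (l : list C) (x y : nat -> C) : Prop :=
  forall f, in_l2 ones f -> pairing ones (blaschke_op l f) x = pairing ones f y.

(* The adjoint is taken for the unweighted ([H^2]) pairing, the norms have weight [Q].
   At [x = B y] the inequality says that [B] is concave for the weight [Q]; by
   duality it is Shimorin's condition for the weight [1/Q]. *)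
Definition adjoint_inequality (l : list C) (Q : nat -> R) : Prop :=
  forall x y, in_l2 Q x -> in_l2 Q y -> adjoint_pair l x y ->
    normsq Q y + normsq Q (blaschke_op l x) <= 2 * normsq Q x.

Definition std_weight (Q : nat -> R) : Prop :=
  (forall j, 1 <= Q j) /\ exists A, 0 <= A /\ forall j, Q j <= Q (S j) <= Q j + A.

Lemma std_weight_admissible Q : std_weight Q -> admissible Q.
Proof.
intros [h1 [A [hA h2]]]. split; [intros j; specialize (h1 j); lra|].
exists A, A. repeat split; trivial.
- intros j. apply h2.
- intros j. specialize (h1 j). nra.
Qed.

Lemma std_weight_kernel_op Q : std_weight Q -> nonincreasing (fun j => / Q j).
Proof.
intros [h1 [A [hA h2]]]. split; intros j.
- apply Rinv_0_lt_compat. specialize (h1 j). lra.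
- apply Rinv_le_contravar; [specialize (h1 j); lra|apply h2].
Qed.

Lemma std_weight_ones Q a : std_weight Q -> in_l2 Q a -> in_l2 ones a.
Proof.
intros [h1 _]. apply in_l2_le with (c := 1); intros j; unfold ones; [lra|].
specialize (h1 j). lra.
Qed.

Lemma std_weight_kernel_op_ones Q a : std_weight Q -> in_l2 ones a -> in_l2 (fun j => / Q j) a.
Proof.
intros [h1 _]. apply in_l2_le with (c := 1); intros j; specialize (h1 j).
- left. apply Rinv_0_lt_compat. lra.
- unfold ones. rewrite Rmult_1_r, <- Rinv_1. apply Rinv_le_contravar; lra.
Qed.

Lemma adjoint_weight_exists a l al : Cmod a < 1 -> in_disc l -> 0 <= al <= 1 ->
  exists Q, std_weight Q /\ comparable Q al /\ adjoint_inequality (a :: l) Q.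
Proof.
intros ha hl0 hal. set (l' := a :: l).
assert (hl : in_disc l') by (constructor; trivial).
destruct (circle_weight_exists al hal) as [P [A [[hA [hP0 [hPA hP]]] [c1 [c2 [hc1 [hc2 hc]]]]]]].
destruct (circle_inequality l' hl) as [r0 [hr0 hcirc]].
set (kap := ((1 - Cmod a ^ 2) * (1 - r0)) ^ 2 / 16).
assert (hkap : 0 < kap).
{ apply Rdiv_lt_0_compat; [|lra]. apply pow_lt. apply Rmult_lt_0_compat; [|lra].
  pose proof (Cmod_ge_0 a). nra. }
(* [P] has mass [A] and the summand [1 - r0^j] counts for at most 1, so the total error in [y] is at
   most [kap] times its squared norm on the circle [r0], which the second defect there pays for. *)
destruct (hcirc (kap / (1 + A))) as [K [hK hineq]]; [apply Rdiv_lt_0_compat; lra|].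
clear hcirc.
(* The total error in [h] is at most [K * (1 + A)] times its squared norm. The constant weight pays
   for it, since on [H^2] the inequality holds with surplus exactly that squared norm ([hnh]). *)
set (Cq := 1 + K * (1 + A)).
assert (hCq : 1 <= Cq) by (unfold Cq; assert (0 <= K * (1 + A)) by (apply Rmult_le_pos; lra); lra).
set (Q := fun j => Cq + one_sub_geom r0 j + P j).
assert (hom : forall j, 0 <= one_sub_geom r0 j <= 1).
{ intros j. unfold one_sub_geom. pose proof (pow_unit_interval r0 j ltac:(lra)). lra. }
exists Q.
assert (hQ : std_weight Q).
{ split; [intros j; unfold Q; specialize (hom j); specialize (hP0 j); lra|].
  exists (1 + A). split; [lra|]. intros j. unfold Q, one_sub_geom. specialize (hPA j). simpl.
  pose proof (pow_unit_interval r0 j ltac:(lra)).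
  assert (0 <= r0 * r0 ^ j <= r0 ^ j) by (split; [apply Rmult_le_pos|]; nra). lra. }
split; trivial. split.
{ exists c1, ((Cq + 1) * c2). split; trivial. split; [apply Rmult_lt_0_compat; lra|].
  intros j. specialize (hc j). specialize (hom j). specialize (hP0 j). unfold Q. split; [lra|].
  rewrite Rmult_assoc. apply Rle_trans with ((Cq + 1) * (1 + P j)); [nra|].
  apply Rmult_le_compat_l; lra. }
intros x y hx hy hxy.
assert (hTx : in_l2 Q (blaschke_op l' x)) by (apply in_l2_blaschke_op; trivial; apply std_weight_admissible; trivial).
assert (hones : forall f, in_l2 Q f -> in_l2 ones f) by (intros; apply std_weight_ones with Q; trivial).
assert (hP1 : forall f, in_l2 Q f -> in_l2 (fun j => 1 + P j) f).
{ intros f. apply in_l2_le with 1; intros j; specialize (hP0 j); specialize (hom j); unfold Q; lra. }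
assert (hPin : forall f, in_l2 Q f -> in_l2 P f).
{ intros f. apply in_l2_le with 1; intros j; specialize (hP0 j); specialize (hom j); unfold Q; lra. }
assert (homin : forall r f, 0 < r < 1 -> in_l2 Q f -> in_l2 (one_sub_geom r) f) by (intros; apply in_l2_one_sub_geom; auto; lra).
set (X := fun j => Cmod (blaschke_op l' x j) ^ 2 + Cmod (y j) ^ 2 - 2 * Cmod (x j) ^ 2).
assert (hser : forall W, in_l2 W (blaschke_op l' x) -> in_l2 W y -> in_l2 W x ->
   normsq W (blaschke_op l' x) + normsq W y - 2 * normsq W x = Series (fun j => X j * W j)).
{ intros W h1 h2 h3. unfold normsq. rewrite <- Series_scal_l, <- Series_plus, <- Series_minus; trivial.
  - apply Series_ext; intros j. unfold X. ring.
  - apply ex_series_R_plus; trivial.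
  - apply ex_series_R_scal; trivial. }
set (h := seq_sub x (blaschke_op l' y)) in *. set (Y := normsq (geom r0) y).
assert (hh1 : in_l2 ones h).
{ apply in_l2_seq_sub; [exact ones_pos|auto|]. apply hones, in_l2_blaschke_op; trivial. apply std_weight_admissible; trivial. }
assert (hiso : forall f g, in_l2 ones f -> in_l2 ones g -> pairing ones (blaschke_op l' f) (blaschke_op l' g) = pairing ones f g).
{ intros; apply blaschke_op_isometry with ones ones; trivial; try exact ones_admissible. intros; unfold ones; lra. }
assert (hTy : in_l2 ones (blaschke_op l' y)) by (apply in_l2_blaschke_op; auto; exact ones_admissible).
assert (hnh : normsq ones (blaschke_op l' x) + normsq ones y - 2 * normsq ones x = - normsq ones h).
{ assert (hxs : x = seq_add h (blaschke_op l' y)) by (seq_ext j; unfold h, seq_add, seq_sub; ring).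
  assert (hhT : pairing ones h (blaschke_op l' y) = 0).
  { rewrite pairing_sym. unfold h. rewrite pairing_ones_sub_r; auto. rewrite hxy, hiso; auto. ring. }
  rewrite (normsq_pairing ones (blaschke_op l' x)), hiso, <- normsq_pairing; auto.
  assert (hn : normsq ones x = normsq ones h + normsq ones y).
  { rewrite hxs at 1. rewrite normsq_seq_add with (W1 := ones); trivial.
    - rewrite hhT, (normsq_pairing ones (blaschke_op l' y)), hiso, <- normsq_pairing; auto. ring.
    - exact ones_pos.
    - intros; right; ring. }
  lra. }
set (K' := K * normsq ones h + kap / (1 + A) * Y).
assert (hY : 0 <= Y).
{ apply normsq_nonneg; [intros j; apply pow_le; lra|]. apply in_l2_geom_of_ones; auto; lra. }
assert (hH : 0 <= normsq ones h) by (apply normsq_nonneg; trivial; exact ones_pos).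
assert (hkA : 0 <= kap / (1 + A)) by (apply Rdiv_le_0_compat; lra).
assert (hK' : 0 <= K').
{ unfold K'. apply Rplus_le_le_0_compat; apply Rmult_le_pos; trivial. }
assert (hPK : normsq P (blaschke_op l' x) + normsq P y - 2 * normsq P x <= A * K').
{ rewrite hser; auto. apply hP; trivial.
  - eapply ex_series_R_le; [|apply (ex_series_R_plus (fun j => Cmod (blaschke_op l' x j) ^ 2 * (1 + P j) + Cmod (y j) ^ 2 * (1 + P j))
      (fun j => 2 * (Cmod (x j) ^ 2 * (1 + P j))))].
    + intros j. rewrite Rabs_mult, Rabs_Rabsolu, (Rabs_pos_eq (1 + P j)) by (specialize (hP0 j); lra).
      cbn beta. rewrite <- Rmult_assoc, <- !Rmult_plus_distr_r.
      apply Rmult_le_compat_r; [specialize (hP0 j); lra|]. unfold X.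
      pose proof (pow2_ge_0 (Cmod (blaschke_op l' x j))). pose proof (pow2_ge_0 (Cmod (y j))).
      pose proof (pow2_ge_0 (Cmod (x j))). apply Rabs_le. lra.
    + apply ex_series_R_plus; apply hP1; trivial.
    + apply ex_series_R_scal. apply (hP1 x hx).
  - intros r hr. rewrite <- hser; auto.
    pose proof (hineq r x y hr ltac:(auto) ltac:(auto) hxy) as h1. fold h Y in h1. fold K' in h1.
    pose proof (second_defect_nonneg r ltac:(lra) l' y hl) as h2.
    specialize (h2 ltac:(apply in_l2_geom_of_ones; auto; lra)). lra. }
assert (hr0K : normsq (one_sub_geom r0) (blaschke_op l' x) + normsq (one_sub_geom r0) y - 2 * normsq (one_sub_geom r0) x <= K' - kap * Y).
{ pose proof (hineq r0 x y hr0 ltac:(auto) ltac:(auto) hxy) as h1. fold h Y in h1. fold K' in h1.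
  pose proof (second_defect_ge r0 ltac:(lra) a l y ha hl0) as h2.
  specialize (h2 ltac:(apply in_l2_geom_of_ones; auto; lra)). fold kap Y l' in h2.
  assert ((1 - r0) * K' <= K') by nra. lra. }
assert (hdec : forall f, in_l2 Q f -> normsq Q f = Cq * normsq ones f + normsq (one_sub_geom r0) f + normsq P f).
{ intros f hf. unfold normsq. rewrite <- Series_scal_l, <- !Series_plus; auto.
  - apply Series_ext; intros j. unfold Q, ones. ring.
  - apply ex_series_R_plus; [apply ex_series_R_scal; apply hones; trivial|apply homin; trivial].
  - apply hPin; trivial.
  - apply ex_series_R_scal; apply hones; trivial.
  - apply homin; trivial. }
rewrite !hdec by trivial.
assert (hfin : (1 + A) * K' = K * (1 + A) * normsq ones h + kap * Y) by (unfold K'; field; lra).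
unfold Cq in *.
assert (Cq * (normsq ones (blaschke_op l' x) + normsq ones y - 2 * normsq ones x) = - (Cq * normsq ones h)) by (rewrite hnh; ring).
unfold Cq in *. nra.
Qed.

Section Duality.

Variables (l : list C) (Q : nat -> R).
Hypothesis hl : in_disc l.
Hypothesis hQ : std_weight Q.

Let W : nat -> R := fun j => / Q j.
Let T : (nat -> C) -> nat -> C := blaschke_op l.

Let Qpos j : 0 < Q j.
Proof. destruct hQ as [h _]. specialize (h j). lra. Qed.
Let Wpos j : 0 < W j.
Proof. apply Rinv_0_lt_compat, Qpos. Qed.
Let Q0 j : 0 <= Q j.
Proof. left; apply Qpos. Qed.
Let W0 j : 0 <= W j.
Proof. left; apply Wpos. Qed.
Let WQ j : ones j ^ 2 <= W j * Q j.
Proof. unfold W, ones. rewrite Rinv_l; [lra|]. specialize (Qpos j). lra. Qed.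
Let admQ : admissible Q := std_weight_admissible Q hQ.
Let admW : admissible W := nonincreasing_admissible W (std_weight_kernel_op Q hQ).

Let TQ f : in_l2 Q f -> in_l2 Q (T f).
Proof. apply in_l2_blaschke_op; trivial. Qed.
Let TW f : in_l2 W f -> in_l2 W (T f).
Proof. apply in_l2_blaschke_op; trivial. Qed.

(** The Riesz isometry from weight [1/Q] onto weight [Q] for the unweighted pairing. *)
Let dual (a : nat -> C) : nat -> C := fun j => Cmult (RtoC (W j)) (a j).

Let dual_sq a j : Cmod (dual a j) ^ 2 * Q j = Cmod (a j) ^ 2 * W j.
Proof.
unfold dual. rewrite Cmod_scal_sq, Cmod_R, pow2_abs. unfold W. specialize (Qpos j). field. lra.
Qed.

Let dual_in_l2 a : in_l2 W a -> in_l2 Q (dual a).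
Proof. apply ex_series_R_ext. intros j. rewrite dual_sq. trivial. Qed.

Let dual_normsq a : normsq Q (dual a) = normsq W a.
Proof. apply Series_ext. intros j. apply dual_sq. Qed.

Let dual_pairing a b : pairing ones a (dual b) = pairing W a b.
Proof. apply Series_ext. intros j. unfold dual, ones, dot. simpl. ring. Qed.

(** Riesz representation in weight [1/Q], transported by [dual]: the [H^2] adjoint of [B] preserves
    weight [Q]. The identity is obtained for all [f] of weight [1/Q], beyond [H^2], as the dual
    estimates require. *)
Lemma adjoint_exists x : in_l2 Q x ->
  exists y, in_l2 Q y /\ forall f, in_l2 W f -> pairing ones (T f) x = pairing ones f y.
Proof.
intros hx. destruct (blaschke_op_bounded W l (std_weight_kernel_op Q hQ) hl) as [C0 [hC0 hb]].
assert (hn : 0 <= normsq Q x) by (apply normsq_nonneg; trivial).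
destruct (riesz_on_subspace _ _ _ _ _ (seq_real_hilbert W Wpos) (in_l2 W)
  (fun f => pairing ones (T f) x) (C0 * normsq Q x)) as [v [hv1 hv2]].
- split; trivial.
  + exists seq_zero. apply in_l2_seq_zero.
  + intros; apply in_l2_seq_add; trivial.
  + intros; apply in_l2_seq_scal; trivial.
- intros f g hf hg. unfold T. rewrite (sl_add _ (blaschke_op_shift_linear l)).
  apply pairing_seq_add_l; apply pairing_ex with W Q; trivial; apply TW; trivial.
- intros c f hf. unfold T. rewrite (sl_scz _ (blaschke_op_shift_linear l)). apply pairing_seq_scal_real.
- apply Rmult_le_pos; trivial.
- intros f hf. eapply Rle_trans; [apply pairing_cauchy_schwarz with (W1 := W) (W2 := Q); trivial; apply TW; trivial|].
  rewrite <- normsq_pairing. specialize (hb f hf). fold T in hb. nra.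
- exists (dual v). split; [apply dual_in_l2; trivial|].
  intros f hf. rewrite dual_pairing, (pairing_sym W), hv2; trivial.
Qed.

Hypothesis hI : adjoint_inequality l Q.

(** Taken at [x = T f], whose adjoint image is [f] by the isometry. *)
Lemma concave_of_adjoint_inequality f : in_l2 Q f ->
  normsq Q (T (T f)) + normsq Q f <= 2 * normsq Q (T f).
Proof.
intros hf. rewrite Rplus_comm. apply hI; auto.
intros g hg. apply blaschke_op_isometry with ones ones; trivial; try exact ones_admissible.
- intros; unfold ones; lra.
- apply std_weight_ones with Q; trivial.
Qed.

Lemma expansive_of_adjoint_inequality f : in_l2 Q f -> normsq Q f <= normsq Q (T f).
Proof.
intros hf.
assert (hn : forall n, in_l2 Q (Nat.iter n T f)) by (intros n; induction n; simpl; auto).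
apply (concave_nonneg_incr (fun n => normsq Q (Nat.iter n T f))).
- intros n. apply normsq_nonneg; trivial.
- intros n. apply concave_of_adjoint_inequality; trivial.
Qed.

Let adjoint_pair_of x : in_l2 Q x -> exists y, in_l2 Q y /\
  (forall f, in_l2 W f -> pairing ones (T f) x = pairing ones f y) /\
  normsq Q y + normsq Q (T x) <= 2 * normsq Q x.
Proof.
intros hx. destruct (adjoint_exists x hx) as [y [hy1 hy2]]. exists y. repeat split; trivial.
apply hI; trivial. intros f hf. apply hy2. apply std_weight_kernel_op_ones; trivial.
Qed.

Lemma bounded_of_adjoint_inequality f : in_l2 Q f -> normsq Q (T f) <= 2 * normsq Q f.
Proof.
intros hf. destruct (adjoint_pair_of f hf) as [y [hy [_ h]]].
assert (0 <= normsq Q y) by (apply normsq_nonneg; trivial). lra.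
Qed.

(** For [x] dual to [s = T a + b], the squared norm of [s] is the pairing of [a] with [y] plus that
    of [T b] with [T x]. After doubling, Young's inequality with factors 2 and [1/2] leaves half of
    the adjoint inequality, that is one squared norm of [s], absorbed on the left. *)
Lemma shimorin_of_adjoint_inequality a b : in_l2 W a -> in_l2 W b ->
  normsq W (seq_add (T a) b) <= 2 * (normsq W a + normsq W (T b)).
Proof.
intros ha hb. set (s := seq_add (T a) b).
assert (hs : in_l2 W s) by (apply in_l2_seq_add; auto).
set (x := dual s). assert (hx : in_l2 Q x) by (apply dual_in_l2; trivial).
destruct (adjoint_pair_of x hx) as [y [hy [h1 h2]]].
assert (hN : pairing ones s x = normsq W s) by (unfold x; rewrite dual_pairing, normsq_pairing; trivial).
assert (hsplit : pairing ones s x = pairing ones a y + pairing ones (T b) (T x)).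
{ unfold s at 1. rewrite pairing_seq_add_l; try (apply pairing_ex with W Q; auto).
  rewrite h1 by trivial. f_equal. symmetry.
  apply blaschke_op_isometry with W Q; trivial. intros j. pose proof (WQ j) as h. unfold ones in h. lra. }
assert (hyoung : forall u v, in_l2 W u -> in_l2 Q v -> 2 * pairing ones u v <= 2 * normsq W u + normsq Q v / 2).
{ intros u v hu hv.
  replace (2 * normsq W u + normsq Q v / 2) with (normsq (fun j => 2 * W j) u + normsq (fun j => / 2 * Q j) v)
    by (rewrite !normsq_scal_weight; field).
  eapply Rle_trans; [apply Rle_abs|]. apply pairing_young.
  - intros j. specialize (W0 j). lra.
  - intros j. specialize (Q0 j). lra.
  - intros j. replace (2 * W j * (/ 2 * Q j)) with (W j * Q j) by field. apply WQ.
  - apply in_l2_scal_weight; trivial.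
  - apply in_l2_scal_weight; trivial. }
pose proof (hyoung a y ha hy). pose proof (hyoung (T b) (T x) (TW b hb) (TQ x hx)).
assert (hxn : normsq Q x = normsq W s) by apply dual_normsq.
fold s. lra.
Qed.

(** Expansivity of [T] in the adjoint inequality makes the adjoint contractive in weight [Q];
    duality gives the bound in weight [1/Q]. *)
Lemma contractive_of_adjoint_inequality a : in_l2 W a -> normsq W (T a) <= normsq W a.
Proof.
intros ha. set (x := dual (T a)).
assert (hx : in_l2 Q x) by (apply dual_in_l2, TW; trivial).
destruct (adjoint_pair_of x hx) as [y [hy [h1 h2]]].
pose proof (expansive_of_adjoint_inequality x hx) as h3.
assert (hN : pairing ones a y = normsq W (T a)).
{ rewrite <- h1 by trivial. unfold x. rewrite dual_pairing, normsq_pairing; trivial. }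
pose proof (pairing_young ones W Q a y W0 Q0 WQ ha hy) as h4.
pose proof (Rle_abs (2 * pairing ones a y)).
assert (hxn : normsq Q x = normsq W (T a)) by apply dual_normsq.
lra.
Qed.

End Duality.

(** * Taylor coefficients *)

Lemma fst_sum_n (u : nat -> C) n : fst (sum_n (G := C_AbelianMonoid) u n) = sum_n (fun k => fst (u k)) n.
Proof.
induction n; [rewrite !sum_O; trivial|]. rewrite !sum_Sn. rewrite <- IHn. reflexivity.
Qed.

Lemma snd_sum_n (u : nat -> C) n : snd (sum_n (G := C_AbelianMonoid) u n) = sum_n (fun k => snd (u k)) n.
Proof.
induction n; [rewrite !sum_O; trivial|]. rewrite !sum_Sn. rewrite <- IHn. reflexivity.
Qed.

Lemma is_series_C_components (u : nat -> C) (l : C) :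
  is_series (K := C_AbsRing) (V := C_NormedModule) u l ->
  is_series (fun k => fst (u k)) (fst l) /\ is_series (fun k => snd (u k)) (snd l).
Proof.
intros h.
assert (hb := proj1 (filterlim_locally_ball_norm (U := C_NormedModule) _ _) h).
split; apply filterlim_locally_ball_norm; intros eps; generalize (hb eps); apply filter_imp;
intros n hn; unfold ball_norm in *; change (Cmod (Cminus (sum_n (G := C_AbelianMonoid) u n) l) < eps) in hn;
(eapply Rle_lt_trans; [|exact hn]).
- eapply Rle_trans; [|apply fst_le_Cmod]. right.
  transitivity (Rabs (fst (sum_n (G := C_AbelianMonoid) u n) - fst l)); [|reflexivity].
  rewrite fst_sum_n. reflexivity.
- eapply Rle_trans; [|apply snd_le_Cmod]. right.
  transitivity (Rabs (snd (sum_n (G := C_AbelianMonoid) u n) - snd l)); [|reflexivity].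
  rewrite snd_sum_n. reflexivity.
Qed.

Lemma is_pseries_C_unique (a : nat -> C) (z l1 l2 : C) :
  is_pseries a z l1 -> is_pseries a z l2 -> l1 = l2.
Proof.
intros h1 h2. destruct (is_series_C_components _ _ h1) as [p1 q1].
destruct (is_series_C_components _ _ h2) as [p2 q2].
apply is_series_unique in p1, q1, p2, q2.
apply injective_projections; congruence.
Qed.

Lemma Cmod_pow_n (z : C) k : Cmod (pow_n (K := C_AbsRing) z k) = Cmod z ^ k.
Proof.
induction k; simpl; [apply Cmod_1|]. rewrite <- IHk. apply (Cmod_mult z).
Qed.

Lemma pow_n_RtoC (x : R) k : pow_n (K := C_AbsRing) (RtoC x) k = RtoC (x ^ k).
Proof.
induction k; simpl; [reflexivity|]. rewrite IHk, RtoC_mult. reflexivity.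
Qed.

(** Convergence at [1/2] forces a positive radius, as terms outside the disc of convergence do not
    tend to 0; the identity theorem then applies near 0. *)
Lemma real_pseries_zero (a : nat -> R) :
  (forall x, Rabs x < 1 -> is_series (fun k => x ^ k * a k) 0) -> forall n, a n = 0.
Proof.
intros h n.
assert (hps : forall x, Rabs x < 1 -> is_pseries a x 0).
{ intros x hx. apply is_pseries_R. apply is_series_ext with (fun k => x ^ k * a k); [|auto]. intros; apply Rmult_comm. }
apply (PSeries_ext_recip a (fun _ => 0)).
- apply Rbar_not_le_lt. intros hle.
  apply (CV_disk_outside a (1 / 2)).
  + eapply Rbar_le_lt_trans; [exact hle|]. simpl. rewrite Rabs_pos_eq; lra.
  + apply (ex_series_lim_0 (fun k => a k * (1 / 2) ^ k)).
    exists 0. apply is_pseries_R, hps. rewrite Rabs_pos_eq; lra.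
- rewrite CV_radius_const_0. simpl; trivial.
- exists (mkposreal 1 Rlt_0_1). intros x hx. simpl in hx.
  assert (hx' : Rabs x < 1).
  { unfold ball in hx. simpl in hx. unfold AbsRing_ball, abs, minus, plus, opp in hx. simpl in hx.
    rewrite Ropp_0, Rplus_0_r in hx. trivial. }
  rewrite (is_pseries_unique a x 0); auto.
  unfold PSeries. symmetry. transitivity (Series (fun _ => 0)); [|apply series_zero].
  apply Series_ext. intros; ring.
Qed.

Lemma taylor_fadd f g a b : taylor f a -> taylor g b -> taylor (fadd f g) (seq_add a b).
Proof. intros h1 h2 z. apply (is_pseries_plus a b); auto. Qed.

Lemma taylor_fscal c f a : taylor f a -> taylor (fscal c f) (seq_scal c a).
Proof. intros h z. apply (is_pseries_scal c a); auto. apply Cmult_comm. Qed.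

Lemma fsub_eq f g : fsub f g = fadd f (fscal (RtoC (-1)) g).
Proof. apply functional_extensionality; intros z. unfold fsub, fadd, fscal. apply injective_projections; simpl; ring. Qed.

Lemma taylor_fsub f g a b : taylor f a -> taylor g b -> taylor (fsub f g) (seq_sub a b).
Proof. intros. rewrite fsub_eq, seq_sub_eq. apply taylor_fadd; trivial. apply taylor_fscal; trivial. Qed.

(** On the real diameter, real and imaginary parts of the coefficients give two real power series
    with sum 0. *)
Lemma taylor_zero_unique a : taylor fzero a -> a = seq_zero.
Proof.
intros h.
assert (hc : forall x : R, Rabs x < 1 ->
  is_series (fun k => x ^ k * fst (a k)) 0 /\ is_series (fun k => x ^ k * snd (a k)) 0).
{ intros x hx. assert (hz : Cmod (RtoC x) < 1) by (rewrite Cmod_R; trivial).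
  specialize (h (exist _ (RtoC x) hz)). unfold is_pseries in h. simpl proj1_sig in h.
  apply is_series_C_components in h. destruct h as [h1 h2]. split.
  - eapply is_series_ext; [|exact h1]. intros k. cbn beta. rewrite pow_n_RtoC.
    unfold scal; simpl. unfold mult; simpl. ring.
  - eapply is_series_ext; [|exact h2]. intros k. cbn beta. rewrite pow_n_RtoC.
    unfold scal; simpl. unfold mult; simpl. ring. }
seq_ext n. unfold seq_zero. apply injective_projections.
- apply (real_pseries_zero (fun k => fst (a k))). intros; apply hc; trivial.
- apply (real_pseries_zero (fun k => snd (a k))). intros; apply hc; trivial.
Qed.

Lemma taylor_unique f a b : taylor f a -> taylor f b -> a = b.
Proof.
intros ha hb. assert (h : taylor fzero (seq_sub a b)).
{ replace fzero with (fsub f f); [apply taylor_fsub; trivial|].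
  apply functional_extensionality; intros z. unfold fsub, fzero. ring. }
apply taylor_zero_unique in h. seq_ext j. pose proof (equal_f h j) as hj.
unfold seq_sub, seq_zero in hj. replace (a j) with (Cplus (b j) (Cminus (a j) (b j))) by ring.
rewrite hj. ring.
Qed.

Lemma taylor_fun_unique f g a : taylor f a -> taylor g a -> f = g.
Proof.
intros hf hg. apply functional_extensionality; intros z.
apply is_pseries_C_unique with a (proj1_sig z); auto.
Qed.

Lemma taylor_coef f : analytic f -> taylor f (coef f).
Proof. intros h. exact (epsilon_spec _ (taylor f) h). Qed.

Lemma coef_eq f a : taylor f a -> coef f = a.
Proof. intros h. apply (taylor_unique f); trivial. apply taylor_coef. exists a; trivial. Qed.

(** * From coefficient sequences to functions on the disc *)

Definition disc_coefs (a : nat -> C) : Prop := forall r, 0 < r < 1 -> in_l2 (geom r) a.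

Lemma disc_coefs_blaschke_op l a : in_disc l -> disc_coefs a -> disc_coefs (blaschke_op l a).
Proof.
intros hl h r hr. apply in_l2_blaschke_op; auto. apply nonincreasing_admissible, geom_nonincreasing. lra.
Qed.

Lemma disc_coefs_kernel_op b a : Cmod b < 1 -> disc_coefs a -> disc_coefs (kernel_op b a).
Proof.
intros hl h r hr. apply in_l2_kernel_op; auto. apply nonincreasing_admissible, geom_nonincreasing. lra.
Qed.

Lemma disc_coefs_pseries a (z : C) : disc_coefs a -> Cmod z < 1 -> exists l : C, is_pseries a z l.
Proof.
intros ha hz. set (t := (1 + Cmod z) / 2). pose proof (Cmod_ge_0 z).
assert (ht : 0 < t < 1) by (unfold t; lra).
apply (ex_series_le (V := C_CompleteNormedModule) _
  (fun k => 1 / 2 * (Cmod (a k) ^ 2 * geom t k + t ^ k))).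
- intros k. change (Cmod (Cmult (pow_n (K := C_AbsRing) z k) (a k)) <= 1 / 2 * (Cmod (a k) ^ 2 * geom t k + t ^ k)).
  rewrite Cmod_mult, Cmod_pow_n.
  assert (h1 : Cmod z ^ k <= t ^ k) by (apply pow_incr; unfold t; lra).
  assert (h2 : 0 <= t ^ k) by (apply pow_le; lra).
  pose proof (Cmod_ge_0 (a k)). pose proof (pow2_ge_0 (Cmod (a k) - 1)).
  apply Rle_trans with (t ^ k * Cmod (a k)); [apply Rmult_le_compat_r; trivial|].
  unfold geom. nra.
- apply ex_series_R_scal, ex_series_R_plus; [apply ha; trivial|].
  apply ex_series_geom. rewrite Rabs_pos_eq; lra.
Qed.

Lemma disc_coefs_function a : disc_coefs a -> exists f, taylor f a.
Proof.
intros ha. exists (fun z : unit_disc => proj1_sig (constructive_indefinite_description _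
   (disc_coefs_pseries a (proj1_sig z) ha (proj2_sig z)))).
intros z. exact (proj2_sig (constructive_indefinite_description _
   (disc_coefs_pseries a (proj1_sig z) ha (proj2_sig z)))).
Qed.

Lemma taylor_fzero : taylor fzero seq_zero.
Proof.
destruct (disc_coefs_function seq_zero) as [f hf]; [intros r hr; apply in_l2_seq_zero|].
replace fzero with (fscal (RtoC 0) f).
- replace seq_zero with (seq_scal (RtoC 0) seq_zero); [apply taylor_fscal; trivial|].
  seq_ext j. unfold seq_scal, seq_zero. ring.
- apply functional_extensionality; intros z. unfold fscal, fzero. ring.
Qed.

Lemma taylor_shift g a : taylor g a -> taylor (fun z => Cmult (proj1_sig z) (g z)) (fshift a).
Proof. intros h z. apply (is_pseries_incr_1 a). apply h. Qed.

Lemma one_sub_mul_neq0 (b z : C) : Cmod b < 1 -> Cmod z < 1 -> Cminus (RtoC 1) (Cmult b z) <> RtoC 0.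
Proof.
intros hb hz h.
assert (h1 : Cmult b z = RtoC 1).
{ replace (Cmult b z) with (Cminus (RtoC 1) (Cminus (RtoC 1) (Cmult b z))) by ring. rewrite h. ring. }
assert (h2 : Cmod b * Cmod z = 1) by (rewrite <- Cmod_mult, h1; apply Cmod_1).
pose proof (Cmod_ge_0 b). pose proof (Cmod_ge_0 z). nra.
Qed.

(** The quotient [g = f / (1 - conj a z)] is built from its coefficients; uniqueness of sums gives
    [f = (1 - conj a z) g], and the product is then [z g - a g]. *)
Lemma taylor_blaschke_factor a f c : Cmod a < 1 -> disc_coefs c -> taylor f c ->
  taylor (fun z => Cmult (blaschke_factor a (proj1_sig z)) (f z)) (factor_op a c).
Proof.
intros ha hc hf. assert (ha' := Cmod_conj_lt a ha).
destruct (disc_coefs_function (kernel_op (Cconj a) c)) as [g hg]; [apply disc_coefs_kernel_op; trivial|].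
pose proof (taylor_shift g _ hg) as hzg.
pose proof (taylor_fsub _ _ _ _ hg (taylor_fscal (Cconj a) _ _ hzg)) as h1.
rewrite kernel_op_spec in h1.
pose proof (taylor_fun_unique _ _ _ hf h1) as hfg.
replace (fun z : unit_disc => Cmult (blaschke_factor a (proj1_sig z)) (f z))
  with (fsub (fun z => Cmult (proj1_sig z) (g z)) (fscal a g)).
{ apply taylor_fsub; trivial. apply taylor_fscal; trivial. }
apply functional_extensionality; intros z. rewrite hfg. unfold fsub, fscal, blaschke_factor.
pose proof (one_sub_mul_neq0 (Cconj a) (proj1_sig z) ha' (proj2_sig z)) as hne.
field. exact hne.
Qed.

Lemma taylor_blaschke l f c : in_disc l -> disc_coefs c -> taylor f c ->
  taylor (fun z => Cmult (fold_right Cmult (RtoC 1)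
     (map (fun a => blaschke_factor a (proj1_sig z)) l)) (f z)) (blaschke_op l c).
Proof.
intros hl hc hf. induction hl as [|a l ha hl IH].
- simpl. replace (fun z : unit_disc => Cmult (RtoC 1) (f z)) with f; trivial.
  apply functional_extensionality; intros z. ring.
- pose proof (taylor_blaschke_factor a _ _ ha (disc_coefs_blaschke_op l c hl hc) IH) as h. simpl.
  match goal with h : taylor ?u _ |- taylor ?v _ => replace v with u; trivial end.
  apply functional_extensionality; intros z. ring.
Qed.

(** * The weighted spaces [D_alpha] *)

(** The weight is at least of order [1 / (j+1)], and [(j+1) r^j] is bounded. *)
Lemma geom_le_weight W alpha r : -1 <= alpha -> comparable W alpha -> 0 < r < 1 ->
  exists c, 0 <= c /\ forall j, geom r j <= c * W j.
Proof.
intros hal [c1 [c2 [h1 [h2 hW]]]] hr.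
destruct (square_le_geometric (/ r)) as [c [hc hcj]].
{ rewrite <- Rinv_1. apply Rinv_lt_contravar; lra. }
assert (hk : 0 < (c + 1) / c1) by (apply Rdiv_lt_0_compat; lra).
exists ((c + 1) / c1). split; [lra|]. intros j.
destruct (hW j) as [hlow _].
assert (hj : 1 <= INR (j + 1)) by (rewrite plus_INR; pose proof (pos_INR j); simpl; lra).
assert (hR : / INR (j + 1) <= Rpower (INR (j + 1)) alpha).
{ rewrite <- (Rpower_1 (INR (j + 1))) at 1 by lra. rewrite <- Rpower_Ropp.
  apply Rle_Rpower; lra. }
apply Rle_trans with ((c + 1) * / INR (j + 1)).
- apply Rmult_le_reg_r with (INR (j + 1)); [lra|].
  rewrite Rmult_assoc, Rinv_l by lra. rewrite Rmult_1_r. unfold geom.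
  assert (hrj : 0 <= r ^ j <= 1) by (apply pow_unit_interval; lra).
  assert (hsq : INR j ^ 2 * r ^ j <= c).
  { apply Rle_trans with (c * (/ r) ^ j * r ^ j); [apply Rmult_le_compat_r; [lra|apply hcj]|].
    rewrite Rmult_assoc, <- Rpow_mult_distr, Rinv_l, pow1 by lra. lra. }
  assert (INR j * r ^ j <= INR j ^ 2 * r ^ j).
  { apply Rmult_le_compat_r; [lra|]. destruct j; [simpl; lra|]. rewrite S_INR.
    pose proof (pos_INR j). nra. }
  rewrite plus_INR. simpl INR. lra.
- apply Rle_trans with ((c + 1) / c1 * (c1 * Rpower (INR (j + 1)) alpha)).
  + replace ((c + 1) / c1 * (c1 * Rpower (INR (j + 1)) alpha))
      with ((c + 1) * Rpower (INR (j + 1)) alpha) by (field; lra).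
    apply Rmult_le_compat_l; lra.
  + apply Rmult_le_compat_l; lra.
Qed.

(** [x] is split into finitely many coefficients and a tail of small norm. The head is paired with
    [u] by Cauchy-Schwarz between the weights [W^2 / r^j] and [r^j], the tail in weight [W]. *)
Lemma pairing_weakly_small W r x : (forall j, 0 < W j) -> 0 < r < 1 -> in_l2 W x ->
  forall e, 0 < e -> exists K, 0 <= K /\ forall u, in_l2 W u -> in_l2 (geom r) u ->
    pairing W x u ^ 2 <= e * normsq W u + K * normsq (geom r) u.
Proof.
intros hW hr hx e he.
assert (hW0 : forall j, 0 <= W j) by (intros; left; auto).
assert (hg : forall j, 0 < geom r j) by (intros; apply pow_lt; lra).
set (v := fun j => Cmod (x j) ^ 2 * W j).
assert (hv : is_lim_seq (sum_n v) (Series v)) by exact (Series_correct v hx).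
apply is_lim_seq_spec in hv.
destruct (hv (mkposreal (e / 2) ltac:(lra))) as [J hJ]. specialize (hJ J (le_n _)). simpl in hJ.
apply Rabs_lt_between in hJ.
set (hd := fun j => if le_dec j J then x j else RtoC 0).
set (tl := fun j => if le_dec j J then RtoC 0 else x j).
assert (hxs : x = seq_add hd tl).
{ seq_ext j. unfold seq_add, hd, tl. destruct (le_dec j J); ring. }
assert (hlev : forall y : nat -> C, (forall j, y j = x j \/ y j = RtoC 0) -> forall j,
   Rabs (Cmod (y j) ^ 2 * W j) <= v j).
{ intros y hy j. rewrite Rabs_pos_eq by (apply Cmod2_pos; auto). unfold v.
  destruct (hy j) as [-> | ->]; [lra|]. rewrite Cmod_0.
  pose proof (Cmod2_pos (x j) (W j) (hW0 j)). lra. }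
assert (hvhd := hlev hd ltac:(intros j; unfold hd; destruct (le_dec j J); auto)).
assert (hvtl := hlev tl ltac:(intros j; unfold tl; destruct (le_dec j J); auto)).
assert (hhd : in_l2 W hd) by exact (ex_series_R_le _ _ hvhd hx).
assert (htl : in_l2 W tl) by exact (ex_series_R_le _ _ hvtl hx).
assert (htl2 : normsq W tl <= e / 2).
{ pose proof (series_tail_bound _ _ J hvtl hx) as h. fold (normsq W tl) in h.
  assert (hz : sum_n (fun j => Cmod (tl j) ^ 2 * W j) J = 0).
  { assert (hle : forall i, (i <= J)%nat -> sum_n (fun j => Cmod (tl j) ^ 2 * W j) i = 0).
    { intros i hi. assert (h0 : forall k, (k <= J)%nat -> Cmod (tl k) ^ 2 * W k = 0).
      { intros k hk. unfold tl. destruct (le_dec k J); [|lia]. rewrite Cmod_0. ring. }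
      induction i; [rewrite sum_n_0; auto|]. rewrite sum_n_S, h0, IHi by lia. apply Rplus_0_l. }
    apply hle; trivial. }
  rewrite hz, Rminus_0_r in h. apply Rabs_le_between in h. lra. }
set (V := fun j => W j * W j * / geom r j).
set (cst := sum_n (fun i => W i * / geom r i) J).
assert (hpos : forall i, 0 <= W i * / geom r i).
{ intros i. apply Rmult_le_pos; trivial. left. apply Rinv_0_lt_compat; trivial. }
assert (hVhd : in_l2 V hd).
{ apply ex_series_R_le with (fun j => cst * (Cmod (x j) ^ 2 * W j)); [|apply ex_series_R_scal; trivial].
  intros j. unfold V. rewrite Rabs_pos_eq.
  - unfold hd. destruct (le_dec j J) as [hj|hj].
    + assert (hjc : W j * / geom r j <= cst).
      { unfold cst. clear - hj hpos. induction J as [|J IH].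
        - replace j with O by lia. rewrite sum_n_0. lra.
        - rewrite sum_n_S. destruct (Nat.eq_dec j (S J)) as [->|hne].
          + assert (0 <= sum_n (fun i => W i * / geom r i) J); [|lra].
            clear - hpos. induction J; [rewrite sum_n_0; auto|]. rewrite sum_n_S.
            specialize (hpos (S J)). lra.
          + specialize (IH ltac:(lia)). specialize (hpos (S J)). lra. }
      replace (Cmod (x j) ^ 2 * (W j * W j * / geom r j)) with (W j * / geom r j * (Cmod (x j) ^ 2 * W j)) by ring.
      apply Rmult_le_compat_r; trivial. apply Cmod2_pos; trivial.
    + rewrite Cmod_0. assert (0 <= cst).
      { unfold cst. clear - hpos. induction J; [rewrite sum_n_0; auto|]. rewrite sum_n_S.
        specialize (hpos (S J)). lra. }
      assert (0 <= cst * (Cmod (x j) ^ 2 * W j)) by (apply Rmult_le_pos; trivial; apply Cmod2_pos; trivial).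
      lra.
  - apply Cmod2_pos. rewrite Rmult_assoc. apply Rmult_le_pos; trivial. }
assert (hV0 : forall j, 0 <= V j).
{ intros j. unfold V. rewrite Rmult_assoc. apply Rmult_le_pos; trivial. }
exists (2 * normsq V hd). split.
{ apply Rmult_le_pos; [lra|]. apply normsq_nonneg; trivial. }
intros u hu hu'.
assert (h1 : pairing W hd u ^ 2 <= normsq V hd * normsq (geom r) u).
{ apply pairing_cauchy_schwarz; trivial; [intros; left; auto|]. intros j. right. unfold V.
  specialize (hg j). field. lra. }
assert (h2 : pairing W tl u ^ 2 <= normsq W tl * normsq W u).
{ apply pairing_cauchy_schwarz; trivial. intros; right; ring. }
rewrite hxs, pairing_seq_add_l by (apply pairing_self_ex; trivial).
assert (hnu : 0 <= normsq W u) by (apply normsq_nonneg; trivial).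
pose proof (pow2_ge_0 (pairing W hd u - pairing W tl u)).
assert (normsq W tl * normsq W u <= e / 2 * normsq W u) by (apply Rmult_le_compat_r; trivial).
lra.
Qed.

Definition wnorm (W : nat -> R) (f : dfun) : R := sqrt (normsq W (coef f)).
Definition wpairing (W : nat -> R) (f g : dfun) : R := pairing W (coef f) (coef g).
Definition wip (W : nat -> R) (f g : dfun) : C :=
  (pairing W (coef f) (coef g), pairing W (coef f) (seq_scal Ci (coef g))).

Definition usual_weight (alpha : R) : nat -> R := fun j => Rpower (INR (j + 1)) alpha.

Lemma usual_weight_pos alpha j : 0 < usual_weight alpha j.
Proof. apply exp_pos. Qed.

Section WeightedSpace.

Variables (alpha : R) (W : nat -> R).
Hypothesis halpha : -1 <= alpha.
Hypothesis hW : comparable W alpha.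

Lemma comparable_pos j : 0 < W j.
Proof.
destruct hW as [c1 [c2 [h1 [h2 h]]]]. pose proof (usual_weight_pos alpha j). unfold usual_weight in *.
specialize (h j). assert (0 < c1 * Rpower (INR (j + 1)) alpha) by (apply Rmult_lt_0_compat; trivial). lra.
Qed.

Let W0 j : 0 <= W j.
Proof. left; apply comparable_pos. Qed.

Lemma comparable_le : exists c, 0 < c /\ forall j, usual_weight alpha j <= c * W j.
Proof.
destruct hW as [c1 [c2 [h1 [h2 h]]]]. exists (/ c1). split; [apply Rinv_0_lt_compat; trivial|].
intros j. destruct (h j) as [h3 _]. fold (usual_weight alpha j) in h3.
apply Rmult_le_reg_l with c1; trivial. rewrite <- Rmult_assoc, Rinv_r by lra. lra.
Qed.

Lemma comparable_ge : exists c, 0 < c /\ forall j, W j <= c * usual_weight alpha j.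
Proof. destruct hW as [c1 [c2 [h1 [h2 h]]]]. exists c2. split; trivial. apply h. Qed.

Lemma in_l2_usual_weight_iff a : in_l2 (usual_weight alpha) a <-> in_l2 W a.
Proof.
destruct comparable_le as [c [_ hc]]. destruct comparable_ge as [c' [_ hc']].
split; [apply in_l2_le with (c := c')|apply in_l2_le with (c := c)]; trivial.
intros j; left; apply usual_weight_pos.
Qed.

Lemma in_l2_disc_coefs a : in_l2 W a -> disc_coefs a.
Proof.
intros ha r hr. destruct (geom_le_weight W alpha r halpha hW hr) as [c [_ hc]].
apply in_l2_le with W c; trivial. intros j. apply pow_le; lra.
Qed.

Lemma Dspace_iff f : Dspace alpha f <-> exists a, taylor f a /\ in_l2 W a.
Proof.
split.
- intros [h1 h2]. exists (coef f). split; [apply taylor_coef; trivial|].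
  apply in_l2_usual_weight_iff. exact h2.
- intros [a [h1 h2]]. split; [exists a; trivial|].
  apply in_l2_usual_weight_iff in h2. rewrite <- (coef_eq f a h1) in h2. exact h2.
Qed.

Lemma Dspace_coef f : Dspace alpha f -> taylor f (coef f) /\ in_l2 W (coef f).
Proof.
intros hf. apply Dspace_iff in hf. destruct hf as [a [h1 h2]]. rewrite (coef_eq f a); auto.
Qed.

Lemma coef_fadd f g : Dspace alpha f -> Dspace alpha g -> coef (fadd f g) = seq_add (coef f) (coef g).
Proof. intros hf hg. apply coef_eq, taylor_fadd; apply Dspace_coef; trivial. Qed.

Lemma coef_fscal c f : Dspace alpha f -> coef (fscal c f) = seq_scal c (coef f).
Proof. intros hf. apply coef_eq, taylor_fscal; apply Dspace_coef; trivial. Qed.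

Lemma Dspace_fadd f g : Dspace alpha f -> Dspace alpha g -> Dspace alpha (fadd f g).
Proof.
intros hf hg. destruct (Dspace_coef f hf), (Dspace_coef g hg). apply Dspace_iff.
exists (seq_add (coef f) (coef g)). split; [apply taylor_fadd|apply in_l2_seq_add]; trivial.
Qed.

Lemma Dspace_fscal c f : Dspace alpha f -> Dspace alpha (fscal c f).
Proof.
intros hf. destruct (Dspace_coef f hf). apply Dspace_iff.
exists (seq_scal c (coef f)). split; [apply taylor_fscal|apply in_l2_seq_scal]; trivial.
Qed.

Lemma eq_of_coef_eq f g : Dspace alpha f -> Dspace alpha g -> coef f = coef g -> f = g.
Proof.
intros hf hg h. apply taylor_fun_unique with (coef f); [|rewrite h]; apply Dspace_coef; trivial.
Qed.

Lemma coef_sub f g : Dspace alpha f -> Dspace alpha g ->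
  coef (fadd f (fscal (RtoC (-1)) g)) = seq_sub (coef f) (coef g).
Proof.
intros. rewrite seq_sub_eq, coef_fadd, coef_fscal; trivial. apply Dspace_fscal; trivial.
Qed.

Lemma Dspace_real_hilbert :
  real_hilbert dfun (Dspace alpha) fadd (fun t => fscal (RtoC t)) (wpairing W).
Proof.
pose proof (seq_real_hilbert W comparable_pos) as H.
assert (hc : forall f, Dspace alpha f -> in_l2 W (coef f)) by (intros; apply Dspace_coef; trivial).
split.
- apply Dspace_fadd.
- intros c f; apply Dspace_fscal.
- intros f g _ _. apply pairing_sym.
- intros f g h hf hg hh. unfold wpairing. rewrite coef_fadd; trivial. apply (rh_addl _ _ _ _ _ H); auto.
- intros c f g hf hg. unfold wpairing. rewrite coef_fscal; trivial. apply pairing_seq_scal_real.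
- intros f hf. apply (rh_pos _ _ _ _ _ H); auto.
- intros f g hf hg h. unfold wpairing in h. rewrite coef_sub, seq_sub_eq in h; trivial.
  apply eq_of_coef_eq; trivial. apply (rh_def _ _ _ _ _ H); auto.
- intros u hu hcau. destruct (rh_complete _ _ _ _ _ H (fun n => coef (u n))) as [v [hv1 hv2]]; auto.
  + intros e he. destruct (hcau e he) as [N hN]. exists N. intros n m hn hm.
    specialize (hN n m hn hm). unfold wpairing in hN. rewrite coef_sub, seq_sub_eq in hN; trivial.
  + destruct (disc_coefs_function v (in_l2_disc_coefs v hv1)) as [F hF].
    assert (hFD : Dspace alpha F) by (apply Dspace_iff; exists v; auto).
    exists F. split; trivial. intros e he. destruct (hv2 e he) as [N hN]. exists N.
    intros n hn. specialize (hN n hn). unfold wpairing. rewrite coef_sub, seq_sub_eq, (coef_eq F v); trivial.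
Qed.

Lemma usual_norm_normsq f : usual_norm alpha f = sqrt (normsq (usual_weight alpha) (coef f)).
Proof. reflexivity. Qed.

Lemma closed_subspace_rh M : closed_subspace alpha M ->
  rh_closed_subspace dfun (Dspace alpha) fadd (fun t => fscal (RtoC t)) (wpairing W) M.
Proof.
intros [[h1 [h2 [h3 h4]]] h5]. split; auto.
- exists fzero; trivial.
- intros f hf hcl. apply h5; trivial. intros eps heps.
  destruct comparable_le as [c [hc0 hc]].
  destruct (hcl (eps ^ 2 / c)) as [g [hg hlt]].
  { apply Rdiv_lt_0_compat; trivial. apply pow_lt; trivial. }
  exists g. split; trivial.
  assert (hgD : Dspace alpha g) by (apply h1; trivial).
  unfold wpairing in hlt. rewrite <- normsq_pairing, coef_sub in hlt; trivial.
  rewrite usual_norm_normsq, fsub_eq, coef_sub; trivial.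
  assert (hin : in_l2 W (seq_sub (coef f) (coef g))) by (apply in_l2_seq_sub; auto; apply Dspace_coef; trivial).
  assert (hle : normsq (usual_weight alpha) (seq_sub (coef f) (coef g)) <= c * normsq W (seq_sub (coef f) (coef g))).
  { apply normsq_le; trivial. apply in_l2_usual_weight_iff; trivial. }
  rewrite <- (sqrt_pow2 eps) by lra. apply sqrt_lt_1_alt. split.
  + apply normsq_nonneg; [intros; left; apply usual_weight_pos|apply in_l2_usual_weight_iff; trivial].
  + apply Rle_lt_trans with (c * normsq W (seq_sub (coef f) (coef g))); trivial.
    apply Rmult_lt_reg_l with (/ c); [apply Rinv_0_lt_compat; trivial|].
    rewrite <- Rmult_assoc, Rinv_l, Rmult_1_l by lra. unfold Rdiv in hlt. lra.
Qed.

Lemma wnorm_equivalent : equivalent_norms alpha (wnorm W) (usual_norm alpha).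
Proof.
destruct comparable_le as [c [hc0 hc]]. destruct comparable_ge as [c' [hc0' hc']].
exists (/ sqrt c), (sqrt c').
assert (hsc : 0 < sqrt c) by (apply sqrt_lt_R0; trivial).
split; [apply Rinv_0_lt_compat; trivial|]. split; [apply sqrt_lt_R0; trivial|].
intros f hf. destruct (Dspace_coef f hf) as [_ h1]. assert (h2 := proj2 (in_l2_usual_weight_iff _) h1).
rewrite usual_norm_normsq. unfold wnorm. split.
- apply Rmult_le_reg_l with (sqrt c); trivial. rewrite <- Rmult_assoc, Rinv_r, Rmult_1_l by lra.
  rewrite <- sqrt_mult_alt by lra. apply sqrt_le_1_alt. apply normsq_le; trivial.
- rewrite <- sqrt_mult_alt by lra. apply sqrt_le_1_alt. apply normsq_le; trivial.
Qed.

Lemma wip_inner_product : inner_product alpha (wip W).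
Proof.
assert (hc : forall f, Dspace alpha f -> in_l2 W (coef f)) by (intros; apply Dspace_coef; trivial).
assert (hex : forall a b, in_l2 W a -> in_l2 W b -> ex_series (fun j => dot (a j) (b j) * W j)).
{ intros; apply pairing_self_ex; trivial. }
split; [|split; [|split; [|split]]].
- intros f g h hf hg hh. unfold wip. rewrite coef_fadd; trivial.
  apply injective_projections; simpl; apply pairing_seq_add_l; apply hex; auto; apply in_l2_seq_scal; auto.
- intros c f g hf hg. unfold wip. rewrite coef_fscal; trivial.
  apply hc in hf. apply hc in hg. pose proof (in_l2_seq_scal W Ci _ hg) as hig.
  apply injective_projections; simpl; unfold pairing.
  + rewrite <- !Series_scal_l, <- Series_minus by (apply ex_series_R_scal, hex; trivial).
    apply Series_ext. intros j. unfold seq_scal, dot. simpl. ring.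
  + rewrite <- !Series_scal_l, <- Series_plus by (apply ex_series_R_scal, hex; trivial).
    apply Series_ext. intros j. unfold seq_scal, dot. simpl. ring.
- intros f g hf hg. unfold wip. apply injective_projections; simpl.
  + apply pairing_sym.
  + unfold pairing. rewrite <- Series_opp. apply Series_ext. intros j. unfold seq_scal, dot. simpl. ring.
- intros f hf. simpl. rewrite <- normsq_pairing. apply normsq_nonneg; auto.
- intros f hf h. apply (f_equal fst) in h. simpl in h. rewrite <- normsq_pairing in h.
  apply normsq_eq0 in h; auto; [|apply comparable_pos].
  apply taylor_fun_unique with seq_zero.
  + rewrite <- h. apply Dspace_coef; trivial.
  + apply taylor_fzero.
Qed.

Lemma wip_induces : induces alpha (wip W) (wnorm W).
Proof. intros f hf. unfold wnorm, wip. simpl. rewrite normsq_pairing. trivial. Qed.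

End WeightedSpace.

(** * The wandering subspace property for the weights [Q] and [1/Q] *)

Section WanderingForWeight.

Variables (alpha : R) (W Q : nat -> R) (a : C) (l' : list C) (c : C) (B : dfun).
Let l : list C := a :: l'.
Hypothesis halpha : -1 <= alpha.
Hypothesis hW : comparable W alpha.
Hypothesis ha : Cmod a < 1.
Hypothesis hl' : in_disc l'.
Hypothesis hc : Cmod c = 1.
Hypothesis hB : forall z, B z = Cmult c
  (fold_right Cmult (RtoC 1) (map (fun a => blaschke_factor a (proj1_sig z)) l)).
Hypothesis hQ : std_weight Q.
Hypothesis hI : adjoint_inequality l Q.
Hypothesis hWQ : W = Q \/ W = (fun j => / Q j).

Let hl : in_disc l.
Proof. constructor; trivial. Qed.

Let W0 j : 0 <= W j.
Proof. left; apply (comparable_pos alpha); trivial. Qed.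

Let admW : admissible W.
Proof.
destruct hWQ as [-> | ->]; [apply std_weight_admissible; trivial|].
apply nonincreasing_admissible, std_weight_kernel_op; trivial.
Qed.

Let n2c f : normsq W (seq_scal c f) = normsq W f.
Proof. rewrite normsq_seq_scal, hc. ring. Qed.

Let Bcoef f : Dspace alpha f ->
  coef (fmul B f) = seq_scal c (blaschke_op l (coef f)) /\ Dspace alpha (fmul B f).
Proof.
intros hf. destruct (Dspace_coef alpha W hW f hf) as [h1 h2].
assert (ht : taylor (fmul B f) (seq_scal c (blaschke_op l (coef f)))).
{ pose proof (taylor_fscal c _ _ (taylor_blaschke l f (coef f) hl (in_l2_disc_coefs alpha W halpha hW _ h2) h1)) as h.
  match type of h with taylor ?u _ => replace (fmul B f) with u; trivial end.
  apply functional_extensionality; intros z. unfold fscal, fmul. rewrite hB. ring. }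
split; [apply coef_eq; trivial|].
apply (Dspace_iff alpha W hW). exists (seq_scal c (blaschke_op l (coef f))). split; trivial.
apply in_l2_seq_scal, in_l2_blaschke_op; trivial.
Qed.

Lemma weight_wandering : wandering_subspace_property alpha (wip W) B.
Proof.
intros M hM hinv f. split.
{ intros h. apply h; trivial. intros g [hg _]; trivial. }
intros hf M0 hM0 hinv0 hsub.
assert (HC : forall g, Dspace alpha g -> in_l2 W (coef g)) by (intros; apply (Dspace_coef alpha W); trivial).
pose proof (Dspace_real_hilbert alpha W halpha hW) as HH.
pose proof (closed_subspace_rh alpha W hW M hM) as hM'.
pose proof (closed_subspace_rh alpha W hW M0 hM0) as hM0'.
set (T := fmul B).
assert (TD : forall g, Dspace alpha g -> Dspace alpha (T g)) by (intros g hg; apply Bcoef; trivial).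
assert (Tadd : forall g h, Dspace alpha g -> Dspace alpha h -> T (fadd g h) = fadd (T g) (T h)).
{ intros. apply functional_extensionality; intros z. unfold T, fmul, fadd. ring. }
assert (Tsc : forall t g, Dspace alpha g -> T (fscal t g) = fscal t (T g)).
{ intros. apply functional_extensionality; intros z. unfold T, fmul, fscal. ring. }
assert (MT : forall g, M g -> M (T g)) by (intros g hg; apply hinv; exists g; auto).
assert (M0T : forall g, M0 g -> M0 (T g)) by (intros g hg; apply hinv0; exists g; auto).
assert (MD : forall g, M g -> Dspace alpha g) by (intros; apply hM; trivial).
assert (M0W : forall g, M g -> (forall h, M h -> wpairing W g (T h) = 0) -> M0 g).
(* The real pairing with [B h] and with [B (i h)] gives both components of [wip]. *)
{ intros g hg horth. apply hsub. split; trivial. intros h0 [h [hh ->]].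
  unfold wip. pose proof (horth h hh) as h1. unfold wpairing in h1. fold T. rewrite h1.
  assert (hih : M (fscal Ci h)) by (destruct hM as [[_ [_ [_ hMs]]] _]; auto).
  pose proof (horth _ hih) as h2. unfold wpairing in h2.
  rewrite Tsc, (coef_fscal alpha W hW) in h2; auto. rewrite h2. reflexivity. }
(* Any circle inside the disc would serve for [pp]. *)
set (r := 1 / 2). assert (hr : 0 < r < 1) by (unfold r; lra).
assert (hr1 : 0 < r <= 1) by lra.
set (pp := fun g : dfun => normsq (geom r) (coef g)).
assert (Hhol : forall g, Dspace alpha g -> in_l2 (geom r) (coef g)).
{ intros g hg. apply (in_l2_disc_coefs alpha W); auto. }
assert (hgp : forall j, 0 <= geom r j) by (intros; apply pow_le; lra).
set (rho := 1 - (1 - Cmod a ^ 2) * (1 - r) / 4).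
assert (hrho : 0 <= rho < 1).
{ unfold rho, r. pose proof (Cmod_ge_0 a). assert (0 <= Cmod a ^ 2 < 1) by (split; nra). lra. }
destruct (geom_le_weight W alpha r halpha hW hr) as [Cp [hCp hCpj]].
assert (pp_pos : forall g, Dspace alpha g -> 0 <= pp g) by (intros; apply normsq_nonneg; auto).
assert (pp_T : forall g, Dspace alpha g -> pp (T g) <= rho * pp g).
{ intros g hg. unfold pp, T. rewrite (proj1 (Bcoef g hg)), normsq_seq_scal, hc.
  pose proof (blaschke_op_strictly_contractive r hr1 a l' (coef g) ha hl' (Hhol g hg)) as h.
  fold rho l in h. lra. }
assert (pp_nn : forall g, Dspace alpha g -> pp g <= Cp * wpairing W g g).
{ intros g hg. unfold wpairing. rewrite <- normsq_pairing. apply normsq_le; auto. }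
assert (pp_weak : forall x, Dspace alpha x -> forall e, 0 < e -> exists K, 0 <= K /\
   forall u, Dspace alpha u -> wpairing W x u ^ 2 <= e * wpairing W u u + K * pp u).
{ intros x hx e he. destruct (pairing_weakly_small W r (coef x) (comparable_pos alpha W hW) hr (HC x hx) e he) as [K [hK h]].
  exists K. split; trivial. intros u hu. unfold wpairing at 2. rewrite <- normsq_pairing. apply h; auto. }
assert (hTn : forall g, Dspace alpha g -> wpairing W (T g) (T g) = normsq W (blaschke_op l (coef g))).
{ intros g hg. unfold wpairing, T. rewrite <- normsq_pairing, (proj1 (Bcoef g hg)). apply n2c. }
assert (hnn : forall g, wpairing W g g = normsq W (coef g)) by (intros; symmetry; apply normsq_pairing).
destruct hWQ as [hWeq | hWeq].
- apply (wandering_of_concave dfun (Dspace alpha) fadd (fun t => fscal (RtoC t)) (wpairing W) HH T 2 1)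
    with (M := M) (pp := pp) (rho := rho) (Cp := Cp); auto.
  + intros g hg. rewrite hTn, hnn, hWeq by trivial.
    apply (bounded_of_adjoint_inequality l Q); trivial. rewrite <- hWeq; auto.
  + intros g hg. rewrite hTn, hnn, hWeq, Rmult_1_l by trivial.
    apply (expansive_of_adjoint_inequality l Q); trivial. rewrite <- hWeq; auto.
  + intros g hg. rewrite !hTn, hnn by auto. unfold T. rewrite (proj1 (Bcoef g hg)).
    rewrite (sl_scz _ (blaschke_op_shift_linear l)), n2c, hWeq.
    apply (concave_of_adjoint_inequality l Q); trivial. rewrite <- hWeq; auto.
- assert (hz : blaschke_op l seq_zero = seq_zero).
  { replace seq_zero with (seq_scal (RtoC 0) seq_zero); [rewrite (sl_scz _ (blaschke_op_shift_linear l))|];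
    seq_ext j; unfold seq_scal, seq_zero; ring. }
  apply (wandering_of_shimorin dfun (Dspace alpha) fadd (fun t => fscal (RtoC t)) (wpairing W) HH T 1 2)
    with (M := M) (pp := pp) (rho := rho) (Cp := Cp); auto.
  + intros g hg. rewrite hTn, hnn, hWeq, Rmult_1_l by trivial.
    apply (contractive_of_adjoint_inequality l Q); trivial. rewrite <- hWeq; auto.
  + intros g hg. rewrite hTn, hnn, hWeq by trivial.
    (* Shimorin's inequality with [f = 0] bounds [T] from below, with constant 2. *)
    pose proof (shimorin_of_adjoint_inequality l Q hl hQ hI seq_zero (coef g)) as h.
    rewrite hz in h. replace (seq_add seq_zero (coef g)) with (coef g) in h
      by (seq_ext j; unfold seq_add, seq_zero; ring).
    replace (normsq (fun j => / Q j) seq_zero) with 0 in h.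
    * rewrite Rplus_0_l in h. apply h; [apply in_l2_seq_zero|]. rewrite <- hWeq; auto.
    * transitivity (Series (fun _ => 0)); [symmetry; apply series_zero|].
      apply Series_ext. intros j. unfold seq_zero. rewrite Cmod_0. ring.
  + intros g h hg hh. rewrite !hTn, !hnn by auto.
    rewrite (coef_fadd alpha W hW) by auto. unfold T. rewrite (proj1 (Bcoef g hg)).
    rewrite <- (sl_scz _ (blaschke_op_shift_linear l)), <- (n2c (coef g)), hWeq.
    apply (shimorin_of_adjoint_inequality l Q); trivial.
    * apply in_l2_seq_scal. rewrite <- hWeq; auto.
    * rewrite <- hWeq; auto.
  + intros g hg. rewrite hTn, hnn, hWeq by trivial.
    apply (contractive_of_adjoint_inequality l Q); trivial. rewrite <- hWeq; auto.
Qed.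

Lemma weight_wandering_for_norm : wandering_for_norm alpha (wnorm W) B.
Proof.
exists (wip W). split; [apply wip_inner_product; trivial|].
split; [apply wip_induces|apply weight_wandering].
Qed.

End WanderingForWeight.

Lemma comparable_kernel_op Q al : comparable Q al -> comparable (fun j => / Q j) (- al).
Proof.
intros [c1 [c2 [h1 [h2 h]]]]. exists (/ c2), (/ c1).
split; [apply Rinv_0_lt_compat; trivial|]. split; [apply Rinv_0_lt_compat; trivial|].
intros j. destruct (h j) as [h3 h4]. rewrite Rpower_Ropp.
assert (hp : 0 < Rpower (INR (j + 1)) al) by apply exp_pos.
assert (0 < c1 * Rpower (INR (j + 1)) al) by (apply Rmult_lt_0_compat; trivial).
rewrite <- !Rinv_mult. split; apply Rinv_le_contravar; lra.
Qed.

(** * Powers of [z] in the usual norm *)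

(** With [s = b t + (1 - b)], the bound [ln u <= u - 1] at [t / s] and [1 / s], weighted by [b] and
    [1 - b], gives [b ln t <= ln s], as the right sides cancel. *)
Lemma bernoulli_Rpower t b : 0 < t -> 0 <= b <= 1 -> Rpower t b <= 1 + b * (t - 1).
Proof.
intros ht hb. set (s := 1 + b * (t - 1)).
assert (hs : 0 < s).
{ unfold s. destruct (Req_dec b 1) as [->|]; [lra|]. nra. }
assert (hln : forall u, 0 < u -> ln u <= u - 1).
{ intros u hu. pose proof (exp_ineq1_le (ln u)) as h. rewrite exp_ln in h by trivial. lra. }
unfold Rpower. rewrite <- (exp_ln s) by trivial.
assert (h1 : ln (t / s) <= t / s - 1) by (apply hln, Rdiv_lt_0_compat; trivial).
assert (h2 : ln (/ s) <= / s - 1) by (apply hln, Rinv_0_lt_compat; trivial).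
unfold Rdiv in h1. rewrite ln_mult in h1 by (trivial; apply Rinv_0_lt_compat; trivial).
rewrite ln_Rinv in h1, h2 by trivial.
assert (h3 : b * (t * / s - 1) + (1 - b) * (/ s - 1) = 0).
{ replace (b * (t * / s - 1) + (1 - b) * (/ s - 1)) with (s * / s - 1) by (unfold s; ring).
  rewrite Rinv_r; lra. }
assert (hle : b * ln t <= ln s).
{ assert (b * (ln t + - ln s) <= b * (t * / s - 1)) by (apply Rmult_le_compat_l; lra).
  assert ((1 - b) * - ln s <= (1 - b) * (/ s - 1)) by (apply Rmult_le_compat_l; lra). lra. }
destruct hle as [hlt|heq]; [left; apply exp_increasing; trivial|right; rewrite heq; trivial].
Qed.

Lemma Rpower_second_difference m k b : 0 < m - k -> 0 <= k -> 0 <= b <= 1 ->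
  Rpower (m - k) b + Rpower (m + k) b <= 2 * Rpower m b.
Proof.
intros h1 h2 hb. assert (hm : 0 < m) by lra.
assert (hd : forall t, 0 < m + t -> Rpower (m + t) b <= Rpower m b * (1 + b * (t / m))).
{ intros t ht. replace (m + t) with (m * ((m + t) / m)) by (field; lra).
  assert (0 < (m + t) / m) by (apply Rdiv_lt_0_compat; trivial).
  rewrite <- Rpower_mult_distr by trivial.
  apply Rmult_le_compat_l; [left; apply exp_pos|].
  eapply Rle_trans; [apply bernoulli_Rpower; trivial|]. right. field. lra. }
pose proof (hd k ltac:(lra)). pose proof (hd (- k) ltac:(lra)).
replace (m + - k) with (m - k) in * by ring.
replace (Rpower m b * (1 + b * (- k / m))) with (Rpower m b * (1 - b * (k / m))) in * by (field; lra).
lra.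
Qed.

Lemma INR_succ_ge1 j : 1 <= INR (j + 1).
Proof. rewrite plus_INR. pose proof (pos_INR j). simpl. lra. Qed.

Lemma usual_weight_comparable alpha : comparable (usual_weight alpha) alpha.
Proof. exists 1, 1. unfold usual_weight. repeat split; lra. Qed.

Lemma usual_weight_std b : 0 <= b <= 1 -> std_weight (usual_weight b).
Proof.
intros hb. split.
- intros j. unfold usual_weight. pose proof (INR_succ_ge1 j).
  rewrite <- (Rpower_O (INR (j + 1))) by lra. apply Rle_Rpower; lra.
- exists 1. split; [lra|]. intros j. unfold usual_weight.
  pose proof (INR_succ_ge1 j) as hj. set (m := INR (j + 1)) in *.
  change (S j + 1)%nat with (S (j + 1)). rewrite S_INR. fold m.
  split; [apply Rle_Rpower_l; lra|].
  replace (m + 1) with (m * (1 + / m)) by (field; lra).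
  assert (him : 0 < / m) by (apply Rinv_0_lt_compat; lra).
  rewrite <- Rpower_mult_distr by lra.
  assert (h1 : Rpower (1 + / m) b <= 1 + / m).
  { eapply Rle_trans; [apply bernoulli_Rpower; lra|]. nra. }
  assert (h2 : Rpower m b <= m).
  { rewrite <- (Rpower_1 m) at 2 by lra. apply Rle_Rpower; lra. }
  assert (h3 : 0 < Rpower m b) by apply exp_pos.
  apply Rle_trans with (Rpower m b * (1 + / m)); [apply Rmult_le_compat_l; lra|].
  assert (Rpower m b * / m <= m * / m) by (apply Rmult_le_compat_r; lra).
  rewrite Rinv_r in * by lra. lra.
Qed.

Lemma factor_op_zero f : factor_op (RtoC 0) f = fshift f.
Proof.
assert (h : kernel_op (Cconj (RtoC 0)) f = f).
{ apply kernel_op_uniq. seq_ext j. unfold seq_sub, seq_scal. apply injective_projections; simpl; ring. }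
unfold factor_op. rewrite h. seq_ext j. unfold seq_sub, seq_scal. ring.
Qed.

Lemma blaschke_op_repeat_zero k f : blaschke_op (repeat (RtoC 0) k) f = Nat.iter k fshift f.
Proof. induction k; simpl; trivial. rewrite factor_op_zero, IHk. trivial. Qed.

Lemma repeat_zero_in_disc k : in_disc (repeat (RtoC 0) k).
Proof.
induction k; simpl; constructor; trivial. rewrite Cmod_0. lra.
Qed.

Lemma in_l2_iter_bshift k x : in_l2 ones x -> in_l2 ones (Nat.iter k bshift x).
Proof. intros hx. induction k; simpl; trivial. apply in_l2_bshift; trivial. Qed.

Lemma pairing_iter_shift k f x : in_l2 ones f -> in_l2 ones x ->
  pairing ones (Nat.iter k fshift f) x = pairing ones f (Nat.iter k bshift x).
Proof.
revert x. induction k; intros x hf hx; simpl; trivial.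
rewrite pairing_fshift_bshift; trivial.
- rewrite IHk; trivial; [|apply in_l2_bshift; trivial].
  f_equal. clear. induction k; simpl; congruence.
- clear - hf. induction k; simpl; trivial. apply in_l2_fshift; trivial. exact ones_admissible.
Qed.

(** The weight in which a sequence has the [W]-norm of its backward shift. *)
Definition zero_cons (W : nat -> R) : nat -> R := fun j => match j with O => 0 | S i => W i end.

Lemma in_l2_bshift_zero_cons W a : in_l2 W (bshift a) <-> in_l2 (zero_cons W) a.
Proof. unfold in_l2. symmetry. apply (ex_series_incr_1 (fun j => Cmod (a j) ^ 2 * zero_cons W j)). Qed.

Lemma normsq_bshift_zero_cons W a : in_l2 W (bshift a) -> normsq W (bshift a) = normsq (zero_cons W) a.
Proof.
intros h. apply in_l2_bshift_zero_cons in h. unfold normsq. rewrite (Series_incr_1 (fun j => Cmod (a j) ^ 2 * zero_cons W j)); trivial.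
simpl. unfold bshift. ring.
Qed.

Lemma normsq_iter_bshift W k a : in_l2 W (Nat.iter k bshift a) ->
  in_l2 (Nat.iter k zero_cons W) a /\ normsq W (Nat.iter k bshift a) = normsq (Nat.iter k zero_cons W) a.
Proof.
revert W. induction k; intros W h; simpl in *; [auto|].
rewrite normsq_bshift_zero_cons by trivial. apply in_l2_bshift_zero_cons in h.
destruct (IHk _ h) as [h1 h2].
assert (he : Nat.iter k zero_cons (zero_cons W) = zero_cons (Nat.iter k zero_cons W)) by (clear; induction k; simpl; congruence).
rewrite he in *. auto.
Qed.

Lemma normsq_iter_fshift W k a : in_l2 W (Nat.iter k fshift a) ->
  in_l2 (fun j => W (j + k)%nat) a /\ normsq W (Nat.iter k fshift a) = normsq (fun j => W (j + k)%nat) a.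
Proof.
revert W. induction k; intros W h; simpl in *.
- replace (fun j => W (j + 0)%nat) with W; [auto|].
  apply functional_extensionality; intros j. f_equal. lia.
- assert (h0 := proj1 (in_l2_fshift_iff _ _) h). destruct (IHk _ h0) as [h1 h2].
  replace (fun j => W (j + S k)%nat) with (fun j => W (S (j + k)))
    by (apply functional_extensionality; intros j; f_equal; lia).
  split; trivial. rewrite <- h2. unfold normsq. rewrite Series_incr_1 by exact h.
  simpl. rewrite Cmod_0. ring.
Qed.

Lemma iter_zero_cons k W j : Nat.iter k zero_cons W j = if le_dec k j then W (j - k)%nat else 0.
Proof.
revert j. induction k; intros j; simpl.
- f_equal. lia.
- destruct j; simpl; [destruct (le_dec (S k) 0); lia || trivial|].
  rewrite IHk. destruct (le_dec k j), (le_dec (S k) (S j)); trivial; lia.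
Qed.

(** The adjoint of [z^k] drops [k] coefficients, so the inequality holds index by index. For
    [j >= k] it is concavity of [t^b]. For [j < k] the term at [j - k] is absent, and
    [j + k + 1 <= (k+1) (j+1)] reduces it to [(k+1)^b <= 2], which is exactly the case [j = 0]. *)
Lemma shift_adjoint_inequality b k : 0 <= b <= 1 -> Rpower (INR k + 1) b <= 2 ->
  adjoint_inequality (repeat (RtoC 0) k) (usual_weight b).
Proof.
intros hb hk x y hx hy hxy.
assert (hstd := usual_weight_std b hb).
assert (hx1 := std_weight_ones _ _ hstd hx). assert (hy1 := std_weight_ones _ _ hstd hy).
assert (hbx := in_l2_iter_bshift k x hx1).
assert (hyx : y = Nat.iter k bshift x).
{ set (d := seq_sub y (Nat.iter k bshift x)).
  assert (hd : in_l2 ones d) by (apply in_l2_seq_sub; trivial; exact ones_pos).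
  assert (h0 : normsq ones d = 0).
  { rewrite normsq_pairing. unfold d at 2. rewrite pairing_ones_sub_r; trivial.
    rewrite <- hxy, blaschke_op_repeat_zero, pairing_iter_shift; trivial. ring. }
  apply normsq_eq0 in h0; trivial; [|intros; unfold ones; lra].
  seq_ext j. pose proof (equal_f h0 j) as hj. unfold d, seq_sub, seq_zero in hj.
  replace (y j) with (Cplus (Nat.iter k bshift x j) (Cminus (y j) (Nat.iter k bshift x j))) by ring.
  rewrite hj. ring. }
assert (hT : in_l2 (usual_weight b) (Nat.iter k fshift x)).
{ rewrite <- blaschke_op_repeat_zero. apply in_l2_blaschke_op; trivial; [apply std_weight_admissible; trivial|apply repeat_zero_in_disc]. }
rewrite blaschke_op_repeat_zero. rewrite hyx in hy |- *.
destruct (normsq_iter_bshift _ _ _ hy) as [h1 ->]. destruct (normsq_iter_fshift _ _ _ hT) as [h2 ->].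
unfold normsq. rewrite <- Series_plus, <- Series_scal_l by trivial.
apply series_le_of_ex.
- intros j. rewrite iter_zero_cons.
  assert (hw : (if le_dec k j then usual_weight b (j - k) else 0) + usual_weight b (j + k) <= 2 * usual_weight b j).
  { unfold usual_weight. destruct (le_dec k j) as [hkj|hkj].
    - replace (INR (j - k + 1)) with (INR (j + 1) - INR k)
        by (rewrite !plus_INR, minus_INR by trivial; simpl; ring).
      replace (INR (j + k + 1)) with (INR (j + 1) + INR k) by (rewrite !plus_INR; simpl; ring).
      apply Rpower_second_difference; trivial; [|apply pos_INR].
      apply le_INR in hkj. rewrite plus_INR. simpl. lra.
    - rewrite Rplus_0_l. pose proof (pos_INR j). pose proof (pos_INR k).
      apply Rle_trans with (Rpower ((INR k + 1) * INR (j + 1)) b).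
      + apply Rle_Rpower_l; [lra|]. rewrite !plus_INR. simpl. split; [lra|]. nra.
      + rewrite <- Rpower_mult_distr; [|lra|pose proof (INR_succ_ge1 j); lra].
        apply Rmult_le_compat_r; trivial. left; apply exp_pos. }
  pose proof (pow2_ge_0 (Cmod (x j))). rewrite <- Rmult_plus_distr_l.
  replace (2 * (Cmod (x j) ^ 2 * usual_weight b j)) with (Cmod (x j) ^ 2 * (2 * usual_weight b j)) by ring.
  apply Rmult_le_compat_l; trivial.
- apply ex_series_R_plus; trivial.
- apply ex_series_R_scal; trivial.
Qed.

Lemma fold_blaschke_zero (z : C) k :
  fold_right Cmult (RtoC 1) (map (fun a => blaschke_factor a z) (repeat (RtoC 0) k)) = Cpow z k.
Proof.
induction k; simpl; trivial. rewrite IHk. f_equal. unfold blaschke_factor.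
replace (Cminus (RtoC 1) (Cmult (Cconj (RtoC 0)) z)) with (RtoC 1)
  by (apply injective_projections; simpl; ring).
field.
Qed.

(** * The general Blaschke product and the powers of [z] *)

Theorem theorem3p3 (alpha : R) (N : nat) (B : dfun)
  (halpha : -1 <= alpha <= 1)
  (hB : finite_blaschke N B) (hN : (1 <= N)%nat) :
  (exists nrmB : dfun -> R,
     equivalent_norms alpha nrmB (usual_norm alpha) /\
     wandering_for_norm alpha nrmB B) /\
  (forall k : nat, (1 <= k)%nat ->
     (forall z : unit_disc, B z = Cpow (proj1_sig z) k) ->
     0 <= Rabs alpha <= ln 2 / ln (INR k + 1) ->
     wandering_for_norm alpha (usual_norm alpha) B).
Proof.
assert (hab : 0 <= Rabs alpha <= 1) by (split; [apply Rabs_pos|apply Rabs_le; lra]).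
split.
- destruct hB as [theta [zeros [hlen hBz]]].
  destruct zeros as [|a0 zeros]; [simpl in hlen; lia|].
  set (a := proj1_sig a0). set (l' := map (@proj1_sig C _) zeros : list C).
  assert (ha : Cmod a < 1) by exact (proj2_sig a0).
  assert (hl' : in_disc l').
  { unfold l'. clear. induction zeros as [|b zeros IH]; simpl; constructor; trivial. exact (proj2_sig b). }
  destruct (adjoint_weight_exists a l' (Rabs alpha) ha hl' hab) as [Q [hQ [hQc hI]]].
  assert (hW : exists W, comparable W alpha /\ (W = Q \/ W = (fun j => / Q j))).
  { destruct (Rle_dec 0 alpha) as [h|h].
    - exists Q. rewrite Rabs_pos_eq in hQc by trivial. auto.
    - exists (fun j => / Q j). split; auto. apply comparable_kernel_op in hQc.
      rewrite Rabs_left, Ropp_involutive in hQc by lra. trivial. }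
  destruct hW as [W [hWc hWQ]]. exists (wnorm W).
  split; [apply wnorm_equivalent; trivial|].
  apply (weight_wandering_for_norm alpha W Q a l' (cos theta, sin theta)); trivial; [lra| |].
  + pose proof (sin2_cos2 theta) as h. unfold Rsqr in h. unfold Cmod. simpl.
    transitivity (sqrt 1); [f_equal; lra|apply sqrt_1].
  + intros z. rewrite hBz. f_equal. simpl. f_equal. unfold l'. rewrite map_map. trivial.
- intros k hk hBk [_ hak].
  assert (hlnk : 0 < ln (INR k + 1)).
  { rewrite <- ln_1. apply ln_increasing; [lra|]. apply le_INR in hk. simpl in hk. lra. }
  assert (hpow : Rpower (INR k + 1) (Rabs alpha) <= 2).
  { rewrite <- (exp_ln 2) by lra. unfold Rpower.
    assert (hle : Rabs alpha * ln (INR k + 1) <= ln 2).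
    { apply Rmult_le_reg_r with (/ ln (INR k + 1)); [apply Rinv_0_lt_compat; trivial|].
      rewrite Rmult_assoc, Rinv_r by lra. unfold Rdiv in hak. lra. }
    destruct hle as [hlt|heq]; [left; apply exp_increasing; trivial|right; rewrite heq; trivial]. }
  pose proof (shift_adjoint_inequality (Rabs alpha) k hab hpow) as hI.
  (* One zero is singled out, as its factor provides the strict contraction [rho]. *)
  destruct k as [|k']; [lia|].
  change (wandering_for_norm alpha (wnorm (usual_weight alpha)) B).
  apply (weight_wandering_for_norm alpha (usual_weight alpha) (usual_weight (Rabs alpha)) (RtoC 0) (repeat (RtoC 0) k') (RtoC 1)).
  + lra.
  + apply usual_weight_comparable.
  + rewrite Cmod_0; lra.
  + apply repeat_zero_in_disc.
  + apply Cmod_1.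
  + intros z. rewrite hBk, <- fold_blaschke_zero. simpl. ring.
  + apply usual_weight_std; trivial.
  + exact hI.
  (* The usual weight is [Q] or [1/Q] exactly, not only up to constants, so the usual norm itself is
     obtained. *)
  + destruct (Rle_dec 0 alpha) as [h|h]; [left; rewrite Rabs_pos_eq; trivial|right].
    apply functional_extensionality; intros j. unfold usual_weight. rewrite Rabs_left by lra.
    rewrite Rpower_Ropp, Rinv_inv. trivial.
Qed.
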